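(* Let $d\ge 2$ and $r\ge 2$ be integers and let $A$ be a real $d\times d$ Frolov matrix (as defined in the context). There exist a constant $c(d,A,r)>0$ and a constant $C(d,A,r)$, depending only on $d,A,r$, such that for every $a>1$ and every $v\ge v_0:=c(d,A,r)a^{-d}$ the point set $\xi=\xi(a,A)$ (defined in the context) satisfies $$ \tilde D^{r,o}(\xi,v)\le C(d,A,r)\,a^{-rd}\,\big(\log(2v/v_0)\big)^{d-1}. $$
   Context: **Frolov matrix.** A real $d\times d$ (invertible) matrix $A$ is called here a Frolov matrix if, writing $L(\mathbf m)=A\mathbf m=(L_1(\mathbf m),\dots,L_d(\mathbf m))^T$ for column vectors $\mathbf m\in\mathbb{Z}^d$, it satisfies: (1) $\left|\prod_{j=1}^d L_j(\mathbf m)\right|\ge 1$ for all $\mathbf m\in\mathbb{Z}^d$, $\mathbf m\ne\mathbf 0$; (2) each parallelepiped $P$ with volume $|P|$ whose edges are parallel to the coordinate axes contains no more than $|P|+1$ lattice points $L(\mathbf m)$, $\mathbf m\in\mathbb{Z}^d$. **Point set.** For $a>1$ let $\{\eta^\mu\}_{\mu=1}^m$ be an enumeration (with $m=m(a,A)$) of the finite set $\left\{\frac{(A^{-1})^T\mathbf m}{a}:\mathbf m\in\mathbb{Z}^d\right\}\cap[-1/2,3/2)^d$, and let $\xi=\xi(a,A):=\{\xi^\mu\}_{\mu=1}^m$, where $\xi^\mu:=\{\eta^\mu\}\in[0,1)^d$ is the vector of coordinatewise fractional parts of $\eta^\mu$. **Hat functions.** For $u>0$ let $h^1(x,u):=\chi_{[-u/2,u/2)}(x)$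 (characteristic function of the interval, $x\in\mathbb{R}$), and inductively $h^r(\cdot,u):=h^{r-1}(\cdot,u)*h^1(\cdot,u)$ for $r\ge2$, where $(f*g)(x)=\int_{\mathbb{R}}f(x-y)g(y)\,dy$. In particular $h^2(x,u)=\max(u-|x|,0)$. For $\mathbf x,\mathbf z\in\mathbb{R}^d$ and $\mathbf u\in(0,\infty)^d$ let $h^r(\mathbf x,\mathbf z,\mathbf u):=\prod_{j=1}^d h^r(x_j-z_j,u_j)$. Its periodization in $\mathbf x$ is $\tilde h^r(\mathbf x,\mathbf z,\mathbf u):=\sum_{\mathbf m\in\mathbb{Z}^d}h^r(\mathbf m+\mathbf x,\mathbf z,\mathbf u)$. Also $pr(\mathbf u):=\prod_{j=1}^d u_j$. **Periodic fixed volume discrepancy.** For a point set $\xi=\{\xi^\mu\}_{\mu=1}^m\subset[0,1)^d$ and $v>0$, $$\tilde D^{r,o}(\xi,v):=\inf_{\lambda_1,\dots,\lambda_m\in\mathbb{R}}\ \sup_{\substack{\mathbf z\in[0,1)^d\\ \mathbf u\in(0,1/2]^d,\ pr(\mathbf u)=v}}\left|\int_{[0,1)^d}\tilde h^r(\mathbf x,\mathbf z,\mathbf u)\,d\mathbf x-\sum_{\mu=1}^m\lambda_\mu\tilde h^r(\xi^\mu,\mathbf z,\mathbf u)\right|,$$ where the supremum over an empty set (which occurs when $v>2^{-d}$) is taken to be $0$. *)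

(* Defs.v *)
From HB Require Import structures.
From mathcomp Require Import all_boot all_order all_algebra.
From mathcomp Require Import finmap.
From mathcomp Require Import all_classical all_reals all_analysis.
From mathcomp Require Import zify lra.

Set Implicit Arguments.
Unset Strict Implicit.
Unset Printing Implicit Defensive.

Import Order.TTheory GRing.Theory Num.Theory.
Import numFieldNormedType.Exports.

Local Open Scope classical_set_scope.
Local Open Scope ring_scope.

Section frolov.
Context {R : realType} {d : nat}.
Implicit Types (A : 'M[R]_d) (m : 'cV[int]_d) (lo hi x z u : 'cV[R]_d).

Definition int_vec m : 'cV[R]_d := map_mx intr m.

Definition frac_vec x : 'cV[R]_d :=
  map_mx (fun t => t - (Num.floor t)%:~R) x.

Definition pr u : R := \prod_j u j 0.

Definition closed_box lo hi : set 'cV[R]_d :=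
  [set x | forall j, lo j 0 <= x j 0 <= hi j 0].

Definition lattice A : set 'cV[R]_d := range (fun m => A *m int_vec m).

Definition frolov_matrix A : Prop :=
  [/\ A \in unitmx,
      forall m, m != 0 -> 1 <= `|\prod_j (A *m int_vec m) j 0| &
      forall lo hi, (forall j, lo j 0 <= hi j 0) ->
        let S := lattice A `&` closed_box lo hi in
        finite_set S /\ #|` fset_set S|%:R <= pr (hi - lo) + 1].

Definition frolov_set (a : R) A : set 'cV[R]_d :=
  [set a^-1 *: ((invmx A)^T *m int_vec m) | m in setT] `&`
  [set x | forall j, - (1 / 2) <= x j 0 < 3 / 2].

Lemma finite_frolov_set (a : R) A :
  A \in unitmx -> 0 < a -> finite_set (frolov_set a A).
Proof.
move=> Au a0.
pose N : nat := \max_j (Num.truncn (\sum_k a * `|A k j| * 2)).+1.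
pose T := {ffun 'I_d -> 'I_(N + N).+1}.
pose f (g : T) : 'cV[R]_d :=
  a^-1 *: ((invmx A)^T *m int_vec (\col_j ((g j)%:Z - N%:Z))).
apply: (@sub_finite_set _ _ (range f)).
  2: by apply: finite_image; exact: finite_finset.
move=> x [[m _ <-{x}]]; set x := _ *: _ => /= xb.
have mE j : (m j 0)%:~R = \sum_k a * A k j * x k 0.
  have : int_vec m = a *: (A^T *m x).
    rewrite /x -scalemxAr scalerA divff ?gt_eqF// scale1r mulmxA.
    by rewrite trmx_inv mulmxV ?mul1mx// unitmx_tr.
  move=> /matrixP/(_ j 0); rewrite !mxE => ->; rewrite mulr_sumr.
  by apply: eq_bigr => k _; rewrite mxE mulrA.
have mN j : `|m j 0| <= N%:Z.
  rewrite -(ler_int R) intr_norm mE.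
  have h : `|\sum_k a * A k j * x k 0| <= \sum_k a * `|A k j| * 2.
    apply: (le_trans (ler_norm_sum _ _ _)); apply: ler_sum => k _.
    rewrite !normrM (gtr0_norm a0) ler_wpM2l ?mulr_ge0 ?(ltW a0)//.
    have /andP[x1 x2] := xb k; rewrite ler_norml; lra.
  apply: (le_trans h); apply: (le_trans (ltW (truncnS_gt _))).
  by rewrite ler_nat; apply: (leq_bigmax j).
have gP j : (absz (m j 0 + N%:Z)%R < (N + N).+1)%N by have := mN j; lia.
exists [ffun j => Ordinal (gP j)] => //.
rewrite /f /x; congr (_ *: (_ *m int_vec _)).
apply/colP => j; rewrite mxE ffunE /=; have := mN j; lia.
Qed.

(* Distinct $\eta^\mu$ may have equal fractional parts, so the $\xi^\mu$ form a
   sequence, possibly with repetitions. *)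
Definition frolov_points (a : R) A : seq 'cV[R]_d :=
  [seq frac_vec x | x <- fset_set (frolov_set a A)].

End frolov.

Section hat.
Context {R : realType}.

Definition conv (f g : R -> R) (x : R) : R :=
  \int[lebesgue_measure]_y (f (x - y) * g y).

Definition hat1 (u : R) : R -> R := \1_(`[- (u / 2), u / 2[).

(* $h^r(\cdot,u)$ for $r \ge 1$, by $r-1$ convolutions with $h^1(\cdot,u)$. *)
Definition hat (r : nat) (u : R) : R -> R :=
  iter r.-1 (fun f => conv f (hat1 u)) (hat1 u).

Context {d : nat}.
Implicit Types x z u : 'cV[R]_d.

Definition hatd (r : nat) x z u : R :=
  \prod_j hat r (u j 0) (x j 0 - z j 0).

(* For positive $u$ only finitely many terms are nonzero, so that the finitely
   supported sum is the full sum over $Z^d$. *)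
Definition hat_per (r : nat) x z u : R :=
  \sum_(m \in [set: 'cV[int]_d]) hatd r (int_vec m + x) z u.

End hat.

Section lebesgue.
Context {R : realType}.
Local Notation RT := (measurableTypeR R).

Section cons_measure.
Variables (n : nat) (mu : {sigma_finite_measure set (n.-tuple RT) -> \bar R}).

Definition tcons (p : RT * n.-tuple RT) : n.+1.-tuple RT :=
  [tuple of p.1 :: p.2].

Lemma measurable_tcons : measurable_fun setT tcons.
Proof. exact: measurable_cons. Qed.

Definition cons_measure : set (n.+1.-tuple RT) -> \bar R :=
  pushforward (lebesgue_measure \x mu)%E tcons.

Local Notation push := (measure_function_pushforward__canonical__measure_function_Measure
  (lebesgue_measure \x mu)%E measurable_tcons).

Let cons_measure0 : cons_measure set0 = 0%E.
Proof. exact: (measure0 push). Qed.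

Let cons_measure_ge0 B : (0 <= cons_measure B)%E.
Proof. exact: (measure_ge0 push). Qed.

Let cons_measure_sigma_additive : semi_sigma_additive cons_measure.
Proof. exact: (@measure_semi_sigma_additive _ _ _ push). Qed.

HB.instance Definition _ := isMeasure.Build _ _ _ cons_measure
  cons_measure0 cons_measure_ge0 cons_measure_sigma_additive.

Let cons_measure_sigma_finite : sigma_finite setT cons_measure.
Proof.
have /sigma_finiteP[F [TF ndF Foo]] :=
  sigma_finiteT (lebesgue_measure : {sigma_finite_measure set RT -> \bar R}).
have /sigma_finiteP[G [TG ndG Goo]] := sigma_finiteT mu.
pose g (t : n.+1.-tuple RT) : RT * n.-tuple RT :=
  (thead t, [tuple of behead t]).
have Kg p : g (tcons p) = p.
  by case: p => x t; congr pair; apply/val_inj.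
have mg : measurable_fun setT g.
  by apply/measurable_fun_pair; [exact: measurable_tnth|
                                 exact: measurable_behead].
exists (fun k => g @^-1` (F k `*` G k)).
  rewrite -preimage_bigcup; apply/seteqP; split=> // t _ /=.
  have [i _ Fi] : (\bigcup_i F i) (g t).1 by rewrite -TF.
  have [j _ Gj] : (\bigcup_i G i) (g t).2 by rewrite -TG.
  exists (maxn i j) => //; split.
    by move: Fi; exact/subsetPset/ndF/leq_maxl.
  by move: Gj; exact/subsetPset/ndG/leq_maxr.
move=> k; have [mF Fk] := Foo k; have [mG Gk] := Goo k.
have mFG : measurable (F k `*` G k) by exact: measurableX.
split; first by rewrite -[X in measurable X]setTI; exact: mg.
rewrite /cons_measure /pushforward (_ : _ @^-1` _ = F k `*` G k); last first.
  by apply/funext => p; rewrite /preimage /mkset Kg.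
by rewrite product_measure1E// lte_mul_pinfty// ge0_fin_numE.
Qed.

HB.instance Definition _ := Measure_isSigmaFinite.Build _ _ _ cons_measure
  cons_measure_sigma_finite.

End cons_measure.

(* Lebesgue measure on $R^n$, by iterated products; the library provides the
   product sigma-algebra on [n.-tuple] but not on column vectors. *)
Fixpoint lebesgue_tuple (n : nat) :
    {sigma_finite_measure set (n.-tuple RT) -> \bar R} :=
  match n with
  | 0 => [the {sigma_finite_measure set (0.-tuple RT) -> \bar R}
            of \d_([tuple] : 0.-tuple RT)]
  | n'.+1 => [the {sigma_finite_measure set (n'.+1.-tuple RT) -> \bar R}
            of cons_measure (lebesgue_tuple n')]
  end.

Definition cube_integral (d : nat) (f : 'cV[R]_d -> R) : R :=
  \int[lebesgue_tuple d]_(t in [set t | forall j, 0 <= tnth t j < 1])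
    f (\col_j tnth t j).

End lebesgue.

Section discrepancy.
Context {R : realType} {d : nat}.

Definition per_error (r : nat) (xi : seq 'cV[R]_d)
    (lambda : 'I_(size xi) -> R) (z u : 'cV[R]_d) : R :=
  cube_integral (fun x => hat_per r x z u)
  - \sum_(mu < size xi) lambda mu * hat_per r (tnth (in_tuple xi) mu) z u.

(* Adding $0$ to the set of (nonnegative) errors only matters when no $u$ is
   admissible. *)
Definition per_disc (r : nat) (xi : seq 'cV[R]_d) (v : R) : \bar R :=
  ereal_inf [set
    ereal_sup (0%E |` [set `|per_error r lambda zu.1 zu.2|%:E | zu in
        [set zu : 'cV[R]_d * 'cV[R]_d |
          [/\ forall j, 0 <= zu.1 j 0 < 1,
              forall j, 0 < zu.2 j 0 <= 1 / 2 &
              pr zu.2 = v]]])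
    | lambda in [set: 'I_(size xi) -> R]].

End discrepancy.

(* Main.v *)
Require Import Defs.
From mathcomp Require Import all_boot all_order all_algebra finmap.
From mathcomp Require Import all_classical all_reals all_analysis.
From mathcomp Require Import measurable_realfun.
From mathcomp Require complex.
From mathcomp Require Import ring lra zify.

Set Implicit Arguments.
Unset Strict Implicit.
Unset Printing Implicit Defensive.

Import Order.TTheory GRing.Theory Num.Theory.
Import numFieldNormedType.Exports.

Local Open Scope classical_set_scope.
Local Open Scope ring_scope.

(** Let [eta] run through the lattice [dual A a], that is [a^-1 A^-T Z^d], and let
    [psi = tplateau S] be a smooth function supported in [[-1/2, 3/2]^d] whose integer
    translates sum to one. The formula gives [eta] the weight [psi eta / kappa], where
    [kappa] is the sum of [psi] over the lattice. Since [psi] vanishes outside the box,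
    the integrand is 1-periodic, and points that agree modulo 1 just add their weights,
    the cubature sum is the lattice sum of [psi] times the integrand, divided by [kappa].

    The integrand is a product of periodized box splines of one variable. Each of them
    is a uniform limit of cosine polynomials whose coefficients are bounded by a
    constant times [omega u k ^+ r], with [omega u k = min(u, 1/|k|)]
    ([trig_approxP]). The weights sum to one, so the frequency zero is integrated
    exactly, and the error is at most a constant times the sum over [k != 0] of
    [\prod_j omega (u_j) (k_j) ^+ r] times the modulus of [Lambda k], the normalized
    lattice sum of [psi] times the wave of frequency [k].

    Two frequencies that differ by a point of the dual lattice [a A Z^d] give waves that
    agree on the quadrature lattice ([wsum_residue]). So write [k = a A m + w] with [w] in
    the fundamental cell.

    If [m != 0], summation by parts along the generators of the lattice shows that
    [Lambda k] is at most a constant times [\prod_j (1 + |w_j|) ^- 2r]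
    ([wave_sum_decay], [wsum_prod_decay]). Replacing [k] by [a A m] inside [omega] costs
    at most a factor [1 + |w_j|] per coordinate, and what remains is summable over [w].
    The sum over [m != 0] is a dyadic count over the Frolov lattice ([frolov_sum]): the
    lower bound on the products of coordinates excludes all dyadic boxes with small total
    exponent, the counting property bounds the number of points in the others, and the
    number of boxes of given total exponent is responsible for the power [d - 1] of the
    logarithm.

    If [m = 0], then [k] itself lies in the cell, and [Lambda k = O(a^-rd)]
    ([wave_sum_small]). Large [k] are covered by the decay just mentioned. For small [k]
    the lattice sum is compared with its translates: a lattice sum of a smooth function
    hardly depends on the translation, being periodic with all its derivatives along each
    generator ([latsum_osc]); and its average over long translations along a coordinate
    axis is negligible, since half a period of the wave changes its sign while the
    integer translates of [psi] sum to one ([latsum_wave_average]).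

    The number of dyadic levels is about the logarithm of [a^d v], which gives the bound
    for [a] large enough to have [kappa >= c a^d]; and [v >= v0] makes [a] large as soon
    as there is an admissible [u], because then [v <= 1]. *)

(** * One-variable calculus *)

Section calculus.
Context {R : realType}.
Implicit Types f g : R -> R.

Lemma is_derive1D f g (x df dg : R) : is_derive x 1 f df -> is_derive x 1 g dg ->
  is_derive x 1 (fun y => f y + g y) (df + dg).
Proof. by move=> h1 h2; exact: (is_deriveD h1 h2). Qed.

Lemma is_derive1B f g (x df dg : R) : is_derive x 1 f df -> is_derive x 1 g dg ->
  is_derive x 1 (fun y => f y - g y) (df - dg).
Proof. by move=> h1 h2; exact: (is_deriveB h1 h2). Qed.

Lemma is_derive1M f g (x df dg : R) : is_derive x 1 f df -> is_derive x 1 g dg ->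
  is_derive x 1 (fun y => f y * g y) (df * g x + f x * dg).
Proof.
move=> h1 h2; apply: (is_derive_eq (is_deriveM h1 h2)).
by rewrite /GRing.scale /= addrC (mulrC (g x)).
Qed.

Lemma is_derive1_affine f (c k x df : R) : is_derive (c + x * k) 1 f df ->
  is_derive x 1 (fun y => f (c + y * k)) (df * k).
Proof.
move=> h; apply: (@is_derive1_comp _ f (fun y => c + y * k)) => //.
have h2 : is_derive x 1 (fun y : R => y * k) k.
  by apply: (is_derive_eq (is_derive1M (is_derive_id x 1) (is_derive_cst k x 1)));
     rewrite mul1r mulr0 addr0.
by apply: (is_derive_eq (is_derive1D (is_derive_cst c x 1) h2)); rewrite add0r.
Qed.

Lemma is_derive1_quadratic f (x df C : R) :
  (forall h, `|f (x + h) - f x - df * h| <= C * h ^+ 2) -> is_derive x 1 f df.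
Proof.
move=> H.
have C0 : 0 <= C.
  by have h := H 1; rewrite expr1n !mulr1 in h; exact: (le_trans (normr_ge0 _) h).
suff cv : h^-1 *: (f (h *: 1 + x) - f x) @[h --> 0^'] --> df.
  apply: DeriveDef; first by apply/cvg_ex; exists df.
  exact: cvg_lim.
apply/cvgrPdist_le => e e0; near=> h.
have h0 : h != 0 by near: h; exact: nbhs_dnbhs_neq.
rewrite [_ *: 1]mulr1 [_ *: _]/(_ * _) (addrC h).
have -> : df - h^-1 * (f (x + h) - f x) = - (f (x + h) - f x - df * h) / h.
  by field.
rewrite normrM normrN normfV ler_pdivrMr ?normr_gt0//.
apply: (le_trans (H h)).
rewrite -normr_id -real_normK ?num_real// expr2 mulrA normr_id ler_wpM2r//.
have : `|h| <= e / (C + 1).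
  near: h; apply: dnbhs0_le; rewrite divr_gt0//; lra.
rewrite ler_pdivlMr; last lra.
by move=> Hh; apply: le_trans Hh; rewrite mulrC ler_wpM2l//; lra.
Unshelve. all: by end_near. Qed.

Lemma is_derive1_continuous f (x df : R) : is_derive x 1 f df ->
  {for x, continuous f}.
Proof. by move=> h; apply: differentiable_continuous; apply/derivable1_diffP. Qed.

Lemma mean_value f f' (a b : R) : (forall x : R, is_derive x 1 f (f' x)) -> a < b ->
  exists2 c, c \in `]a, b[ & f b - f a = f' c * (b - a).
Proof.
move=> h ab; apply: MVT => // x.
by apply: continuous_subspaceT => y; exact: is_derive1_continuous.
Qed.

Lemma mean_value_le f f' (M a b : R) : (forall x : R, is_derive x 1 f (f' x)) ->
  (forall x, `|f' x| <= M) -> `|f b - f a| <= M * `|b - a|.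
Proof.
move=> h hM; have [ab|ab|->] := ltgtP a b; last by rewrite !subrr normr0 mulr0.
  by have [c _ ->] := mean_value h ab; rewrite normrM ler_wpM2r.
have [c _ e] := mean_value h ab.
by rewrite distrC e normrM (distrC b) ler_wpM2r.
Qed.

End calculus.

(** * A smooth step and the partition of unity it generates *)

Section smooth_step.
Context {R : realType}.
Implicit Types (f g : R -> R) (p q : {poly R}).

(** The derivatives are existentially quantified one at a time, so that closure
    properties are proved by induction on [L], without iterated derivatives. *)
Fixpoint smooth1 (L : nat) (M : R) f : Prop :=
  (forall x, `|f x| <= M) /\
  if L is L'.+1 then
    exists2 f' : R -> R, (forall x : R, is_derive x 1 f (f' x)) & smooth1 L' M f'
  else True.

Lemma smooth1_bound L M f : smooth1 L M f -> forall x, `|f x| <= M.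
Proof. by case: L => [|L] []. Qed.

Lemma smooth1W L M M' f : M <= M' -> smooth1 L M f -> smooth1 L M' f.
Proof.
move=> MM; elim: L f => [|L IH] f [h1 h2]; split=> //.
- by move=> x; exact: le_trans (h1 x) MM.
- by move=> x; exact: le_trans (h1 x) MM.
- by case: h2 => f' f1 f2; exists f' => //; exact: IH.
Qed.

Lemma smooth1Z L M k f : smooth1 L M f -> smooth1 L (`|k| * M) (fun x => k * f x).
Proof.
elim: L f => [|L IH] f [h1 h2]; split=> //.
- by move=> x; rewrite normrM ler_wpM2l.
- by move=> x; rewrite normrM ler_wpM2l.
- case: h2 => f' f1 f2; exists (fun x => k * f' x); last exact: IH.
  move=> x; apply: (is_derive_eq (is_derive1M (is_derive_cst k x 1) (f1 x))).
  by rewrite mul0r add0r.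
Qed.

Lemma smooth1_diff_shift L M a b f : smooth1 L M f ->
  smooth1 L (M + M) (fun x => f (x + a) - f (x + b)).
Proof.
elim: L f => [|L IH] f [h1 h2]; split=> //.
- by move=> x; apply: (le_trans (ler_normB _ _)); exact: lerD.
- by move=> x; apply: (le_trans (ler_normB _ _)); exact: lerD.
- case: h2 => f' f1 f2; exists (fun x => f' (x + a) - f' (x + b)); last exact: IH.
  have sh (c x : R) : is_derive x 1 (fun y => f (y + c)) (f' (x + c)).
    have -> : (fun y => f (y + c)) = (fun y => f (c + y * 1)).
      by apply/funext => y; rewrite mulr1 addrC.
    rewrite -[f' _]mulr1; apply: is_derive1_affine.
    by rewrite mulr1 addrC; exact: f1.
  by move=> x; exact: is_derive1B.
Qed.

Let Y : {poly R} := 'X - 'X^2.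

(** [poly_bump p] vanishes outside [[0, 1]]; the square makes it differentiable at the
    end points even though the positive part is not. *)
Definition poly_bump p (x : R) : R := Num.max 0 Y.[x] ^+ 2 * p.[x].

Let hornerY x : Y.[x] = x - x ^+ 2.
Proof. by rewrite !hornerE. Qed.

Lemma poly_bump0 p x : ~~ (0 < x < 1) -> poly_bump p x = 0.
Proof.
move=> h; rewrite /poly_bump hornerY.
suff -> : Num.max 0 (x - x ^+ 2) = 0 by rewrite expr0n mul0r.
apply/max_l; apply: contraNT h; rewrite -ltNge => h; apply/andP; split; nra.
Qed.

Lemma poly_bump_bounded p : exists M, forall x, `|poly_bump p x| <= M.
Proof.
exists (\sum_(i < size p) `|p`_i|) => x.
have S0 : 0 <= \sum_(i < size p) `|p`_i| by apply: sumr_ge0.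
have [/andP[x0 x1]|h] := boolP (0 < x < 1); last by rewrite poly_bump0// normr0.
rewrite /poly_bump normrM -[leRHS]mul1r ler_pM//.
  rewrite ger0_norm ?sqr_ge0// hornerY max_r; last nra.
  by rewrite expr_le1//; nra.
rewrite horner_coef; apply: (le_trans (ler_norm_sum _ _ _)).
apply: ler_sum => i _; rewrite normrM -[leRHS]mulr1 ler_wpM2l//.
by rewrite normrX exprn_ile1// ger0_norm// ltW.
Qed.

Lemma is_derive_pos_sqr (t : R) :
  is_derive t 1 (fun t => Num.max 0 t ^+ 2) (2 * Num.max 0 t).
Proof.
apply: (@is_derive1_quadratic _ _ _ _ 1) => h; rewrite mul1r ler_norml.
by case: (leP t 0) => ht; case: (leP (t + h) 0) => hh; apply/andP; split; nra.
Qed.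

Lemma is_derive_poly_bumpY p (x : R) :
  is_derive x 1 (poly_bump (Y * p)) (poly_bump (Y^`() *+ 2 * p + (Y * p)^`()) x).
Proof.
have h1 : is_derive x 1 (fun x => Num.max 0 Y.[x] ^+ 2)
    (2 * Num.max 0 Y.[x] * Y^`().[x]).
  exact: (is_derive1_comp (is_derive_pos_sqr Y.[x]) (is_derive_poly Y x)).
apply: (is_derive_eq (is_derive1M h1 (is_derive_poly (Y * p) x))).
rewrite /poly_bump (hornerD (Y^`() *+ 2 * p)) mulrDr; congr (_ + _).
rewrite (hornerM Y) (hornerM (Y^`() *+ 2)) hornerMn -[in RHS]mulr_natl.
case: (leP Y.[x] 0) => hY.
  by rewrite expr0n !mulr0 !mul0r.
by move: Y.[x] (Y^`().[x]) (p.[x]) => y dy q; ring.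
Qed.

Let deriv_poly_bump_ring (T : comNzRingType) (dY YL q dq y : T) L :
  dY *+ 2 * (YL * q) + ((dY * YL) *+ L.+1 * q + (y * YL) * dq) =
  YL * (dY *+ L.+3 * q + y * dq).
Proof.
rewrite -[L.+3]/(2 + L.+1)%N mulrnDr.
rewrite -(mulr_natl (dY * YL) L.+1) -(mulr_natl dY L.+1).
move: L.+1%:R => l; ring.
Qed.

Let deriv_mulXn (y p : {poly R}) L :
  y^`() *+ 2 * (y ^+ L * p) + (y * (y ^+ L * p))^`() =
  y ^+ L * (y^`() *+ L.+3 * p + y * p^`()).
Proof.
rewrite -deriv_poly_bump_ring; congr (_ + _).
rewrite mulrA derivM; congr (_ * _ + _).
rewrite -[y * _]/(y ^+ 1 * y ^+ L) -exprD.
by rewrite (deriv_exp y L.+1).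
Qed.

(** Differentiation lowers the power of [Y] by one and preserves the shape, since
    [2 * max 0 t] times [t] is twice the square of [max 0 t]. *)
Lemma smooth1_poly_bump L p : exists M, smooth1 L M (poly_bump (Y ^+ L * p)).
Proof.
elim: L p => [|L IH] p.
  by have [M hM] := poly_bump_bounded (Y ^+ 0 * p); exists M.
have [M0 hM0] := poly_bump_bounded (Y ^+ L.+1 * p).
have [M1 hM1] := IH (Y^`() *+ L.+3 * p + Y * p^`()).
exists (Num.max M0 M1); split.
  by move=> x; rewrite le_max hM0.
exists (poly_bump (Y ^+ L * (Y^`() *+ L.+3 * p + Y * p^`()))); last first.
  by apply: smooth1W hM1; rewrite le_max lexx orbT.
by move=> x; rewrite exprS -mulrA -deriv_mulXn; exact: is_derive_poly_bumpY.
Qed.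

Lemma poly_bump_continuous p : continuous (poly_bump p).
Proof.
move=> x; apply: cvgM; last exact: is_derive1_continuous (is_derive_poly p x).
have := is_derive1_comp (is_derive_pos_sqr Y.[x]) (is_derive_poly Y x).
exact: is_derive1_continuous.
Qed.

Lemma poly_bump_antiderivative p :
  exists F : R -> R, forall x : R, is_derive x 1 F (poly_bump p x).
Proof.
have ib : lebesgue_measure.-integrable [set: R] (EFin \o poly_bump p).
  have -> : EFin \o poly_bump p = (EFin \o poly_bump p) \_ `[0, 1].
    apply/funext => x; rewrite patchE; case: ifPn => //= h; congr EFin.
    by apply: poly_bump0; apply: contraNN h => h; rewrite inE /= in_itv /=; lra.
  apply/(integrable_mkcond _ _).1 => //.
  apply: continuous_compact_integrable; first exact: segment_compact.
  by apply: continuous_subspaceT; exact: poly_bump_continuous.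
exists (fun x => \int[lebesgue_measure]_(t in [set` Interval -oo%O (BRight x)]) poly_bump p t).
move=> x.
have ib1 : lebesgue_measure.-integrable [set` Interval -oo%O (BRight (x + 1))]
    (EFin \o poly_bump p) by exact: integrableS ib.
have x1 : x < x + 1 by rewrite ltrDl.
have [d1 d2] := continuous_FTC1 x1 ib1 (ltNyr _) (@poly_bump_continuous p x).
by apply: DeriveDef; [exact: d1|rewrite -derive1E d2].
Qed.

(** A normalized antiderivative of a bump. *)
Lemma smooth_step L : exists S M,
  [/\ smooth1 L.+1 M S, forall x, x <= 0 -> S x = 0, forall x, 1 <= x -> S x = 1
    & {homo S : x y / x <= y}].
Proof.
pose b := poly_bump (Y ^+ L * 1).
have [M hM] := smooth1_poly_bump L 1.
have [F dF] := poly_bump_antiderivative (Y ^+ L * 1).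
have Y01 x : 0 < x < 1 -> 0 < Y.[x] by rewrite hornerY => /andP[]; nra.
have b0 x : 0 <= b x.
  have [h|h] := boolP (0 < x < 1); last by rewrite /b poly_bump0.
  by rewrite /b /poly_bump mulr1 horner_exp mulr_ge0 ?sqr_ge0// exprn_ge0// ltW// Y01.
have Fh x y : x <= y -> F x <= F y.
  rewrite le_eqVlt => /predU1P[->//|xy]; have [c _ e] := mean_value dF xy.
  by rewrite -subr_ge0 e mulr_ge0// subr_ge0 ltW.
have Fl x : x <= 0 -> F x = F 0.
  rewrite le_eqVlt => /predU1P[->//|xy]; have [c ci e] := mean_value dF xy.
  apply/esym/eqP; rewrite -subr_eq0 e mulf_eq0 poly_bump0 ?eqxx//.
  by move: ci; rewrite in_itv /=; lra.
have Fr x : 1 <= x -> F x = F 1.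
  rewrite le_eqVlt => /predU1P[->//|xy]; have [c ci e] := mean_value dF xy.
  apply/eqP; rewrite -subr_eq0 e mulf_eq0 poly_bump0 ?eqxx//.
  by move: ci; rewrite in_itv /=; lra.
have F10 : 0 < F 1 - F 0.
  have [c ci ->] := mean_value dF ltr01.
  rewrite subr0 mulr1 /poly_bump mulr1 horner_exp.
  move: ci; rewrite in_itv /= => /Y01 cY.
  by rewrite mulr_gt0 ?exprn_gt0// lt_max cY orbT.
pose k := (F 1 - F 0)^-1.
exists (fun x => k * (F x - F 0)), (Num.max 1 (`|k| * M)).
have k0 : 0 < k by rewrite invr_gt0.
have S0 x : x <= 0 -> k * (F x - F 0) = 0 by move=> /Fl ->; rewrite subrr mulr0.
have S1 x : 1 <= x -> k * (F x - F 0) = 1.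
  by move=> /Fr ->; rewrite mulVf// gt_eqF.
have Sh x y : x <= y -> k * (F x - F 0) <= k * (F y - F 0).
  by move=> /Fh xy; rewrite ler_wpM2l ?lerD2r ?(ltW k0).
have Sb x : `|k * (F x - F 0)| <= Num.max 1 (`|k| * M).
  rewrite le_max; apply/orP; left; rewrite ler_norml; apply/andP; split.
    rewrite (@le_trans _ _ 0)// ?lerN10//.
    have [x0|x0] := leP x 0; first by rewrite S0.
    by have := Sh _ _ (ltW x0); rewrite (S0 0 (lexx 0)).
  have [x0|x0] := leP 1 x; first by rewrite S1.
  by have := Sh _ _ (ltW x0); rewrite (S1 1 (lexx 1)).
split=> //; split=> //.
exists (fun x => k * b x).
  move=> x; apply: (is_derive_eq (is_derive1M (is_derive_cst k x 1)
    (is_derive1B (dF x) (is_derive_cst (F 0) x 1)))).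
  by rewrite mul0r add0r subr0.
by apply: (@smooth1W _ (`|k| * M)); [rewrite le_max lexx orbT|exact: smooth1Z].
Qed.

End smooth_step.

(** * Functions smooth along a fixed direction *)

Section directional.
Context {R : realType} {V : lmodType R}.
Implicit Types (b x : V) (F G : V -> R).

(** One direction at a time is what summation by parts along a lattice generator uses.
    Here [e] is the size of the generator relative to the scale on which [F] varies: each
    derivative gains a factor [e]. *)
Fixpoint lsmooth (b : V) (L : nat) (M e : R) F : Prop :=
  (forall x, `|F x| <= M) /\
  if L is L'.+1 then
    exists2 F' : V -> R,
      (forall x, is_derive (0 : R) 1 (fun s : R => F (x + s *: b)) (F' x)) &
      lsmooth b L' (M * e) e F'
  else True.

Lemma lsmooth_bound b L M e F : lsmooth b L M e F -> forall x, `|F x| <= M.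
Proof. by case: L => [|L] []. Qed.

Lemma lsmoothW b L M M' e F : 0 <= e -> M <= M' -> lsmooth b L M e F ->
  lsmooth b L M' e F.
Proof.
move=> e0; elim: L M M' F => [|L IH] M M' F MM [h1 h2]; split=> //.
- by move=> x; exact: le_trans (h1 x) MM.
- by move=> x; exact: le_trans (h1 x) MM.
- case: h2 => F' f1 f2; exists F' => //; apply: IH f2.
  by rewrite ler_wpM2r.
Qed.

Lemma lsmooth_pred b L M e F : lsmooth b L.+1 M e F -> lsmooth b L M e F.
Proof.
elim: L M F => [|L IH] M F [h1 [F' f1 f2]]; split=> //.
by exists F' => //; exact: IH.
Qed.

Lemma is_derive_along b F F' :
  (forall x, is_derive (0 : R) 1 (fun s : R => F (x + s *: b)) (F' x)) ->
  forall x (s : R), is_derive s 1 (fun s : R => F (x + s *: b)) (F' (x + s *: b)).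
Proof.
move=> h x s.
have -> : (fun s => F (x + s *: b)) =
    (fun s' => (fun r => F ((x + s *: b) + r *: b)) (- s + s' * 1)).
  apply/funext => s'; congr F; rewrite -addrA -scalerDl; congr (_ + _ *: _).
  by rewrite mulr1 addrA subrr add0r.
rewrite -[F' _]mulr1.
apply: (@is_derive1_affine _ (fun r => F (x + s *: b + r *: b)) (- s) 1 s).
by rewrite mulr1 addNr; exact: h.
Qed.

Lemma lsmoothD b L M1 M2 e F G : lsmooth b L M1 e F -> lsmooth b L M2 e G ->
  lsmooth b L (M1 + M2) e (fun x => F x + G x).
Proof.
elim: L M1 M2 F G => [|L IH] M1 M2 F G [f1 f2] [g1 g2]; split=> //.
- by move=> x; apply: (le_trans (ler_normD _ _)); exact: lerD.
- by move=> x; apply: (le_trans (ler_normD _ _)); exact: lerD.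
- case: f2 => F' f2 f3; case: g2 => G' g2 g3.
  exists (fun x => F' x + G' x); last by rewrite mulrDl; exact: IH.
  by move=> x; exact: is_derive1D.
Qed.

Lemma lsmoothZ b L M e k F : lsmooth b L M e F ->
  lsmooth b L (`|k| * M) e (fun x => k * F x).
Proof.
elim: L M F => [|L IH] M F [f1 f2]; split=> //.
- by move=> x; rewrite normrM ler_wpM2l.
- by move=> x; rewrite normrM ler_wpM2l.
- case: f2 => F' f2 f3; exists (fun x => k * F' x); last by rewrite -mulrA; exact: IH.
  move=> x; apply: (is_derive_eq (is_derive1M (is_derive_cst k (0 : R) (1 : R)) (f2 x))).
  by rewrite mul0r add0r.
Qed.

(** The product rule doubles the number of terms with each derivative. *)
Lemma lsmoothM b L M1 M2 e F G : 0 <= e ->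
  lsmooth b L M1 e F -> lsmooth b L M2 e G ->
  lsmooth b L (2 ^+ L * (M1 * M2)) e (fun x => F x * G x).
Proof.
move=> e0.
have H (m1 m2 : R) (f g : V -> R) : (forall x, `|f x| <= m1) ->
    (forall x, `|g x| <= m2) -> forall x, `|f x * g x| <= m1 * m2.
  by move=> hf hg x; rewrite normrM ler_pM.
elim: L M1 M2 F G => [|L IH] M1 M2 F G hF hG.
  by case: hF hG => f1 _ [g1 _]; split => //; rewrite expr0 mul1r; exact: H.
have [f1 [F' f2 f3]] := hF; have [g1 [G' g2 g3]] := hG.
have M12 x : `|F x * G x| <= M1 * M2 by exact: H.
split.
  move=> x; apply: (le_trans (M12 x)); rewrite ler_peMl ?exprn_ege1 ?ler1n//.
  exact: le_trans (M12 x).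
exists (fun x => F' x * G x + F x * G' x).
  move=> x; have := is_derive1M (f2 x) (g2 x).
  by rewrite scale0r addr0.
have -> : 2 ^+ L.+1 * (M1 * M2) * e =
    2 ^+ L * (M1 * e * M2) + 2 ^+ L * (M1 * (M2 * e)) by rewrite exprS; ring.
by apply: lsmoothD; apply: IH => //; exact: lsmooth_pred.
Qed.

Lemma lsmooth_prod (I : Type) (r : seq I) b L M e (F : I -> V -> R) : 0 <= e ->
  (forall i, lsmooth b L M e (F i)) ->
  lsmooth b L ((2 ^+ L * M) ^+ size r) e (fun x => \prod_(i <- r) F i x).
Proof.
move=> e0 h; elim: r => [|i r IH] /=.
  have -> : (fun x => \prod_(i <- [::]) F i x) = (fun=> 1).
    by apply/funext => x; rewrite big_nil.
  rewrite expr0.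
  have h0 n K : 0 <= K -> lsmooth b n K e (fun=> 0).
    elim: n K => [|n IH] K K0; split=> //; try by move=> x; rewrite normr0.
    by exists (fun=> 0) => [x|]; [exact: is_derive_cst|apply: IH; exact: mulr_ge0].
  case: (L) => [|n]; split=> //; try by move=> x; rewrite normr1.
  by exists (fun=> 0) => [x|]; [exact: is_derive_cst|apply: h0; rewrite mul1r].
have -> : (fun x => \prod_(j <- i :: r) F j x) =
    (fun x => F i x * \prod_(j <- r) F j x).
  by apply/funext => x; rewrite big_cons.
by rewrite exprS -mulrA; apply: lsmoothM.
Qed.

Lemma lsmooth_comp b L M e f (l : V -> R) (lb : R) : 0 <= e -> `|lb| <= e ->
  (forall x s, l (x + s *: b) = l x + s * lb) -> smooth1 L M f ->
  lsmooth b L M e (fun x => f (l x)).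
Proof.
move=> e0 lbe ll; elim: L f => [|L IH] f [f1 f2]; split=> //.
case: f2 => f' f2 f3; exists (fun x => lb * f' (l x)).
  move=> x; rewrite mulrC.
  have -> : (fun s => f (l (x + s *: b))) = (fun s => f (l x + s * lb)).
    by apply/funext => s; rewrite ll.
  by apply: is_derive1_affine; rewrite mul0r addr0; exact: f2.
have M0 : 0 <= M := le_trans (normr_ge0 _) (smooth1_bound f3 0).
apply: (@lsmoothW _ _ (`|lb| * M)) => //; first by rewrite mulrC ler_wpM2l.
by apply: lsmoothZ; exact: IH.
Qed.

Lemma lsmooth_cos b L e (l : V -> R) (lb beta : R) : 0 <= e -> `|lb| <= e ->
  (forall x s, l (x + s *: b) = l x + s * lb) ->
  lsmooth b L 1 e (fun x => cos (l x + beta)).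
Proof.
move=> e0 lbe ll; elim: L beta => [|L IH] beta; split=> //; try by move=> x; exact: cos_max.
exists (fun x => lb * cos (l x + (beta + pi / 2))).
  move=> x; have -> : (fun s => cos (l (x + s *: b) + beta)) =
      (fun s => cos (l x + beta + s * lb)).
    by apply/funext => s; rewrite ll addrAC.
  rewrite addrA cosDpihalf mulrC; apply: is_derive1_affine.
  by rewrite mul0r addr0; exact: is_derive_cos.
apply: (@lsmoothW _ _ (`|lb| * 1)) => //; first by rewrite mulr1 mul1r.
by apply: lsmoothZ; exact: IH.
Qed.

(** By the mean value theorem an increment costs one derivative. *)
Lemma lsmooth_increment b L M e F : lsmooth b L.+1 M e F ->
  lsmooth b L (M * e) e (fun x => F x - F (x + b)).
Proof.
elim: L M F => [|L IH] M F hF.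
  have [f1 [F' f2 [f3 _]]] := hF; split=> // x.
  have := mean_value_le 0 1 (is_derive_along f2 x) (fun s => f3 (x + s *: b)).
  by rewrite subr0 normr1 mulr1 scale1r scale0r addr0 distrC.
have [f1 [F' f2 f3]] := hF; split.
  move=> x.
  have := mean_value_le 0 1 (is_derive_along f2 x) (fun s => f3.1 (x + s *: b)).
  by rewrite subr0 normr1 mulr1 scale1r scale0r addr0 distrC.
exists (fun x => F' x - F' (x + b)); last exact: IH.
move=> x; apply: is_derive1B => //.
have -> : (fun s => F (x + s *: b + b)) = (fun s => F ((x + b) + s *: b)).
  by apply/funext => s; rewrite addrAC.
exact: f2.
Qed.

Lemma is_derive1_sum (I : Type) (r : seq I) (G : I -> R -> R) (G' : I -> R) (u : R) :
  (forall i, is_derive u 1 (G i) (G' i)) ->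
  is_derive u 1 (fun s => \sum_(i <- r) G i s) (\sum_(i <- r) G' i).
Proof.
move=> h; elim: r => [|i r IH].
  have -> : (fun s => \sum_(i <- [::]) G i s) = fun=> 0.
    by apply/funext => s; rewrite big_nil.
  by rewrite big_nil; exact: is_derive_cst.
have -> : (fun s => \sum_(j <- i :: r) G j s) =
    (fun s => G i s + \sum_(j <- r) G j s).
  by apply/funext => s; rewrite big_cons.
by rewrite big_cons; exact: is_derive1D.
Qed.

(** A sum of translates that takes the same value at both ends of a unit segment,
    as do its derivatives, has derivatives vanishing somewhere in between; so its
    oscillation is at most that of its derivative, and this can be iterated. The set
    [D] is a support stable under small translations, hence one for the derivatives. *)
Lemma oscillation_le (I : finType) (x : I -> V) (D : set V) b L M e F : 0 <= e ->
  (forall y, ~ D y -> \forall s \near (0 : R), ~ D (y + s *: b)) ->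
  (forall G, (forall y, ~ D y -> G y = 0) ->
     \sum_i G (x i + b) = \sum_i G (x i)) ->
  lsmooth b L M e F -> (forall y, ~ D y -> F y = 0) ->
  forall s t, 0 <= s <= 1 -> 0 <= t <= 1 ->
  `|\sum_i F (x i + s *: b) - \sum_i F (x i + t *: b)|
    <= 2 * #|I|%:R * (M * e ^+ L).
Proof.
move=> e0 Dn per; elim: L M F => [|L IH] M F hF F0 s t s01 t01.
  case: hF => f1 _; apply: (le_trans (ler_normB _ _)).
  have h u : `|\sum_i F (x i + u *: b)| <= #|I|%:R * M.
    apply: (le_trans (ler_norm_sum _ _ _)).
    rewrite -sum1_card natr_sum mulr_suml; apply: ler_sum => i _.
    by rewrite mul1r.
  by rewrite expr0 mulr1 -mulrA mulr_natl mulr2n; apply: lerD.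
have [f1 [F' f2 f3]] := hF.
pose g u := \sum_i F (x i + u *: b); pose g' u := \sum_i F' (x i + u *: b).
have dg (u : R) : is_derive u 1 g (g' u).
  by apply: is_derive1_sum => i; exact: is_derive_along.
have F'0 y : ~ D y -> F' y = 0.
  move=> Dy; rewrite -(@derive_val _ _ _ _ _ _ _ (f2 y)).
  have h : is_derive (0 : R) 1 (fun s : R => F (y + s *: b)) 0.
    apply: near_eq_is_derive (is_derive_cst 0 (0 : R) (1 : R)).
    by have := Dn _ Dy; apply: filterS => r Dr; rewrite F0.
  exact: (@derive_val _ _ _ _ _ _ _ h).
have g01 : g 0 = g 1.
  transitivity (\sum_i F (x i)).
    by apply: eq_bigr => i _; rewrite scale0r addr0.
  by rewrite -(per _ F0); apply: eq_bigr => i _; rewrite scale1r.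
have gc (a b' : R) : {within `[a, b'], continuous g}.
  by apply: continuous_subspaceT => u; exact: is_derive1_continuous (dg u).
have [c c01 dc] : exists2 c : R, c \in `]0, 1[ & is_derive c 1 g 0.
  by apply: Rolle.
have g'c : g' c = 0.
  by rewrite -(@derive_val _ _ _ _ _ _ _ (dg c)); exact: (@derive_val _ _ _ _ _ _ _ dc).
have g'le u : 0 <= u <= 1 -> `|g' u| <= 2 * #|I|%:R * (M * e ^+ L.+1).
  move=> u01; rewrite exprS (mulrA M) -[g' u]subr0 -g'c.
  by apply: IH => //; move: c01; rewrite in_itv /= => /andP[c0 c1]; rewrite !ltW.
have main (a b' : R) : 0 <= a -> b' <= 1 -> a < b' ->
    `|g b' - g a| <= 2 * #|I|%:R * (M * e ^+ L.+1).
  move=> a0 b1 ab; have [u] := mean_value dg ab.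
  rewrite in_itv /= => /andP[au ub] ->; rewrite normrM.
  rewrite -[leRHS]mulr1 ler_pM//; first by apply: g'le; lra.
  by rewrite ger0_norm; lra.
have [st|st|->] := ltgtP s t.
- by rewrite distrC; apply: main => //; lra.
- by apply: main => //; lra.
- rewrite subrr normr0 mulr_ge0 ?mulr_ge0 ?exprn_ge0//.
  exact: le_trans (normr_ge0 _) (f1 0).
Qed.

End directional.

(** * Sums over the points of a lattice *)

Lemma floor_bounds (R : realType) (x : R) :
  (Num.floor x)%:~R <= x < (Num.floor x)%:~R + 1.
Proof. by have := floor_itv x; rewrite intrD. Qed.

Section lattice_sums.
Context {R : realType} {d : nat} (B : 'M[R]_d).
Hypothesis Bu : B \in unitmx.
Local Notation V := 'cV[R]_d.
Implicit Types (t x y : V) (F G : V -> R) (n p : 'cV[int]_d).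

Definition lat n : V := B *m int_vec n.

Definition latsum F t : R := \sum_(n \in [set: 'cV[int]_d]) F (lat n + t).

Definition cube (rho : R) : set V := [set x | forall j, `|x j 0| <= rho].

Lemma int_vecD n p : int_vec (n + p) = int_vec n + int_vec p :> V.
Proof. by apply/colP => i; rewrite !mxE intrD. Qed.

Lemma latD n p : lat (n + p) = lat n + lat p.
Proof. by rewrite /lat int_vecD mulmxDr. Qed.

Lemma latsum_shift F t p : latsum F (t + lat p) = latsum F t.
Proof.
rewrite /latsum [RHS](reindex_fsbigT (fun n => n + p)); last first.
  by exists (fun n => n - p) => n; rewrite ?addrK ?subrK.
by apply: eq_fsbigr => n _; rewrite latD addrAC addrA.
Qed.

(** The lattice points seen through the window of side [N] and corner [base]. *)
Definition window N (base : 'cV[int]_d) (g : {ffun 'I_d -> 'I_N}) : 'cV[int]_d :=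
  \col_i (base i 0 + (g i)%:Z).

Lemma window_inj N base : injective (@window N base).
Proof.
move=> g h /colP e; apply/ffunP => i; apply/val_inj.
by have := e i; rewrite !mxE => /addrI [].
Qed.

Variable beta : R.
Hypothesis betaP : forall i, \sum_j `|invmx B i j| <= beta.

Lemma mul_invmx_le x rho : 0 <= rho -> cube rho x ->
  forall i, `|(invmx B *m x) i 0| <= rho * beta.
Proof.
move=> r0 xr i; rewrite mxE; apply: (le_trans (ler_norm_sum _ _ _)).
apply: (@le_trans _ _ (\sum_j `|invmx B i j| * rho)).
  by apply: ler_sum => j _; rewrite normrM ler_wpM2l.
by rewrite -mulr_suml mulrC ler_wpM2l.
Qed.

(** If [lat n + t] is in [cube rho], then the coordinates of [n] differ from those of
    [- invmx B *m t] by at most [rho * beta]; the window contains all these [n]. *)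
Definition covers N (base : 'cV[int]_d) rho t := forall i,
  (base i 0)%:~R <= - (invmx B *m t) i 0 - rho * beta /\
  - (invmx B *m t) i 0 + rho * beta < (base i 0 + N%:Z)%:~R.

Lemma window_mem N base rho t n : 0 <= rho -> covers N base rho t ->
  cube rho (lat n + t) -> n \in [seq window base g | g <- enum {ffun 'I_d -> 'I_N}].
Proof.
move=> r0 cov cn; have h := mul_invmx_le r0 cn.
have hn i : (base i 0 <= n i 0 < base i 0 + N%:Z)%R.
  have := h i; have [c1 c2] := cov i; rewrite mulmxDr /lat mulKmx// !mxE.
  rewrite mxE in c1; rewrite mxE in c2.
  rewrite -(ler_int R) -(ltr_int R) ler_norml => /andP[h1 h2].
  by apply/andP; split; [move: c1 h1|move: c2 h2]; set z := \sum_j _; lra.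
apply/mapP.
have hN i : (absz (n i 0 - base i 0)%R < N)%N by have := hn i; lia.
exists [ffun i => Ordinal (hN i)]; first by rewrite mem_enum.
apply/colP => i; rewrite mxE ffunE /=; have /andP[h1 h2] := hn i.
by rewrite gez0_abs ?subr_ge0// addrC subrK.
Qed.

Lemma latsum_window N base rho F t : 0 <= rho -> covers N base rho t ->
  (forall y, ~ cube rho y -> F y = 0) ->
  latsum F t = \sum_(g : {ffun 'I_d -> 'I_N}) F (lat (window base g) + t).
Proof.
move=> r0 cov F0.
rewrite /latsum (@fsbigE _ _ _ _ _ [seq window base g | g <- enum {ffun 'I_d -> 'I_N}]).
- by rewrite (eq_bigl xpredT) => [|n]; [rewrite big_map big_enum|rewrite mem_set].
- by rewrite map_inj_uniq ?enum_uniq//; exact: window_inj.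
- by [].
move=> n _; apply: contraNeq => Fn; apply: window_mem cov _ => //.
by apply: contrapT => /F0 e; move: Fn; rewrite e eqxx.
Qed.

Lemma covers_tight N rho t : 2 * (rho * beta) + 2 <= N%:R ->
  exists base, covers N base rho t.
Proof.
move=> hN; exists (\col_i Num.floor (- (invmx B *m t) i 0 - rho * beta)) => i.
rewrite [(\col__ _) _ _]mxE; set c := - (invmx B *m t) i 0.
rewrite intrD; have /andP[h1 h2] := floor_bounds (c - rho * beta).
by split=> //; rewrite -[N%:Z%:~R]/(N%:R); lra.
Qed.

Lemma latsum_ge_seq rho F t (r : seq 'cV[int]_d) : 0 <= rho -> uniq r ->
  (forall y, ~ cube rho y -> F y = 0) -> (forall y, 0 <= F y) ->
  \sum_(n <- r) F (lat n + t) <= latsum F t.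
Proof.
move=> r0 ur F0 Fge.
have hN : 2 * (rho * beta) + 2 <= (Num.truncn (2 * (rho * beta) + 2)).+1%:R.
  by rewrite ltW// truncnS_gt.
have [base cov] := covers_tight t hN.
pose s := [seq window base g | g <- enum {ffun 'I_d -> 'I_(Num.truncn (2 * (rho * beta) + 2)).+1}].
rewrite /latsum (@fsbigE _ _ _ _ _ (undup (r ++ s))) ?undup_uniq//; last first.
  move=> n _; rewrite mem_undup mem_cat negb_or => /andP[_]; apply: contraNeq => Fn.
  apply: window_mem cov _ => //.
  by apply: contrapT => /F0 e; move: Fn; rewrite e eqxx.
rewrite [leRHS](eq_bigl xpredT) => [|n]; last by rewrite mem_set.
rewrite [leRHS](bigID (mem r)) /=.
suff -> : \sum_(n <- undup (r ++ s) | n \in r) F (lat n + t) =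
    \sum_(n <- r) F (lat n + t).
  by rewrite lerDl sumr_ge0.
rewrite -big_filter; apply: perm_big; apply: uniq_perm => //.
  by rewrite filter_uniq// undup_uniq.
by move=> n; rewrite mem_filter mem_undup mem_cat; case: (_ \in _).
Qed.

Lemma latsum_le N rho F t M : 0 <= rho -> 2 * (rho * beta) + 2 <= N%:R ->
  (forall y, ~ cube rho y -> F y = 0) -> (forall y, `|F y| <= M) ->
  `|latsum F t| <= N%:R ^+ d * M.
Proof.
move=> r0 hN F0 FM; have [base cov] := covers_tight t hN.
rewrite (latsum_window r0 cov F0); apply: (le_trans (ler_norm_sum _ _ _)).
rewrite -natrX -[X in (_ ^ X)%N]card_ord -[X in (X ^ _)%N]card_ord -card_ffun.
by rewrite -sum1_card natr_sum mulr_suml; apply: ler_sum => g _; rewrite mul1r.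
Qed.

Definition step i : V := lat (delta_mx i 0).

Lemma cube_open rho b y : ~ cube rho y ->
  \forall s \near (0 : R), ~ cube rho (y + s *: b).
Proof.
move=> /existsNP[j /negP]; rewrite -ltNge => hj.
have e0 : 0 < (`|y j 0| - rho) / (`|b j 0| + 1).
  by rewrite divr_gt0 ?subr_gt0// ltr_wpDl.
have b1 : 0 < `|b j 0| + 1 by rewrite ltr_wpDl.
apply: filterS (nbhs0_lt e0) => s; rewrite ltr_pdivlMr// => hs.
move=> /(_ j); rewrite !mxE => h.
have := lerB_normD (y j 0) (s * b j 0); rewrite normrM.
have := normr_ge0 s; have := normr_ge0 (b j 0); nra.
Qed.

(** Along a generator the lattice sum is 1-periodic, and [oscillation_le] applies. One
    window has to serve all the translates, whence the larger margin in [N]. *)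
Lemma latsum_osc_step N rho F t i L M e s : 0 <= rho -> 0 <= e ->
  2 * (rho * beta) + 4 <= N%:R -> (forall y, ~ cube rho y -> F y = 0) ->
  lsmooth (step i) L M e F -> 0 <= s <= 1 ->
  `|latsum F (t + s *: step i) - latsum F t| <= 2 * N%:R ^+ d * (M * e ^+ L).
Proof.
move=> r0 e0 hN F0 hF s01.
pose base : 'cV[int]_d :=
  \col_k (Num.floor (- (invmx B *m t) k 0 - rho * beta) - 1).
have cov (u : R) : 0 <= u <= 1 -> covers N base rho (t + u *: step i).
  move=> /andP[u0 u1] k.
  have -> : (invmx B *m (t + u *: step i)) k 0 =
      (invmx B *m t) k 0 + u * (k == i)%:R.
    by rewrite mulmxDr -scalemxAr /step /lat mulKmx// !mxE eqxx andbT; case: eqP.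
  have : 0 <= u * (k == i)%:R <= 1.
    by case: (k == i); rewrite ?mulr1 ?mulr0 ?u0// lexx ler01.
  rewrite [base k 0]mxE; move: (u * _) => w /andP[w0 w1].
  have := floor_bounds (- (invmx B *m t) k 0 - rho * beta).
  by rewrite !intrD -[N%:Z%:~R]/(N%:R) => /andP[h1 h2]; split; lra.
have sumE G : (forall y, ~ cube rho y -> G y = 0) ->
    forall u : R, 0 <= u <= 1 -> latsum G (t + u *: step i) =
    \sum_(g : {ffun 'I_d -> 'I_N}) G ((lat (window base g) + t) + u *: step i).
  move=> G0 u /cov cu; rewrite (latsum_window r0 cu G0).
  by apply: eq_bigr => g _; rewrite addrA.
have lt0 G : latsum G t = latsum G (t + 0 *: step i) by rewrite scale0r addr0.
rewrite (lt0 F) !sumE ?lexx ?ler01//.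
rewrite -natrX -[X in (_ ^ X)%N]card_ord -[X in (X ^ _)%N]card_ord -card_ffun.
apply: (oscillation_le e0 (@cube_open rho (step i)) _ hF F0) => //.
  move=> G G0; have := sumE G G0 1; have := sumE G G0 0.
  rewrite !lexx ler01 => /(_ isT) h0 /(_ isT) h1.
  transitivity (latsum G (t + 1 *: step i)).
    by rewrite h1; apply: eq_bigr => g _; rewrite scale1r.
  rewrite scale1r /step latsum_shift lt0 h0.
  by apply: eq_bigr => g _; rewrite scale0r addr0.
by rewrite lexx ler01.
Qed.

(** As a function of the translation, a lattice sum of a smooth function is almost
    constant: it has the lattice as group of periods, so it oscillates little along
    each generator, and these span. *)
Lemma latsum_osc N rho F t L M e : 0 <= rho -> 0 <= e ->
  2 * (rho * beta) + 4 <= N%:R -> (forall y, ~ cube rho y -> F y = 0) ->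
  (forall i, lsmooth (step i) L M e F) ->
  `|latsum F t - latsum F 0| <= d%:R * (2 * N%:R ^+ d * (M * e ^+ L)).
Proof.
move=> r0 e0 hN F0 hF.
pose tau := invmx B *m t.
pose p : 'cV[int]_d := map_mx Num.floor tau.
pose sg k : 'cV[R]_d := \col_i (if (i < k)%N then tau i 0 - (p i 0)%:~R else 0).
have tE : t = B *m sg d + lat p.
  rewrite /lat -mulmxDr -[LHS](mulKVmx Bu); congr (_ *m _).
  by apply/colP => i; rewrite !mxE ltn_ord subrK.
rewrite tE latsum_shift.
suff H k : (k <= d)%N ->
    `|latsum F (B *m sg k) - latsum F 0| <= k%:R * (2 * N%:R ^+ d * (M * e ^+ L)).
  exact: H.
elim: k => [_|k IH kd].
  have -> : sg 0%N = 0 by apply/colP => i; rewrite !mxE.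
  by rewrite mulmx0 subrr normr0 mul0r.
pose i := Ordinal kd.
have sgS : sg k.+1 = sg k + (tau i 0 - (p i 0)%:~R) *: int_vec (delta_mx i 0).
  apply/colP => j; rewrite !mxE eqxx andbT ltnS leq_eqVlt -(inj_eq val_inj) /=.
  case: (ltngtP j k) => jk; rewrite ?mulr0 ?addr0 ?add0r//.
  by rewrite mulr1 (_ : j = i)//; apply/val_inj.
have -> : B *m sg k.+1 = B *m sg k + (tau i 0 - (p i 0)%:~R) *: step i.
  by rewrite sgS mulmxDr -scalemxAr.
set z := latsum F (_ + _); set y := latsum F (B *m sg k) in IH *.
have -> : z - latsum F 0 = (z - y) + (y - latsum F 0) by rewrite addrA subrK.
apply: (le_trans (ler_normD _ _)); rewrite -natr1 mulrDl mul1r [leRHS]addrC.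
rewrite lerD ?IH ?(ltnW kd)//.
apply: latsum_osc_step r0 e0 hN F0 (hF i) _.
by rewrite [p i 0]mxE; have /andP[h1 h2] := floor_bounds (tau i 0); lra.
Qed.

End lattice_sums.

(** * Lattice sums of modulated functions *)

Section lattice_waves.
Context {R : realType} {d : nat} (B : 'M[R]_d).
Hypothesis Bu : B \in unitmx.
Variable beta : R.
Hypothesis betaP : forall i, \sum_j `|invmx B i j| <= beta.
Local Notation V := 'cV[R]_d.
Implicit Types (t x y w : V) (F G : V -> R).

Definition dot x y : R := \sum_j x j 0 * y j 0.

Lemma dotDr w x y : dot w (x + y) = dot w x + dot w y.
Proof. by rewrite -big_split; apply: eq_bigr => j _; rewrite mxE mulrDr. Qed.

Lemma dotDl w x y : dot (x + y) w = dot x w + dot y w.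
Proof. by rewrite -big_split; apply: eq_bigr => j _; rewrite mxE mulrDl. Qed.

Lemma dotZr w s x : dot w (s *: x) = s * dot w x.
Proof. by rewrite mulr_sumr; apply: eq_bigr => j _; rewrite mxE mulrCA. Qed.

Lemma latsumB rho F G t : 0 <= rho ->
  (forall y, ~ cube rho y -> F y = 0) -> (forall y, ~ cube rho y -> G y = 0) ->
  latsum B (fun x => F x - G x) t = latsum B F t - latsum B G t.
Proof.
move=> r0 F0 G0.
have hN : 2 * (rho * beta) + 2 <= (Num.truncn (2 * (rho * beta) + 2)).+1%:R.
  by rewrite ltW// truncnS_gt.
have [base cov] := covers_tight B t hN.
rewrite !(latsum_window Bu betaP r0 cov)// ?sumrB// => y hy.
by rewrite F0// G0// subr0.
Qed.

Definition wave w (b : R) x : R := cos (2 * pi * dot w x + b).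

(** Summation by parts: multiplying a lattice sum of [F] times a wave by the
    increment of the wave along a lattice step moves that increment onto [F]. *)
Lemma latsum_wave_parts rho delta F w b i : 0 <= rho -> 0 <= delta ->
  (forall j, `|step B i j 0| <= delta) -> (forall y, ~ cube rho y -> F y = 0) ->
  2 * sin (pi * dot w (step B i)) * latsum B (fun x => F x * wave w b x) 0 =
  latsum B (fun x => (F x - F (x + step B i)) *
    wave w (b + pi * dot w (step B i) - pi / 2) x) 0.
Proof.
move=> r0 d0 hd F0; set th := pi * dot w (step B i).
pose H x := F x * sin (2 * pi * dot w x + b + th).
pose G x := F x * sin (2 * pi * dot w x + b - th).
have cubeW y : ~ cube (rho + delta) y -> ~ cube rho y.
  by apply: contra_not => h j; apply: (le_trans (h j)); rewrite lerDl.
have H0 y : ~ cube (rho + delta) y -> H y = 0.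
  by move=> /cubeW h; rewrite /H F0 ?mul0r.
have G0 y : ~ cube (rho + delta) y -> G y = 0.
  by move=> /cubeW h; rewrite /G F0 ?mul0r.
have G1 y : ~ cube (rho + delta) y -> G (y + step B i) = 0.
  move=> h; rewrite /G F0 ?mul0r//; apply: contra_not h => h j.
  have := h j; rewrite mxE; have := hd j.
  have := lerB_normD (y j 0) (step B i j 0); lra.
have rd0 : 0 <= rho + delta by exact: addr_ge0.
transitivity (latsum B H 0 - latsum B G 0).
  rewrite -(latsumB 0 rd0 H0 G0) /latsum mulr_fsumr.
  apply: eq_fsbigr => n _; rewrite /H /G /wave.
  by rewrite sinD sinB; ring.
have -> : latsum B G 0 = latsum B (fun x => G (x + step B i)) 0.
  rewrite -(latsum_shift B G 0 (delta_mx i 0)) /latsum.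
  by apply: eq_fsbigr => n _; rewrite addrA.
rewrite -(latsumB 0 rd0 H0 G1) /latsum.
apply: eq_fsbigr => n _; rewrite /H /G /wave.
rewrite addrA cosBpihalf (dotDr w _ (step B i)) mulrBl addrA; congr (_ - _ * sin _).
by rewrite /th; ring.
Qed.

(** Iterated summation by parts; each increment enlarges the support by [delta]. *)
Lemma latsum_wave_le L N rho delta F w b i M e : 0 <= rho -> 0 <= delta ->
  (forall j, `|step B i j 0| <= delta) ->
  2 * ((rho + L%:R * delta) * beta) + 2 <= N%:R ->
  (forall y, ~ cube rho y -> F y = 0) -> lsmooth (step B i) L M e F ->
  `|2 * sin (pi * dot w (step B i))| ^+ L *
    `|latsum B (fun x => F x * wave w b x) 0| <= N%:R ^+ d * (M * e ^+ L).
Proof.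
move=> r0 d0 hd; elim: L M rho F b r0 => [|L IH] M rho F b r0 hN F0 hF.
  rewrite !expr0 mul1r mulr1; apply: (latsum_le Bu betaP 0 r0).
  - by rewrite mul0r addr0 in hN.
  - by move=> y /F0 ->; rewrite mul0r.
  - move=> y; rewrite normrM -[leRHS]mulr1 ler_pM ?(lsmooth_bound hF)//.
    exact: cos_max.
rewrite exprSr -mulrA -normrM (latsum_wave_parts w b r0 d0 hd F0).
rewrite exprS (mulrA M); apply: (IH _ (rho + delta)).
- exact: addr_ge0.
- suff -> : rho + delta + L%:R * delta = rho + L.+1%:R * delta by [].
  by rewrite -natr1; ring.
- move=> y hy.
  have h1 : ~ cube rho y by apply: contra_not hy => hy j; apply: (le_trans (hy j)); rewrite lerDl.
  rewrite (F0 _ h1) F0 ?subrr//; apply: contra_not hy => hy j.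
  have := hy j; rewrite mxE; have := hd j.
  have := lerB_normD (y j 0) (step B i j 0); lra.
- exact: lsmooth_increment.
Qed.

Lemma covers_large rho tau : 0 <= tau -> exists N base,
  forall t, cube tau t -> covers B beta N base rho t.
Proof.
move=> t0; pose X := (Num.truncn (tau * beta + rho * beta)).+1.
have hX : tau * beta + rho * beta < X%:R by exact: truncnS_gt.
exists (X + X)%N, (const_mx (- X%:Z)) => t ht i; rewrite mxE.
have := mul_invmx_le betaP t0 ht i; rewrite ler_norml => /andP[h1 h2].
rewrite PoszD intrD rmorphN/= -[X%:Z%:~R]/(X%:R) intrD -[X%:Z%:~R]/(X%:R); split; lra.
Qed.

End lattice_waves.

(** * The plateau, averaged with alternating signs *)

Section averaging.
Context {R : realType}.
Variable S : R -> R.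
Hypothesis S0 : forall x, x <= 0 -> S x = 0.
Hypothesis S1 : forall x, 1 <= x -> S x = 1.
Hypothesis Sh : {homo S : x y / x <= y}.

(** As a difference of two steps at distance 1, its integer translates sum to 1. *)
Definition plateau (x : R) := S (x + 1 / 2) - S (x - 1 / 2).

Lemma S_ge0 x : 0 <= S x.
Proof.
have [x0|x0] := leP x 0; first by rewrite S0.
by rewrite -(S0 (lexx 0)) Sh// ltW.
Qed.

Lemma S_le1 x : S x <= 1.
Proof.
have [x0|x0] := leP 1 x; first by rewrite S1.
by rewrite -(S1 (lexx 1)) Sh// ltW.
Qed.

Lemma plateau_ge0 x : 0 <= plateau x.
Proof. by rewrite subr_ge0 Sh//; lra. Qed.

Lemma plateau_le1 x : plateau x <= 1.
Proof. by rewrite /plateau; have := S_le1 (x + 1 / 2); have := S_ge0 (x - 1 / 2); lra. Qed.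

Lemma plateau0 x : ~~ (- (1 / 2) <= x < 3 / 2) -> plateau x = 0.
Proof.
rewrite negb_and -ltNge -leNgt => /orP[h|h]; rewrite /plateau.
  by rewrite !S0 ?subrr//; lra.
by rewrite !S1 ?subrr//; lra.
Qed.

Lemma plateau_half : plateau (1 / 2) = 1.
Proof. by rewrite /plateau S1 ?S0 ?subr0//; lra. Qed.

(** The signs are those taken by a wave of frequency [K] along translations by half a
    period, [1 / K.*2], which is the step for [q = K.*2]. *)
Definition alt_plateau (q T : nat) x : R :=
  \sum_(j < T * q) (-1) ^+ j * plateau (x + j%:R / q%:R).

Lemma sum_alternating K : \sum_(l < K.*2) (-1) ^+ l = 0 :> R.
Proof.
elim: K => [|K IH]; first by rewrite big_ord0.
rewrite doubleS !big_ord_recr /= IH add0r exprS mulN1r subrr//.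
Qed.

(** Translating the plateau through whole periods telescopes. *)
Lemma alt_plateauE K T x : (0 < K)%N -> alt_plateau K.*2 T x =
  \sum_(l < K.*2) (-1) ^+ l * (S (x + l%:R / K.*2%:R + T%:R - 1 / 2)
                                - S (x + l%:R / K.*2%:R - 1 / 2)).
Proof.
move=> K0; set q := K.*2.
have q0 : q%:R != 0 :> R by rewrite pnatr_eq0 /q; lia.
elim: T x => [|T IH] x.
  rewrite /alt_plateau big_ord0 big1// => l _.
  by rewrite addr0 subrr mulr0.
have -> : alt_plateau q T.+1 x = \sum_(l < q) (-1) ^+ l * plateau (x + l%:R / q%:R)
     + alt_plateau q T (x + 1).
  rewrite /alt_plateau mulSn big_split_ord; congr (_ + _).
  apply: eq_bigr => i _ /=; rewrite exprD natrD mulrDl divff// addrA.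
  by rewrite -signr_odd /q odd_double expr0 mul1r.
rewrite IH -big_split; apply: eq_bigr => l _ /=.
rewrite -mulrDr -[T.+1%:R]natr1 /plateau; congr (_ * _).
move: (l%:R / q%:R) => z.
have -> : x + 1 + z - 1 / 2 = x + z + 1 / 2 by lra.
have -> : x + 1 + z + T%:R - 1 / 2 = x + z + (T%:R + 1) - 1 / 2 by lra.
by ring.
Qed.

Lemma alt_plateau_le K T x : (0 < K)%N -> `|alt_plateau K.*2 T x| <= K.*2%:R.
Proof.
move=> K0; rewrite alt_plateauE//; apply: (le_trans (ler_norm_sum _ _ _)).
rewrite -[in leRHS](card_ord K.*2) -sum1_card natr_sum; apply: ler_sum => l _.
rewrite normrM normrX normrN1 expr1n (mul1r `|_|) ler_norml.
set y := (_ + _ - 1 / 2); set z := _ - 1 / 2.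
by have := S_ge0 y; have := S_ge0 z; have := S_le1 y; have := S_le1 z; lra.
Qed.

(** If [x] and [x + T] lie on opposite sides of the support, the terms are alternating
    ones. *)
Lemma alt_plateau0 K T x : (0 < K)%N -> ~~ (- (1 / 2) <= x <= 3 / 2) ->
  ~~ (- (1 / 2) <= x + T%:R <= 3 / 2) -> alt_plateau K.*2 T x = 0.
Proof.
move=> K0 h1 h2; rewrite alt_plateauE//.
have lq (l : 'I_K.*2) : 0 <= (l%:R / K.*2%:R : R) < 1.
  have q0 : 0 < K.*2%:R :> R by rewrite ltr0n double_gt0.
  by rewrite divr_ge0 ?ler0n//= ltr_pdivrMr// mul1r ltr_nat.
have T0 : 0 <= T%:R :> R by exact: ler0n.
move: h1; rewrite negb_and -!ltNge => /orP[h1|h1]; last first.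
  apply: big1 => l _; have := lq l => hl.
  by rewrite !S1 ?subrr ?mulr0//; lra.
move: h2; rewrite negb_and -!ltNge => /orP[h2|h2].
  apply: big1 => l _; have := lq l => hl.
  by rewrite !S0 ?subrr ?mulr0//; lra.
rewrite -[RHS](sum_alternating K); apply: eq_bigr => l _; have := lq l => hl.
by rewrite S1 ?S0 ?subr0 ?mulr1//; lra.
Qed.

End averaging.

(** * Waves of integer frequency under translation *)

Section integer_waves.
Context {R : realType} {d : nat} (B : 'M[R]_d).
Hypothesis Bu : B \in unitmx.
Variable beta : R.
Hypothesis betaP : forall i, \sum_j `|invmx B i j| <= beta.
Variable S : R -> R.
Hypothesis S0 : forall x, x <= 0 -> S x = 0.
Hypothesis S1 : forall x, 1 <= x -> S x = 1.
Hypothesis Sh : {homo S : x y / x <= y}.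
Local Notation V := 'cV[R]_d.
Implicit Types (t x y w : V) (F G : V -> R).

Definition tplateau x : R := \prod_j plateau S (x j 0).

Lemma tplateau_ge0 x : 0 <= tplateau x.
Proof. by apply: prodr_ge0 => j _; exact: plateau_ge0. Qed.

Lemma tplateau0 x j : ~~ (- (1 / 2) <= x j 0 < 3 / 2) -> tplateau x = 0.
Proof. by move=> h; rewrite /tplateau (bigD1 j)//= plateau0 ?mul0r. Qed.

Lemma tplateau_cube x : ~ cube 2 x -> tplateau x = 0.
Proof.
move=> /existsNP[j /negP h]; apply: (@tplateau0 _ j).
by apply: contra h => /andP[h1 h2]; rewrite ler_norml; lra.
Qed.

Lemma cos_addn_pi (a : R) n : cos (a + n%:R * pi) = (-1) ^+ n * cos a.
Proof.
elim: n => [|n IH]; first by rewrite mul0r addr0 mul1r.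
by rewrite -[n.+1%:R]natr1 mulrDl mul1r addrA cosDpi IH exprS mulN1r mulNr.
Qed.

Lemma cos_addz_pi (a : R) n (z : int) : `|z| = n%:Z ->
  cos (a + z%:~R * pi) = (-1) ^+ n * cos a.
Proof.
move=> zn; have [z0|z0] := leP 0 z.
  by rewrite ger0_norm// in zn; rewrite zn cos_addn_pi.
have -> : z = - n%:Z by rewrite -zn ltr0_norm// opprK.
rewrite rmorphN mulNr; set a' := a - _.
have -> : a = a' + n%:R * pi by rewrite /a' subrK.
by rewrite cos_addn_pi mulrA -expr2 sqrr_sign mul1r.
Qed.

Let e i : V := delta_mx i 0.

Lemma dot_delta w i : dot w (e i) = w i 0.
Proof.
rewrite /dot (bigD1 i)//= mxE !eqxx mulr1 big1 ?addr0// => j ji.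
by rewrite mxE (negPf ji) mulr0.
Qed.

Lemma sum_translates (k : 'cV[int]_d) b i K T x : `|k i 0| = K%:Z -> (0 < K)%N ->
  \sum_(j < T * K.*2) tplateau (x + (j%:R / K.*2%:R) *: e i)
     * wave (int_vec k) b (x + (j%:R / K.*2%:R) *: e i) =
  (\prod_(l | l != i) plateau S (x l 0)) * wave (int_vec k) b x
    * alt_plateau S K.*2 T (x i 0).
Proof.
move=> kK K0; rewrite /alt_plateau mulr_sumr; apply: eq_bigr => j _.
have q0 : K%:R != 0 :> R by rewrite pnatr_eq0 -lt0n.
have qE : K.*2%:R = 2 * K%:R :> R by rewrite -mul2n natrM.
rewrite /tplateau (bigD1 i)//= {1}/e !mxE !eqxx mulr1.
under eq_bigr => l li do rewrite /e !mxE (negPf li) mulr0 addr0.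
have -> : wave (int_vec k) b (x + (j%:R / K.*2%:R) *: e i) =
    (-1) ^+ j * wave (int_vec k) b x.
  rewrite /wave dotDr dotZr dot_delta mxE.
  have -> : 2 * pi * (dot (int_vec k) x + j%:R / K.*2%:R * (k i 0)%:~R) + b =
      2 * pi * dot (int_vec k) x + b + (j%:Z * sgz (k i 0))%:~R * pi.
    have -> : (k i 0)%:~R = (sgz (k i 0))%:~R * K%:R :> R.
      by rewrite {1}[k i 0]intEsg abszE kK intrM.
    by rewrite intrM -[j%:Z%:~R]/(j%:R) qE; field.
  apply: cos_addz_pi; rewrite normrM.
  have [z|z|z] := ltgtP (k i 0) 0.
  - by rewrite (ltr0_sgz z) normrN1 mulr1.
  - by rewrite (gtr0_sgz z) normr1 mulr1.
  - by move: kK; rewrite z normr0; lia.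
by ring.
Qed.

(** Averaging the lattice sum over translates by a vector that flips the sign of
    the wave leaves only the translates that meet the boundary of the window. *)
Lemma latsum_wave_average N (k : 'cV[int]_d) b i K T : `|k i 0| = K%:Z -> (0 < K)%N ->
  2 * (2 * beta) + 2 <= N%:R ->
  `|\sum_(j < T * K.*2)
      latsum B (fun x => tplateau x * wave (int_vec k) b x) ((j%:R / K.*2%:R) *: e i)|
    <= 2 * (N%:R ^+ d * K.*2%:R).
Proof.
move=> kK K0 hN.
pose q := K.*2; pose F x := tplateau x * wave (int_vec k) b x.
have q0 : 0 < q%:R :> R by rewrite ltr0n double_gt0.
have F0 y : ~ cube 2 y -> F y = 0 by move=> /tplateau_cube h; rewrite /F h mul0r.
have [X [base cov]] := covers_large betaP 2 (ler0n R T).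
have ecube (s : R) : 0 <= s <= T%:R -> cube T%:R (s *: e i).
  move=> /andP[s0 sT] l; rewrite !mxE eqxx andbT; case: (_ == _).
    by rewrite mulr1 ger0_norm.
  by rewrite mulr0 normr0 ler0n.
pose H x := \sum_(j < T * q) F (x + (j%:R / q%:R) *: e i).
have HE x : H x = (\prod_(l | l != i) plateau S (x l 0)) * wave (int_vec k) b x
    * alt_plateau S q T (x i 0) by exact: sum_translates.
have Hle x : `|H x| <= q%:R.
  rewrite HE !normrM -[leRHS]mul1r ler_pM ?alt_plateau_le//.
  rewrite -[leRHS]mul1r ler_pM ?cos_max// ger0_norm.
    by apply: prodr_ile1 => l _; rewrite plateau_ge0 ?plateau_le1.
  by apply: prodr_ge0 => l _; exact: plateau_ge0.
have -> : \sum_(j < T * q) latsum B F ((j%:R / q%:R) *: e i) =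
    \sum_(g : {ffun 'I_d -> 'I_X}) H (lat B (window base g)).
  rewrite exchange_big /=; apply: eq_bigr => j _.
  apply: (@latsum_window _ _ B Bu beta betaP X base 2 F) => //; apply: cov.
  apply: ecube; rewrite divr_ge0 ?ler0n//= ler_pdivrMr// -natrM ler_nat ltnW//.
have T0 : 0 <= T%:R :> R by exact: ler0n.
(* The sum [H x] vanishes unless the segment from [x] to [x + T *: e i] starts in the
   cube ([H1]) or ends in it without starting there ([H2], read off at the end point). *)
pose H1 x := if x \in cube 2 then H x else 0.
pose H2 x := if x - T%:R *: e i \in cube 2 then 0 else H (x - T%:R *: e i).
have H1_0 y : ~ cube 2 y -> H1 y = 0 by move=> hy; rewrite /H1 memNset.
have H2_0 y : ~ cube 2 y -> H2 y = 0.
  move=> hy; rewrite /H2; case: ifPn => // /negP yc; rewrite HE.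
  have /existsNP[l hl] := hy.
  have [m hm] : exists m, ~ `|(y - T%:R *: e i) m 0| <= 2.
    by apply/existsNP => h; apply: yc; rewrite inE.
  move: hl hm => /negP hl /negP hm; rewrite ler_norml in hl; rewrite ler_norml in hm.
  have yE l' : l' != i -> (y - T%:R *: e i) l' 0 = y l' 0.
    by move=> li; rewrite !mxE (negPf li) mulr0 subr0.
  have yi : (y - T%:R *: e i) i 0 = y i 0 - T%:R by rewrite !mxE !eqxx mulr1.
  have zero l' : l' != i -> ~~ (-2 <= y l' 0 <= 2) ->
      \prod_(l | l != i) plateau S ((y - T%:R *: e i) l 0) = 0.
    move=> li hl'; rewrite (bigD1 l')//= yE// plateau0 ?mul0r//.
    by apply: contra hl'; lra.
  have [li|/negPn/eqP li] := boolP (l != i); first by rewrite (zero l)// !mul0r.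
  have [mi|/negPn/eqP mi] := boolP (m != i).
    by rewrite yE in hm; rewrite ?(zero m)// !mul0r.
  rewrite alt_plateau0 ?mulr0//.
    by apply: contra hm; rewrite mi; lra.
  by apply: contra hl; rewrite yi li subrK; lra.
have -> : \sum_(g : {ffun 'I_d -> 'I_X}) H (lat B (window base g)) =
    latsum B H1 0 + latsum B H2 (T%:R *: e i).
  have c0 : covers B beta X base 2 0.
    by rewrite -(scale0r (e i)); apply: cov; apply: ecube; rewrite lexx.
  have cT : covers B beta X base 2 (T%:R *: e i).
    by apply: cov; apply: ecube; rewrite lexx andbT.
  rewrite (latsum_window Bu betaP (ler0n R 2) c0 H1_0).
  rewrite (latsum_window Bu betaP (ler0n R 2) cT H2_0).
  rewrite -big_split; apply: eq_bigr => g _ /=.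
  rewrite /H1 /H2 addr0 addrK; case: (_ \in _).
    by rewrite addr0.
  by rewrite add0r.
apply: (le_trans (ler_normD _ _)); rewrite mulrDl mul1r.
apply: lerD; apply: (latsum_le Bu betaP _ _ hN) => //.
- by move=> y; rewrite /H1; case: (_ \in _); [exact: Hle|rewrite normr0 ltW].
- by move=> y; rewrite /H2; case: (_ \in _); [rewrite normr0 ltW|exact: Hle].
Qed.

End integer_waves.

(** * Exponential sums over the quadrature lattice *)

Section sine_bound.
Context {R : realType}.

(** Halving the angle: both cosines in [sin x = 2 cos(x/2) sin(x/2)] and in the mean
    value of [sin] are at least [cos(pi/4)], whose square is 1/2. *)
Lemma sin_ge_half (x : R) : 0 <= x <= pi / 2 -> x / 2 <= sin x.
Proof.
move=> /andP[x0 x1].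
have c4 : cos (pi / 4 : R) ^+ 2 = 1 / 2.
  have : cos ((pi / 4 : R) *+ 2) = 0.
    by rewrite (_ : _ *+ 2 = pi / 2) ?cos_pihalf//; rewrite mulr2n; field.
  by rewrite cos_mulr2n mulr2n; lra.
have pi0 : 0 < pi :> R := pi_gt0 R.
have c0 : 0 < cos (pi / 4 : R) by apply: cos_gt0_pihalf; lra.
have cd (y : R) : 0 <= y <= pi / 4 -> cos (pi / 4) <= cos y.
  move=> /andP[y0]; rewrite le_eqVlt => /predU1P[->//|y1]; apply: ltW.
  by rewrite ltr_cos// in_itv /=; lra.
pose y := x / 2.
have sy : cos (pi / 4) * y <= sin y.
  have [->|y0] := eqVneq y 0; first by rewrite mulr0 sin0.
  have yp : 0 < y by rewrite lt0r y0 /y; lra.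
  have [c ci] := mean_value (fun z => is_derive_sin z) yp.
  rewrite sin0 !subr0 => ->; rewrite ler_wpM2r ?(ltW yp)//.
  by apply: cd; move: ci; rewrite in_itv /= /y; lra.
have -> : sin x = 2 * (cos y * sin y).
  have -> : x = y *+ 2 by rewrite mulr2n /y; field.
  by rewrite sin_mulr2n mulr2n; ring.
have cy : cos (pi / 4) <= cos y by apply: cd; rewrite /y; lra.
apply: (@le_trans _ _ (2 * (cos (pi / 4) * (cos (pi / 4) * y)))).
  by rewrite (mulrA (cos _)) -expr2 c4 /y; lra.
rewrite ler_pM2l ?ltr0n// ler_pM ?(ltW c0)// mulr_ge0 ?(ltW c0)//.
by rewrite /y; lra.
Qed.

Lemma norm_sin_pi_ge (x : R) : `|x| <= 1 / 2 -> `|x| <= `|2 * sin (pi * x)|.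
Proof.
have pi2 := pi_ge2 R.
suff H (y : R) : 0 <= y <= 1 / 2 -> y <= 2 * sin (pi * y).
  move=> hx; have [x0|x0] := leP 0 x.
    rewrite ger0_norm// in hx *; apply: le_trans (ler_norm _).
    by apply: H; rewrite x0.
  rewrite ltr0_norm// in hx *.
  have -> : `|2 * sin (pi * x)| = `|2 * sin (pi * - x)|.
    by rewrite mulrN sinN mulrN normrN.
  by apply: le_trans (ler_norm _); apply: H; lra.
move=> /andP[y0 y1]; have : pi * y / 2 <= sin (pi * y).
  by apply: sin_ge_half; rewrite mulr_ge0 ?pi_ge0//= ler_pM2l ?pi_gt0// -[2^-1]mul1r.
have : 2 * y <= pi * y by rewrite ler_wpM2r.
lra.
Qed.

End sine_bound.

Section scaled_lattice.
Context {R : realType} {d : nat} (A : 'M[R]_d).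
Hypothesis d0 : (0 < d)%N.
Hypothesis Au : A \in unitmx.
Variables (S : R -> R) (l : nat) (M : R).
Hypothesis S0 : forall x, x <= 0 -> S x = 0.
Hypothesis S1 : forall x, 1 <= x -> S x = 1.
Hypothesis Sh : {homo S : x y / x <= y}.
Local Notation L := l.*2.
Hypothesis SM : smooth1 L.+1 M S.
Local Notation V := 'cV[R]_d.

(** The lattice dual to [a A Z^d]. *)
Definition dual (a : R) : 'M[R]_d := a^-1 *: (invmx A)^T.

Let alpha : R := \sum_i \sum_j `|A i j|.
Let delta : R := \sum_i \sum_j `|invmx A i j|.

Let alpha0 : 0 <= alpha.
Proof. by apply: sumr_ge0 => i _; apply: sumr_ge0. Qed.

Let delta0 : 0 <= delta.
Proof. by apply: sumr_ge0 => i _; apply: sumr_ge0. Qed.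

Let sum_row_le (D : 'M[R]_d) i : \sum_j `|D i j| <= \sum_i \sum_j `|D i j|.
Proof. by rewrite [leRHS](bigD1 i)//= lerDl; apply: sumr_ge0 => k _; apply: sumr_ge0. Qed.

Let sum_col_le (D : 'M[R]_d) i : \sum_j `|D j i| <= \sum_i \sum_j `|D i j|.
Proof.
rewrite [leRHS]exchange_big /= [leRHS](bigD1 i)//= lerDl.
by apply: sumr_ge0 => k _; apply: sumr_ge0.
Qed.

Lemma dual_unit a : 1 <= a -> dual a \in unitmx.
Proof.
move=> a1; have a0 : 0 < a := lt_le_trans ltr01 a1.
by rewrite unitmxZ ?unitfE ?invr_eq0 ?gt_eqF// unitmx_tr unitmx_inv.
Qed.

Lemma invmx_dual a : 1 <= a -> invmx (dual a) = a *: A^T.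
Proof.
move=> a1; have a0 : 0 < a := lt_le_trans ltr01 a1.
apply: (can_inj (mulKmx (dual_unit a1))); rewrite mulmxV ?dual_unit//.
rewrite /dual -scalemxAl -scalemxAr scalerA mulVf ?gt_eqF// scale1r.
by rewrite -trmx_mul mulmxV// trmx1.
Qed.

Let dual_beta a : 1 <= a -> forall i, \sum_j `|invmx (dual a) i j| <= a * alpha.
Proof.
move=> a1 i; have a0 : 0 < a := lt_le_trans ltr01 a1.
rewrite invmx_dual//; apply: le_trans (ler_wpM2l (ltW a0) (sum_col_le A i)).
rewrite mulr_sumr; apply: ler_sum => j _.
by rewrite !mxE normrM (gtr0_norm a0).
Qed.

Let stepE a i j : step (dual a) i j 0 = a^-1 * invmx A i j.
Proof.
rewrite /step /lat /dual -scalemxAl mxE; congr (_ * _).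
rewrite mxE (bigD1 i)//= !mxE !eqxx mulr1 big1 ?addr0// => k ki.
by rewrite !mxE (negPf ki) mulr0.
Qed.

Let step_sum_le a i : 1 <= a -> \sum_j `|step (dual a) i j 0| <= delta / a.
Proof.
move=> a1; have a0 : 0 < a := lt_le_trans ltr01 a1.
apply: (@le_trans _ _ (a^-1 * \sum_j `|invmx A i j|)).
  rewrite mulr_sumr; apply: ler_sum => j _.
  by rewrite stepE normrM gtr0_norm// invr_gt0.
by rewrite [leRHS]mulrC ler_wpM2l ?invr_ge0 ?(ltW a0).
Qed.

Let step_le a i j : 1 <= a -> `|step (dual a) i j 0| <= delta / a.
Proof.
move=> a1; apply: le_trans (step_sum_le i a1).
by rewrite (bigD1 j)//= lerDl sumr_ge0.
Qed.

Lemma dot_step a w i : dot w (step (dual a) i) = a^-1 * (invmx A *m w) i 0.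
Proof.
rewrite /dot mxE mulr_sumr; apply: eq_bigr => j _.
by rewrite stepE; ring.
Qed.

(** Side of a window for the support of the plateau and of its first [L] increments. *)
Let N a := (Num.truncn (2 * ((2 + L%:R * delta) * (a * alpha)) + 4)).+1.

Let CN : R := 2 * ((2 + L%:R * delta) * alpha) + 5.

Let CN0 : 0 <= CN.
Proof.
have h : 0 <= (2 + L%:R * delta) * alpha by rewrite mulr_ge0// addr_ge0// mulr_ge0.
by rewrite /CN; lra.
Qed.

Let N_ge a : 2 * ((2 + L%:R * delta) * (a * alpha)) + 4 <= (N a)%:R.
Proof. by rewrite ltW// truncnS_gt. Qed.

Let N_le a : 1 <= a -> (N a)%:R <= CN * a.
Proof.
move=> a1; rewrite /N -natr1.
have z0 : 0 <= (2 + L%:R * delta) * alpha by rewrite mulr_ge0// addr_ge0// mulr_ge0.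
have -> : (2 + L%:R * delta) * (a * alpha) = (2 + L%:R * delta) * alpha * a by ring.
rewrite /CN; set z := _ * alpha in z0 *.
have za : 0 <= z * a by rewrite mulr_ge0//; lra.
have : 0 <= 2 * (z * a) + 4 by lra.
by rewrite -truncn_le; lra.
Qed.

Let N_ge2 a : 1 <= a -> 2 * (2 * (a * alpha)) + 4 <= (N a)%:R.
Proof.
move=> a1; apply: le_trans (N_ge a); rewrite lerD2r ler_pM2l//.
rewrite ler_wpM2r ?mulr_ge0//; first lra.
by rewrite lerDl mulr_ge0.
Qed.

Let Mpsi : R := (2 ^+ L * (M + M)) ^+ d.

Let tplateau_smooth a i e : 1 <= a -> delta / a <= e ->
  lsmooth (step (dual a) i) L Mpsi e (tplateau S).
Proof.
move=> a1 de; have a0 : 0 < a := lt_le_trans ltr01 a1.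
have e0 : 0 <= e by apply: le_trans de; rewrite divr_ge0// ltW.
have -> : Mpsi = (2 ^+ L * (M + M)) ^+ size (index_enum 'I_d).
  by rewrite [index_enum _]unlock -enumT size_enum_ord.
apply: lsmooth_prod => // j.
apply: (@lsmooth_comp _ _ _ _ _ _ (plateau S) (fun x : V => x j 0)
  (step (dual a) i j 0)) => //.
- by apply: le_trans de; exact: step_le.
- by move=> x s; rewrite !mxE.
- apply: smooth1_diff_shift; move: SM; elim: (L) M S => [|n IH] M' f [f1 [f' f2 f3]].
    by split.
  by split=> //; exists f' => //; exact: IH.
Qed.

Let Nd_le a : 1 <= a -> (N a)%:R ^+ d <= CN ^+ d * a ^+ d.
Proof. by move=> a1; rewrite -exprMn lerXn2r ?nnegrE ?N_le// (le_trans _ (N_le a1)). Qed.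

Let Mpsi0 : 0 <= Mpsi.
Proof.
have := smooth1_bound SM 0 => h; have M0 := le_trans (normr_ge0 _) h.
by rewrite exprn_ge0// mulr_ge0 ?exprn_ge0 ?addr_ge0.
Qed.

Lemma wave_sum_trivial : exists2 C, 0 <= C & forall a w b, 1 <= a ->
  `|latsum (dual a) (fun x => tplateau S x * wave w b x) 0| <= C * a ^+ d.
Proof.
exists (CN ^+ d); first exact: exprn_ge0.
move=> a w b a1; apply: le_trans (Nd_le a1); rewrite -[leRHS]mulr1.
apply: (latsum_le (dual_unit a1) (dual_beta a1) 0 (ler0n R 2)).
- by have := N_ge2 a1; lra.
- by move=> y /tplateau_cube -> //; rewrite mul0r.
- move=> y; rewrite normrM -[leRHS]mul1r ler_pM ?cos_max// ger0_norm ?tplateau_ge0//.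
  by apply: prodr_ile1 => j _; rewrite plateau_ge0 ?plateau_le1.
Qed.

(** In the fundamental cell a lattice step advances the phase by at most half a period,
    so that the sine in [latsum_wave_le] is comparable with the coordinate of
    [invmx A *m w / a] along that step; the largest of these coordinates controls [w]. *)
Lemma wave_sum_decay : exists2 C, 0 <= C & forall a w b, 1 <= a ->
  (forall i, `|(invmx A *m w) i 0| <= a / 2) -> forall j,
  `|w j 0| ^+ L *
    `|latsum (dual a) (fun x => tplateau S x * wave w b x) 0| <= C * a ^+ d.
Proof.
exists (alpha ^+ L * (CN ^+ d * (Mpsi * delta ^+ L))).
  apply: mulr_ge0; first exact: exprn_ge0.
  apply: mulr_ge0; first exact: exprn_ge0.
  by apply: mulr_ge0 => //; exact: exprn_ge0.
move=> a w b a1 hw j; have a0 : 0 < a := lt_le_trans ltr01 a1.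
pose th i : R := dot w (step (dual a) i).
have thE i : (invmx A *m w) i 0 = a * th i.
  by rewrite /th dot_step mulrA divff ?mul1r ?gt_eqF.
have th2 i : `|th i| <= 1 / 2.
  rewrite /th dot_step normrM gtr0_norm ?invr_gt0// mulrC ler_pdivrMr//.
  by apply: (le_trans (hw i)); lra.
have [i0 hi0] : exists i0, forall i, `|th i| <= `|th i0|.
  have [i0 _ h] := @Order.TotalTheory.arg_maxP _ _ _ (Ordinal d0) xpredT (fun i => `|th i|) isT.
  by exists i0 => i; exact: h.
have wj : `|w j 0| <= a * alpha * `|th i0|.
  have -> : w j 0 = \sum_i A j i * (a * th i).
    rewrite -[w in LHS](mulKVmx Au) mxE; apply: eq_bigr => i _.
    by rewrite thE.
  apply: (le_trans (ler_norm_sum _ _ _)).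
  apply: (@le_trans _ _ (\sum_i `|A j i| * (a * `|th i0|))).
    apply: ler_sum => i _; rewrite !normrM (gtr0_norm a0) ler_wpM2l//.
    by rewrite ler_wpM2l ?(ltW a0).
  rewrite -mulr_suml (_ : a * alpha * _ = alpha * (a * `|th i0|)); last by ring.
  by rewrite ler_wpM2r ?sum_row_le// mulr_ge0// ltW.
have key : `|th i0| ^+ L * `|latsum (dual a) (fun x => tplateau S x * wave w b x) 0|
    <= (N a)%:R ^+ d * (Mpsi * (delta / a) ^+ L).
  apply: le_trans (latsum_wave_le (delta := delta) (dual_unit a1) (dual_beta a1) w b
    (ler0n R 2) delta0 _ _ (@tplateau_cube _ _ S S0 S1) (tplateau_smooth i0 a1 (lexx _))).
  - rewrite ler_wpM2r// lerXn2r ?nnegrE//; exact: norm_sin_pi_ge.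
  - move=> k; apply: (le_trans (step_le _ _ a1)).
    by rewrite ler_pdivrMr// ler_peMr.
  - by have := N_ge a; lra.
set Z := `|latsum _ _ _| in key *; have Z0 : 0 <= Z by exact: normr_ge0.
apply: (@le_trans _ _ ((a * alpha) ^+ L * (`|th i0| ^+ L * Z))).
  by rewrite mulrA -exprMn ler_wpM2r// lerXn2r ?nnegrE ?mulr_ge0// ltW.
apply: (le_trans (ler_wpM2l _ key)); first by rewrite exprn_ge0// mulr_ge0// ltW.
rewrite exprMn expr_div_n.
have -> : a ^+ L * alpha ^+ L * ((N a)%:R ^+ d * (Mpsi * (delta ^+ L / a ^+ L))) =
    alpha ^+ L * ((N a)%:R ^+ d * (Mpsi * delta ^+ L)).
  by field; rewrite expf_neq0// gt_eqF.
rewrite -[leRHS]mulrA ler_wpM2l ?exprn_ge0//.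
rewrite [leRHS]mulrAC ler_wpM2r ?Nd_le// mulr_ge0//; exact: exprn_ge0.
Qed.

(** The sum differs little from its translates ([latsum_osc]), and their average over
    ever longer segments tends to zero ([latsum_wave_average]). *)
Lemma wave_sum_integer : exists2 C, 0 <= C & forall a (k : 'cV[int]_d) b K, 1 <= a ->
  k != 0 -> 1 <= K -> (forall j, `|(k j 0)%:~R| <= K) ->
  `|latsum (dual a) (fun x => tplateau S x * wave (int_vec k) b x) 0|
    <= C * a ^+ d * (K / a) ^+ L.
Proof.
pose D : R := (1 + 2 * pi) * delta.
have D0 : 0 <= D by rewrite mulr_ge0// addr_ge0// mulr_ge0// pi_ge0.
exists (d%:R * (2 * CN ^+ d * (2 ^+ L * (Mpsi * 1) * D ^+ L))).
  apply: mulr_ge0 => //; apply: mulr_ge0; first by rewrite mulr_ge0 ?exprn_ge0.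
  apply: mulr_ge0; last exact: exprn_ge0.
  by rewrite mulr1; apply: mulr_ge0 => //; exact: exprn_ge0.
move=> a k b K a1 k0 K1 kK; have a0 : 0 < a := lt_le_trans ltr01 a1.
pose e := D * (K / a).
have Ka0 : 0 <= K / a by rewrite divr_ge0 ?(ltW a0)//; lra.
have e0 : 0 <= e by rewrite mulr_ge0.
have dK : 0 <= delta * K by rewrite mulr_ge0//; lra.
pose F (x : V) := tplateau S x * wave (int_vec k) b x.
have F0 y : ~ cube 2 y -> F y = 0 by rewrite /F => /tplateau_cube -> //; rewrite mul0r.
have smF i : lsmooth (step (dual a) i) L (2 ^+ L * (Mpsi * 1)) e F.
  apply: lsmoothM => //.
    apply: tplateau_smooth => //; rewrite /e mulrA.
    apply: ler_wpM2r; first by rewrite invr_ge0 ltW.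
    have : delta <= delta * K by rewrite ler_peMr.
    have : 0 <= pi * (delta * K) by rewrite mulr_ge0// pi_ge0.
    have -> : D * K = delta * K + 2 * (pi * (delta * K)) by rewrite /D; ring.
    lra.
  apply: (@lsmooth_cos _ _ _ _ _ (fun x : V => 2 * pi * dot (int_vec k) x)
    (2 * pi * dot (int_vec k) (step (dual a) i))) => //.
    rewrite normrM ger0_norm; last by rewrite mulr_ge0// pi_ge0.
    have : `|dot (int_vec k) (step (dual a) i)| <= delta * K / a.
      apply: (le_trans (ler_norm_sum _ _ _)).
      apply: (@le_trans _ _ (\sum_j K * `|step (dual a) i j 0|)).
        by apply: ler_sum => j _; rewrite normrM ler_wpM2r// mxE.
      rewrite -mulr_sumr mulrAC [leRHS]mulrC ler_wpM2l ?step_sum_le//; lra.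
    have p0 : 0 <= 2 * pi :> R by rewrite mulr_ge0// pi_ge0.
    move=> /(ler_wpM2l p0) /le_trans; apply; rewrite /e mulrA [leRHS]mulrA.
    apply: ler_wpM2r; first by rewrite invr_ge0 ltW.
    by rewrite /D -(mulrA _ delta) ler_wpM2r// lerDr.
  by move=> x s; rewrite dotDr dotZr; ring.
set Z := latsum _ _ _.
pose E := d%:R * (2 * (N a)%:R ^+ d * (2 ^+ L * (Mpsi * 1) * e ^+ L)).
have osc t : `|latsum (dual a) F t - Z| <= E.
  exact: (latsum_osc (dual_unit a1) (dual_beta a1) t (ler0n R 2) e0 (N_ge2 a1) F0 smF).
have [i ki] : exists i, k i 0 != 0.
  apply/existsP; apply: contraNT k0 => /existsPn h; apply/eqP/colP => i.
  by have := h i; rewrite negbK mxE => /eqP.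
pose K0 := absz (k i 0).
have kia : `|k i 0| = K0%:Z by rewrite /K0 abszE.
have Kp : (0 < K0)%N by rewrite absz_gt0.
pose q := K0.*2.
have q0 : 0 < q%:R :> R by rewrite ltr0n double_gt0.
have ave T : T%:R * `|Z| <= T%:R * E + 2 * (N a)%:R ^+ d.
  have hN : 2 * (2 * (a * alpha)) + 2 <= (N a)%:R by have := N_ge2 a1; lra.
  have := latsum_wave_average (dual_unit a1) (dual_beta a1) S0 S1 Sh b T kia Kp hN.
  rewrite -/q -/F; set W := \sum_(j < _) _ => hW.
  have h : `|W - (T * q)%:R * Z| <= (T * q)%:R * E.
    rewrite -[X in X%:R * Z]card_ord -[X in X%:R * E]card_ord -!sum1_card !natr_sum.
    rewrite !mulr_suml -sumrB; apply: (le_trans (ler_norm_sum _ _ _)).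
    by apply: ler_sum => j _; rewrite !mul1r osc.
  have : `|(T * q)%:R * Z| <= (T * q)%:R * E + 2 * ((N a)%:R ^+ d * q%:R).
    rewrite -(subKr W ((T * q)%:R * Z)); apply: (le_trans (ler_normB _ _)).
    by rewrite [leRHS]addrC lerD.
  rewrite normrM ger0_norm ?ler0n// natrM => hT.
  rewrite -(ler_pM2r q0) mulrAC; apply: (le_trans hT).
  by rewrite le_eqVlt; apply/orP; left; apply/eqP; ring.
have ZE : `|Z| <= E.
  rewrite leNgt; apply/negP => EZ.
  pose y := 2 * (N a)%:R ^+ d / (`|Z| - E).
  have := ave (Num.truncn y).+1; apply/negP; rewrite -ltNge.
  have := truncnS_gt y; rewrite /y ltr_pdivrMr ?subr_gt0// -/y.
  by rewrite mulrBr; lra.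
apply: (le_trans ZE); rewrite /E /e exprMn.
set Q := (2 ^+ L * _); set z := (K / a) ^+ L.
have -> : d%:R * (2 * CN ^+ d * (Q * D ^+ L)) * a ^+ d * z =
  d%:R * (2 * (CN ^+ d * a ^+ d) * (Q * (D ^+ L * z))) by ring.
rewrite ler_wpM2l// ler_wpM2r//; last by rewrite ler_wpM2l// Nd_le.
apply: mulr_ge0; first by apply: mulr_ge0; [exact: exprn_ge0|rewrite mulr1].
by rewrite mulr_ge0// exprn_ge0.
Qed.

(** The bounds [(K / a)^2l] of [wave_sum_integer] and [K^-2l] of [wave_sum_decay] meet at
    the frequency size [K = a^(1/2)], where both are [a^-l]. *)
Lemma wave_sum_small : exists2 C, 0 <= C & forall a (k : 'cV[int]_d) b, 1 <= a ->
  k != 0 -> (forall i, `|(invmx A *m int_vec k : V) i 0| <= a / 2) ->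
  `|latsum (dual a) (fun x => tplateau S x * wave (int_vec k) b x) 0|
    <= C * a ^+ d / a ^+ l.
Proof.
have [C1 C1p h1] := wave_sum_decay; have [C2 C2p h2] := wave_sum_integer.
exists (C1 + C2); first exact: addr_ge0.
move=> a k b a1 k0 hk; have a0 : 0 < a := lt_le_trans ltr01 a1.
have [j hj] : exists j, forall i, `|k i 0| <= `|k j 0|.
  have [j _ h] := @Order.TotalTheory.arg_maxP _ _ _ (Ordinal d0) xpredT (fun i => `|k i 0|) isT.
  by exists j => i; exact: h.
pose K : R := `|(k j 0)%:~R|.
have kK i : `|(k i 0)%:~R| <= K by rewrite /K -!intr_norm ler_int.
have K1 : 1 <= K.
  rewrite /K -intr_norm ler1z.
  have : k j 0 != 0.
    apply: contraNneq k0 => kj; apply/eqP/colP => i; have := hj i.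
    by rewrite kj normr0 normr_le0 mxE => /eqP.
  by rewrite -normr_gt0 gtz0_ge1.
have ad0 : 0 <= a ^+ d by rewrite exprn_ge0// ltW.
have al0 : 0 < a ^+ l by rewrite exprn_gt0.
rewrite ler_pdivlMr//.
have [Ka|Ka] := leP (K ^+ 2) a.
  apply: (@le_trans _ _ (C2 * a ^+ d)); last by rewrite ler_wpM2r// lerDr.
  rewrite -ler_pdivlMr//; apply: (le_trans (h2 a k b K a1 k0 K1 kK)).
  rewrite ler_wpM2l ?mulr_ge0// -muln2 mulnC exprM expr_div_n -(exprVn a l).
  rewrite lerXn2r ?nnegrE ?divr_ge0 ?invr_ge0 ?exprn_ge0 ?(ltW a0)//; first lra.
  by rewrite expr2 invfM mulrA ler_pdivrMr// mulVf ?gt_eqF// ler_pdivrMr// mul1r.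
apply: (@le_trans _ _ (C1 * a ^+ d)); last by rewrite ler_wpM2r// lerDl.
apply: le_trans (h1 a (int_vec k) b a1 hk j).
rewrite mulrC ler_wpM2r// mxE -/K -muln2 mulnC exprM.
by rewrite lerXn2r ?nnegrE ?exprn_ge0 ?(ltW a0)// ?ltW//; lra.
Qed.

(** Near the centre of the box each plateau is at least 1/2, and the number of lattice
    points there is of the order of [a^d]. *)
Lemma tplateau_sum_ge : exists c a0, [/\ 0 < c, 1 <= a0 & forall a, a0 <= a ->
  c * a ^+ d <= latsum (dual a) (tplateau S) 0].
Proof.
have M0 : 0 <= M := le_trans (normr_ge0 _) (smooth1_bound SM 0).
pose rho := (4 * (M + 1))^-1.
have rho0 : 0 < rho by rewrite invr_gt0; lra.
have half x : `|x - 1 / 2| <= rho -> 1 / 2 <= plateau S x.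
  have [_ [f f1 f2]] := smooth1_diff_shift (1 / 2) (- (1 / 2)) SM.
  have := mean_value_le (1 / 2) x f1 (smooth1_bound f2).
  rewrite -/(plateau S _) -/(plateau S _) (plateau_half S0 S1) => h hx.
  have : (M + M) * `|x - 1 / 2| <= 1 / 2.
    have : (M + M) * `|x - 1 / 2| <= (M + M) * rho by rewrite ler_wpM2l// addr_ge0.
    move/le_trans; apply; rewrite /rho ler_pdivrMr; lra.
  move: h; rewrite ler_norml => /andP[h _]; lra.
pose dl := delta + 1.
have dl0 : 0 < dl by rewrite ltr_wpDl.
exists ((rho / (4 * dl)) ^+ d), (Num.max 1 (2 * dl / rho)).
split=> [||a]; first by rewrite exprn_gt0// divr_gt0// mulr_gt0.
  by rewrite le_max lexx.
rewrite ge_max => /andP[a1 a2]; have a0 : 0 < a := lt_le_trans ltr01 a1.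
pose X := Num.truncn (rho * a / dl).
have X1 : X%:R <= rho * a / dl by rewrite truncn_le divr_ge0 ?mulr_ge0 ?ltW.
have X2 : rho * a / dl < X%:R + 1 by rewrite natr1 truncnS_gt.
have X3 : 2 <= rho * a / dl.
  by rewrite ler_pdivlMr// (mulrC rho) -ler_pdivrMr.
pose h : V := const_mx (1 / 2).
pose base : 'cV[int]_d := map_mx Num.floor (invmx (dual a) *m h).
have near (g : {ffun 'I_d -> 'I_X}) j :
    `|lat (dual a) (window base g) j 0 - 1 / 2| <= rho.
  have -> : lat (dual a) (window base g) j 0 - 1 / 2 =
      (dual a *m (int_vec (window base g) - invmx (dual a) *m h)) j 0.
    by rewrite mulmxBr mulKVmx ?dual_unit// [in RHS]mxE [(- h) j 0]mxE [h j 0]mxE.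
  have hX i : `|(int_vec (window base g) - invmx (dual a) *m h : V) i 0| <= X%:R.
    have -> : (int_vec (window base g) - invmx (dual a) *m h : V) i 0 =
        (Num.floor ((invmx (dual a) *m h) i 0) + (g i)%:Z)%:~R
        - (invmx (dual a) *m h) i 0 by rewrite !mxE.
    have /andP[f1 f2] := floor_bounds ((invmx (dual a) *m h) i 0).
    have g1 : (g i)%:R + 1 <= X%:R :> R by rewrite natr1 ler_nat.
    have g0 : 0 <= (g i)%:R :> R by exact: ler0n.
    by rewrite intrD -[(g i)%:Z%:~R]/((g i)%:R) ler_norml; lra.
  rewrite mxE; apply: (le_trans (ler_norm_sum _ _ _)).
  apply: (@le_trans _ _ (\sum_i `|dual a j i| * X%:R)).
    by apply: ler_sum => i _; rewrite normrM ler_wpM2l.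
  rewrite -mulr_suml.
  have : \sum_i `|dual a j i| <= dl / a.
    apply: (@le_trans _ _ (a^-1 * \sum_i `|invmx A i j|)).
      rewrite mulr_sumr; apply: ler_sum => i _.
      by rewrite !mxE normrM gtr0_norm ?invr_gt0.
    rewrite [leRHS]mulrC ler_wpM2l ?invr_ge0 ?(ltW a0)//.
    by apply: (le_trans (sum_col_le _ _)); rewrite lerDl.
  move=> /(ler_wpM2r (ler0n R X)) /le_trans; apply.
  have dla : 0 <= dl / a by rewrite divr_ge0 ?ltW.
  apply: (le_trans (ler_wpM2l dla X1)).
  have -> : dl / a * (rho * a / dl) = rho * (dl / dl) * (a / a) by ring.
  by rewrite !divff ?gt_eqF// !mulr1.
apply: le_trans (latsum_ge_seq (r := [seq window base g | g <- enum {ffun 'I_d -> 'I_X}])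
  (dual_unit a1) (dual_beta a1) 0 (ler0n R 2) _ (@tplateau_cube _ _ S S0 S1)
  (tplateau_ge0 Sh)); last first.
  by rewrite map_inj_uniq ?enum_uniq//; exact: window_inj.
rewrite big_map big_enum /=.
apply: (@le_trans _ _ (\sum_(g : {ffun 'I_d -> 'I_X}) (1 / 2) ^+ d)).
  rewrite sumr_const card_ffun !card_ord -[leRHS]mulr_natl natrX -!exprMn.
  have c0 : 0 <= rho / (4 * dl) by rewrite divr_ge0 ?mulr_ge0 ?ltW.
  have c1 : 0 <= rho / (4 * dl) * a by rewrite mulr_ge0 // ltW.
  have c2 : 0 <= X%:R * (1 / 2) :> R by rewrite mulr_ge0 ?divr_ge0.
  apply: lerXn2r; rewrite ?nnegrE//.
  have -> : rho / (4 * dl) * a = rho * a / dl / 4 by field; rewrite gt_eqF.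
  lra.
apply: ler_sum => g _; rewrite addr0 -[X in _ ^+ X]card_ord -prodr_const.
by apply: ler_prod => j _; rewrite divr_ge0//= half// near.
Qed.

End scaled_lattice.

(** * Dyadic summation over a Frolov lattice *)

Section dyadic.
Context {R : realType}.

(** One term of the exponential series bounds [j^e] by a multiple of [(3/2)^j]. *)
Lemma sum_pow_geometric (e : nat) : exists2 G : R, 0 <= G &
  forall J, \sum_(j < J) (j.+1%:R ^+ e / 2 ^+ j) <= G.
Proof.
pose c : R := ln (3 / 2).
have c0 : 0 < c by rewrite ln_gt0//; lra.
pose E := e.+1; pose K : R := E`!%:R / c ^+ E * (3 / 2).
have K0 : 0 <= K by rewrite mulr_ge0 ?divr_ge0 ?exprn_ge0 ?(ltW c0)//; lra.
have H j : (j.+1%:R : R) ^+ e <= K * (3 / 2) ^+ j.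
  apply: (@le_trans _ _ (j.+1%:R ^+ E)); first by rewrite ler_weXn2l ?ler1n.
  have h0 : 0 <= c * j.+1%:R by rewrite mulr_ge0 ?(ltW c0).
  have := expR_ge1Dxn e h0; rewrite -/E.
  have -> : expR (c * j.+1%:R) = (3 / 2) ^+ j.+1.
    by rewrite expRM_natr /c lnK// posrE; lra.
  rewrite exprMn exprS => h.
  have cf : 0 < E`!%:R / c ^+ E by rewrite divr_gt0 ?ltr0n ?fact_gt0// exprn_gt0.
  have -> : j.+1%:R ^+ E = E`!%:R / c ^+ E * (c ^+ E * j.+1%:R ^+ E / E`!%:R).
    have f0 : E`!%:R != 0 :> R by rewrite pnatr_eq0 -lt0n fact_gt0.
    have e0 : c ^+ E != 0 by rewrite expf_neq0// gt_eqF.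
    by move: (c ^+ E) (E`!%:R) e0 f0 => z y z0 y0; field; rewrite z0 y0.
  rewrite /K -[leRHS]mulrA ler_wpM2l ?(ltW cf)//; lra.
exists (K * 4); first by rewrite mulr_ge0.
move=> J; apply: (@le_trans _ _ (\sum_(j < J) K * (3 / 4) ^+ j)).
  apply: ler_sum => j _; rewrite ler_pdivrMr ?exprn_gt0//.
  apply: (le_trans (H j)); rewrite -(mulrA K) -exprMn.
  by rewrite (_ : 3 / 4 * 2 = 3 / 2 :> R)//; lra.
rewrite -mulr_sumr ler_wpM2l//.
have -> : \sum_(j < J) (3 / 4) ^+ j = (1 - (3 / 4) ^+ J) * 4 :> R.
  elim: (J) => [|n IH]; first by rewrite big_ord0 expr0 subrr mul0r.
  by rewrite big_ord_recr /= IH exprS; lra.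
by have : 0 <= (3 / 4 : R) ^+ J by [rewrite exprn_ge0//; lra]; lra.
Qed.

(** The first entry is determined by the others, which are at most [n]. *)
Lemma card_ffun_sum d Q n :
  (#|[pred s : {ffun 'I_d.+1 -> 'I_Q} | \sum_i s i == n]| <= n.+1 ^ d)%N.
Proof.
pose f (s : {ffun 'I_d.+1 -> 'I_Q}) : {ffun 'I_d -> 'I_n.+1} :=
  [ffun i => inord (s (lift ord0 i))].
rewrite -[n.+1 in leqRHS]card_ord -[d in leqRHS]card_ord -card_ffun.
apply: (@leq_card_in _ _ f) => s t; rewrite !inE => /eqP sn /eqP tn st.
have le (z : {ffun 'I_d.+1 -> 'I_Q}) i : (\sum_i z i)%N = n -> (z i <= n)%N.
  by move=> <-; rewrite (bigD1 i)//= leq_addr.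
have e i : s (lift ord0 i) = t (lift ord0 i).
  move/ffunP: st => /(_ i); rewrite !ffunE => /(congr1 val).
  by rewrite /= !inordK ?ltnS ?le// => h; apply/val_inj.
apply/ffunP => i; case: (unliftP ord0 i) => [j|] ->; first exact: e.
apply/val_inj => /=; move: sn; rewrite -tn !big_ord_recl.
by rewrite (eq_bigr (fun i => val (t (lift ord0 i)))) => [/addIn//|k _]; rewrite e.
Qed.

(** With [n = n0 + j], the count [(n + 1)^d] is at most [(n0 + 1)^d (j + 1)^d], and the
    second factor is absorbed by the geometric decay in [j]. *)
Lemma sum_dyadic_tail d (p : nat) : (0 < p)%N -> exists2 G : R, 0 <= G &
  forall Q n0, \sum_(s : {ffun 'I_d.+1 -> 'I_Q} | (n0 <= \sum_i s i)%N)
     2 ^- (p * \sum_i s i) <= G * n0.+1%:R ^+ d / 2 ^+ (p * n0).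
Proof.
move=> p0; have [G G0 hG] := sum_pow_geometric d.
exists G => // Q n0.
pose B := (d.+1 * Q).+1.
have sB (s : {ffun 'I_d.+1 -> 'I_Q}) : (\sum_i s i < B)%N.
  rewrite ltnS; apply: (@leq_trans (\sum_(i < d.+1) Q)).
    by apply: leq_sum => i _; exact: ltnW.
  by rewrite sum_nat_const card_ord.
rewrite (partition_big (fun s => Ordinal (sB s)) xpredT)//=.
apply: (@le_trans _ _ (\sum_(n < B | (n0 <= n)%N) n.+1%:R ^+ d / 2 ^+ (p * n))).
  rewrite [leRHS]big_mkcond; apply: ler_sum => n _; case: ifPn => n0n.
    apply: (@le_trans _ _ (\sum_(s in [pred s : {ffun 'I_d.+1 -> 'I_Q} |
        (\sum_i s i)%N == n]) 2 ^- (p * n))).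
      rewrite (eq_bigl (fun s => s \in [pred s : {ffun 'I_d.+1 -> 'I_Q} |
        (\sum_i s i)%N == n])).
        by apply: ler_sum => s; rewrite inE => /eqP ->.
      move=> s; rewrite inE -(inj_eq val_inj) /=.
      by case: eqP => [->|]; [rewrite n0n|rewrite andbF].
    rewrite sumr_const -[leLHS]mulr_natl ler_wpM2r ?invr_ge0 ?exprn_ge0//.
    by rewrite -natrX ler_nat card_ffun_sum.
  rewrite big1// => s /andP[h1 /eqP/(congr1 val)/= h2].
  by move: n0n; rewrite -h2 h1.
apply: (@le_trans _ _ (\sum_(n < B | (n0 <= n)%N)
   n0.+1%:R ^+ d / 2 ^+ (p * n0) * ((n - n0).+1%:R ^+ d / 2 ^+ (n - n0)))).
  apply: ler_sum => n n0n.
  have -> : (p * n = p * n0 + p * (n - n0))%N by rewrite -mulnDr subnKC.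
  rewrite exprD mulrACA -exprMn -invfM ler_pM ?exprn_ge0 ?invr_ge0 ?mulr_ge0 ?exprn_ge0//.
    apply: lerXn2r; rewrite ?nnegrE ?mulr_ge0// -natrM ler_nat; nia.
  rewrite lef_pV2 ?posrE ?mulr_gt0 ?exprn_gt0//.
  by rewrite ler_wpM2l ?exprn_ge0// ler_weXn2l ?ler1n// leq_pmull.
rewrite -mulr_sumr mulrC mulrA ler_wpM2r ?invr_ge0 ?exprn_ge0//.
rewrite ler_wpM2r ?exprn_ge0//; apply: le_trans (hG B).
rewrite -(big_geq_mkord n0 B xpredT (fun n => (n - n0).+1%:R ^+ d / 2 ^+ (n - n0))).
rewrite -[n0 in \sum_(n0 <= _ < _) _]add0n big_addn big_mkord.
rewrite (eq_bigr (fun j : 'I_(B - n0) => j.+1%:R ^+ d / 2 ^+ j)); last first.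
  by move=> j _; rewrite addnK.
rewrite -!(big_mkord xpredT (fun j => j.+1%:R ^+ d / 2 ^+ j : R)).
rewrite [leRHS](@big_cat_nat _ _ _ (B - n0)) ?leq_subr//= lerDl.
by apply: sumr_ge0 => j _; rewrite divr_ge0 ?exprn_ge0.
Qed.

End dyadic.

Section frolov_sums.
Context {R : realType}.

(** The minimum of [u] and [1 / |y|], which bounds the Fourier coefficients of the
    indicator of an interval of length [u]. In this form a product of such factors is
    [pr u] divided by a product of maxima. *)
Definition omega (u y : R) : R := u / Num.max 1 (u * `|y|).

Lemma max1_gt0 (x : R) : 0 < Num.max 1 x.
Proof. by rewrite lt_max ltr01. Qed.

Lemma omega_ge0 u y : 0 <= u -> 0 <= omega u y.
Proof. by move=> u0; rewrite divr_ge0// ltW// max1_gt0. Qed.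

(** Moving the frequency costs a factor polynomial in the displacement. *)
Lemma omega_transfer u x y : 0 <= u <= 1 ->
  omega u x <= (1 + `|x - y|) * omega u y.
Proof.
move=> /andP[u0 u1]; rewrite /omega mulrCA ler_wpM2l//.
rewrite -[leLHS]mul1r ler_pdivrMr ?max1_gt0// mulrAC ler_pdivlMr ?max1_gt0// mul1r.
have := normr_ge0 (x - y); set z := `|x - y| => z0.
have yx : `|y| <= `|x| + z by rewrite /z distrC -{1}(subrK x y) addrC ler_normD.
have m1 : 1 <= Num.max 1 (u * `|x|) by rewrite le_max lexx.
have mx : u * `|x| <= Num.max 1 (u * `|x|) by rewrite le_max lexx orbT.
move: m1 mx; set mm := Num.max 1 _ => m1 mx.
rewrite ge_max; apply/andP; split; first nra.
have : u * `|y| <= u * `|x| + u * z by rewrite -mulrDr ler_wpM2l.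
have : u * z <= z * mm by nra.
lra.
Qed.

Variables (d : nat) (A : 'M[R]_d.+1).
Hypothesis frA : frolov_matrix A.

Lemma frolov_count (hi : 'cV[R]_d.+1) (s : seq 'cV[int]_d.+1) : uniq s ->
  (forall j, 0 <= hi j 0) ->
  (forall m, m \in s -> forall j, `|(A *m int_vec m) j 0| <= hi j 0) ->
  (size s)%:R <= \prod_j (2 * hi j 0) + 1.
Proof.
move=> us hi0 hs; have [Au _ /(_ (- hi) hi)] := frA.
case=> [j|finS cardS]; first by rewrite mxE; have := hi0 j; lra.
have -> : \prod_j (2 * hi j 0) = pr (hi - - hi).
  by apply: eq_bigr => j _; rewrite !mxE opprK mulrDl mul1r.
apply: le_trans cardS; rewrite ler_nat.
rewrite -(size_map (fun m => A *m int_vec m)) uniq_leq_size//.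
  rewrite map_inj_uniq// => m n /(can_inj (mulKmx Au)) /colP e.
  by apply/colP => i; have := e i; rewrite !mxE => /eqP; rewrite eqr_int => /eqP.
move=> _ /mapP[m ms ->]; rewrite in_fset_set// inE; split; first by exists m.
by move=> j; rewrite mxE -ler_norml hs.
Qed.

(** Sort the lattice points by the integral parts [s_j] of the binary logarithms of the
    maxima [t_j] in the denominators of [omega]. As the coordinates of a nonzero lattice
    point have product at least 1 in modulus, the product of the [t_j] is at least
    [X = a^(d+1) pr u], so the sum of the [s_j] is at least [n0]. The points with given [s]
    lie in a box of volume [4^(d+1) 2^(sum s) / X], which bounds their number by the counting
    property, because that volume is bounded below as soon as one such point exists. *)
Lemma frolov_sum (p : nat) : (0 < p)%N -> exists2 C : R, 0 <= C &
  forall (a : R) (u : 'cV[R]_d.+1) n0 (s : seq 'cV[int]_d.+1), 1 <= a ->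
  (forall j, 0 < u j 0) ->
  a ^+ d.+1 * pr u <= 2 ^+ (n0 + d.+1) ->
  (forall n, a ^+ d.+1 * pr u <= 2 ^+ (n + d.+1) -> (n0 <= n)%N) ->
  uniq s -> 0 \notin s ->
  \sum_(m <- s) \prod_j omega (u j 0) (a * (A *m int_vec m) j 0) ^+ p.+1
    <= C * n0.+1%:R ^+ d / a ^+ (p.+1 * d.+1).
Proof.
move=> p0; have [G G0 hG] := @sum_dyadic_tail R d p p0.
pose kd : R := 4 ^+ d.+1 + 2 ^+ d.+1.
have kd0 : 0 <= kd by rewrite addr_ge0 ?exprn_ge0.
exists (kd * G * (2 ^+ d.+1) ^+ p); first by rewrite !mulr_ge0 ?exprn_ge0.
move=> a u n0 s a1 u0 Xn0 n0min us s0.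
have a0 : 0 < a := lt_le_trans ltr01 a1.
set X := a ^+ d.+1 * pr u in Xn0 n0min.
have XE : X = a ^+ d.+1 * pr u by [].
clearbody X.
have v0 : 0 < pr u by apply: prodr_gt0.
have X0 : 0 < X by rewrite XE mulr_gt0 ?exprn_gt0.
pose y (m : 'cV[int]_d.+1) j : R := a * (A *m int_vec m) j 0.
pose t m j : R := Num.max 1 (u j 0 * `|y m j|).
have t1 m j : 1 <= t m j by rewrite le_max lexx.
pose sg m j : nat := trunc_log 2 (Num.truncn (t m j)).
have tn m j : (0 < Num.truncn (t m j))%N by rewrite truncn_gt0.
have sg1 m j : 2 ^+ sg m j <= t m j.
  have /andP[h _] := trunc_log_bounds (ltnSn 1) (tn m j).
  apply: (@le_trans _ _ (Num.truncn (t m j))%:R).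
    by rewrite -natrX ler_nat.
  by rewrite truncn_le (le_trans ler01).
have sg2 m j : t m j < 2 ^+ (sg m j).+1.
  have /andP[_ h] := trunc_log_bounds (ltnSn 1) (tn m j).
  apply: (lt_le_trans (truncnS_gt _)).
  by rewrite -natrX ler_nat.
have prodt m : m \in s -> X <= \prod_j t m j.
  move=> ms; have m0 : m != 0 by apply: contraNneq s0 => <-.
  have [_ /(_ m m0) h _] := frA.
  apply: (@le_trans _ _ (\prod_j (u j 0 * `|y m j|))).
    rewrite big_split /= XE mulrC ler_pM2l//.
    rewrite /y; under eq_bigr => j _ do rewrite normrM (gtr0_norm a0).
    rewrite big_split /= prodr_const card_ord -[leLHS]mulr1 ler_wpM2l ?exprn_ge0 ?(ltW a0)//.
    by rewrite -normr_prod.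
  by apply: ler_prod => j _; rewrite mulr_ge0 ?(ltW (u0 j))//= le_max lexx orbT.
pose Q := (\max_(m <- s) \max_j sg m j).+1.
have sQ m j : m \in s -> (sg m j < Q)%N.
  move=> ms; rewrite ltnS (leq_trans (leq_bigmax j))//.
  by apply: (@leq_bigmax_seq _ _ xpredT (fun m => \max_j sg m j)).
pose f m : {ffun 'I_d.+1 -> 'I_Q} := [ffun j => inord (sg m j)].
have fE m j : m \in s -> f m j = sg m j :> nat.
  by move=> ms; rewrite ffunE inordK// sQ.
pose W (z : {ffun 'I_d.+1 -> 'I_Q}) := (\sum_i z i)%N.
pose term (z : {ffun 'I_d.+1 -> 'I_Q}) : R := pr u ^+ p.+1 / 2 ^+ (p.+1 * W z).
have term0 z : 0 <= term z by rewrite divr_ge0 ?exprn_ge0 ?(ltW v0).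
have XW m : m \in s -> X <= 2 ^+ (W (f m) + d.+1).
  move=> ms; apply: (le_trans (prodt m ms)).
  apply: (@le_trans _ _ (\prod_j 2 ^+ (sg m j).+1)).
    by apply: ler_prod => j _; rewrite (le_trans ler01 (t1 m j))/= ltW.
  have -> : W (f m) = (\sum_j sg m j)%N by apply: eq_bigr => j _; rewrite fE.
  rewrite -expr_sum (eq_bigr (fun j => (sg m j + 1)%N)); last by move=> j _; rewrite addn1.
  by rewrite big_split /= sum1_card card_ord.
have termP m : m \in s -> \prod_j omega (u j 0) (y m j) ^+ p.+1 <= term (f m).
  move=> ms; rewrite prodrXl /term mulnC exprM -exprVn -exprMn.
  have o0 : 0 <= \prod_j omega (u j 0) (y m j).
    by apply: prodr_ge0 => j _; rewrite omega_ge0// ltW.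
  have z0 : 0 <= pr u / 2 ^+ W (f m) by rewrite divr_ge0 ?exprn_ge0 ?(ltW v0).
  apply: lerXn2r; rewrite ?nnegrE//.
  rewrite /omega big_split /= prodfV ler_wpM2l ?(ltW v0)//.
  rewrite lef_pV2 ?posrE ?exprn_gt0//; last by apply: prodr_gt0 => j _; exact: max1_gt0.
  rewrite /W expr_sum; apply: ler_prod => j _; rewrite exprn_ge0//= fE//.
have cnt z : (size [seq m <- s | f m == z])%:R <=
    (if (n0 <= W z)%N then kd * 2 ^+ W z / X else 0) :> R.
  have [e|] := eqVneq [seq m <- s | f m == z] [::].
    by rewrite e; case: ifP => // _; rewrite mulr_ge0 ?mulr_ge0 ?invr_ge0 ?exprn_ge0 ?(ltW X0).
  rewrite -size_eq0 -lt0n -has_predT => /hasP[m0]; rewrite mem_filter => /andP[/eqP fz m0s] _.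
  have Xz : X <= 2 ^+ (W z + d.+1) by rewrite -fz; exact: XW.
  rewrite n0min//.
  pose hi : 'cV[R]_d.+1 := \col_j (2 ^+ (z j).+1 / (u j 0 * a)).
  have hiE j : hi j 0 = 2 ^+ (z j).+1 / (u j 0 * a) by rewrite mxE.
  have := @frolov_count hi _ (filter_uniq (fun m => f m == z) us).
  have hi0 j : 0 <= hi j 0 by rewrite hiE divr_ge0 ?exprn_ge0 ?mulr_ge0 ?(ltW (u0 j)) ?(ltW a0).
  move=> /(_ hi0) h; apply: le_trans (h _) _ => [m|].
    rewrite mem_filter => /andP[/eqP fm ms] j.
    rewrite hiE ler_pdivlMr ?mulr_gt0// -fm fE//.
    apply: ltW; apply: le_lt_trans (sg2 m j).
    by rewrite /t le_max /y normrM (gtr0_norm a0) mulrC -mulrA lexx orbT.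
  have -> : \prod_j (2 * hi j 0) = 4 ^+ d.+1 * 2 ^+ W z / X.
    rewrite /W expr_sum -[in 4 ^+ _](card_ord d.+1) -prodr_const.
    rewrite XE mulrC -[in a ^+ _](card_ord d.+1) -[a ^+ _]prodr_const /pr -big_split /=.
    rewrite -prodfV -!big_split /=; apply: eq_bigr => j _.
    rewrite hiE exprS; move: (2 ^+ z j : R) (u j 0) (u0 j) => Z w w0.
    by field; rewrite !gt_eqF.
  have : 1 <= 2 ^+ d.+1 * 2 ^+ W z / X by rewrite ler_pdivlMr// mul1r -exprD addnC.
  by rewrite /kd !mulrDl lerD2l.
apply: (@le_trans _ _ (\sum_(m <- s) term (f m))).
  by rewrite big_seq [leRHS]big_seq; apply: ler_sum => m ms; exact: termP.
have -> : \sum_(m <- s) term (f m) = \sum_z (size [seq m <- s | f m == z])%:R * term z.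
  rewrite (eq_bigr (fun m => \sum_(z | f m == z) term z)); last first.
    by move=> m _; rewrite (big_pred1 (f m))// => z; rewrite eq_sym.
  rewrite (exchange_big_dep xpredT)//=; apply: eq_bigr => z _.
  by rewrite -big_filter big_const_seq count_predT iter_addr_0 mulr_natl.
apply: (@le_trans _ _ (\sum_(z | (n0 <= W z)%N)
    kd * pr u ^+ p.+1 / X * 2 ^- (p * W z))).
  rewrite [leRHS]big_mkcond; apply: ler_sum => z _.
  apply: (le_trans (ler_wpM2r (term0 z) (cnt z))).
  case: ifP => _; last by rewrite mul0r.
  rewrite /term mulSn exprD invfM le_eqVlt; apply/orP; left; apply/eqP.
  have W0 : 2 ^+ W z != 0 :> R by rewrite expf_neq0.
  have W1 : 2 ^+ (p * W z) != 0 :> R by rewrite expf_neq0.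
  move: (2 ^+ W z : R) (2 ^+ (p * W z) : R) (pr u ^+ p.+1) W0 W1 => Z1 Z2 v Z10 Z20.
  by field; rewrite Z20 Z10 gt_eqF.
rewrite -mulr_sumr.
have c0 : 0 <= kd * pr u ^+ p.+1 / X.
  by rewrite divr_ge0 ?(ltW X0)// mulr_ge0// exprn_ge0// ltW.
apply: (le_trans (ler_wpM2l c0 (hG Q n0))).
have h2 : 2 ^- (p * n0) <= (2 ^+ d.+1 / X) ^+ p.
  rewrite mulnC exprM -exprVn; apply: lerXn2r; rewrite ?nnegrE ?invr_ge0 ?divr_ge0 ?exprn_ge0 ?(ltW X0)//.
  by rewrite ler_pdivlMr// ler_pdivrMl ?exprn_gt0// -exprD.
have c1 : 0 <= kd * pr u ^+ p.+1 / X * (G * n0.+1%:R ^+ d).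
  by rewrite mulr_ge0// mulr_ge0// exprn_ge0.
rewrite mulrA; apply: (le_trans (ler_wpM2l c1 h2)).
rewrite expr_div_n le_eqVlt; apply/orP; left; apply/eqP.
rewrite mulnC exprM.
have -> : (a ^+ d.+1) ^+ p.+1 = X ^+ p.+1 / pr u ^+ p.+1.
  by rewrite XE exprMn mulfK// expf_neq0// gt_eqF.
have X1 : X ^+ p != 0 by rewrite expf_neq0// gt_eqF.
have v1 : pr u ^+ p != 0 by rewrite expf_neq0// gt_eqF.
rewrite !exprS; move: (X ^+ p) (pr u ^+ p) (n0.+1%:R ^+ d : R) ((2 * 2 ^+ d) ^+ p : R) X1 v1.
move: (X) (pr u) X0 v0 => x v x0 v0 x1 v1 Z1 Z2 h1 h3.
by field; rewrite h3 h1 !gt_eqF.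
Qed.

End frolov_sums.

(** * Box splines *)

Section interval_integrals.
Context {R : realType}.
Local Notation mu := (@lebesgue_measure R).
Implicit Types f g : R -> R.

Lemma continuous_integrable_co f (a b : R) : continuous f ->
  mu.-integrable `[a, b[ (EFin \o f).
Proof.
move=> cf; have : mu.-integrable `[a, b] (EFin \o f).
  apply: continuous_compact_integrable; first exact: segment_compact.
  exact: continuous_subspaceT.
by apply: integrableS => //; apply: subset_itvl; rewrite bnd_simp.
Qed.

(** Half-open on the right like [hat1]. *)
Definition iint f (a b : R) : R := \int[mu]_(y in `[a, b[) f y.

Lemma iintD f g a b : continuous f -> continuous g ->
  iint (fun y => f y + g y) a b = iint f a b + iint g a b.
Proof. by move=> cf cg; rewrite /iint RintegralD//; exact: continuous_integrable_co. Qed.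

Lemma iintB f g a b : continuous f -> continuous g ->
  iint (fun y => f y - g y) a b = iint f a b - iint g a b.
Proof. by move=> cf cg; rewrite /iint RintegralB//; exact: continuous_integrable_co. Qed.

Lemma iintZ k f a b : continuous f -> iint (fun y => k * f y) a b = k * iint f a b.
Proof. by move=> cf; rewrite /iint RintegralZl//; exact: continuous_integrable_co. Qed.

Lemma iint_cst k a b : a <= b -> iint (fun=> k) a b = k * (b - a).
Proof.
move=> ab; rewrite /iint Rintegral_cst//; congr (_ * _).
transitivity (fine (lebesgue_measure `[a, b[%classic)); first by [].
rewrite lebesgue_measure_itv/= lte_fin.
have [//|ba] := ltP a b.
by rewrite (@le_anti _ _ a b) ?ab// subrr.
Qed.

Lemma iint_le f g a b : continuous f -> continuous g -> (forall y, f y <= g y) ->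
  iint f a b <= iint g a b.
Proof.
by move=> cf cg fg; apply: le_Rintegral => //; exact: continuous_integrable_co.
Qed.

Lemma iint_dist_le f g a b e : a <= b -> continuous f -> continuous g ->
  (forall y, `|f y - g y| <= e) -> `|iint f a b - iint g a b| <= e * (b - a).
Proof.
move=> ab cf cg fg; rewrite -iintB//.
have cfg : continuous (fun y => f y - g y) by move=> y; apply: cvgB; [exact: cf|exact: cg].
have ce (k : R) : continuous (fun _ : R => k) by exact: cst_continuous.
rewrite ler_norml -mulNr -!iint_cst//; apply/andP; split; apply: iint_le => // y.
  by have := fg y; rewrite ler_norml => /andP[].
by have := fg y; rewrite ler_norml => /andP[].
Qed.

Lemma continuous_sum (I : Type) (r : seq I) (F : I -> R -> R) :
  (forall i, continuous (F i)) -> continuous (fun x => \sum_(i <- r) F i x).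
Proof.
move=> cF; elim: r => [|i r IH].
  by under eq_fun do rewrite big_nil; exact: cst_continuous.
under eq_fun do rewrite big_cons.
by move=> x; apply: cvgD; [exact: cF|exact: IH].
Qed.

Lemma iint_sum (I : Type) (r : seq I) (F : I -> R -> R) a b : a <= b ->
  (forall i, continuous (F i)) ->
  iint (fun y => \sum_(i <- r) F i y) a b = \sum_(i <- r) iint (F i) a b.
Proof.
move=> ab cF; elim: r => [|i r IH].
  under eq_fun do rewrite big_nil.
  by rewrite big_nil iint_cst// mul0r.
under eq_fun do rewrite big_cons.
by rewrite big_cons iintD ?IH//; exact: continuous_sum.
Qed.

Lemma iint_derive f f' a b : a <= b -> continuous f' ->
  (forall x : R, is_derive x 1 f (f' x)) -> iint f' a b = f b - f a.
Proof.
move=> ab cf' df; move: ab; rewrite le_eqVlt => /predU1P[->|ab].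
  by rewrite subrr /iint set_itvco0 Rintegral_set0.
have cf : continuous f by move=> x; exact: is_derive1_continuous (df x).
rewrite /iint Rintegral_itv_bndo_bndc; last exact: continuous_integrable_co.
rewrite /Rintegral (@continuous_FTC2 _ f' f)//.
- exact: continuous_subspaceT.
- split; first by move=> x _; exact: ex_derive.
  + exact: cvg_at_right_filter (cf a).
  + exact: cvg_at_left_filter (cf b).
- by move=> x _; rewrite derive1E derive_val.
Qed.

Lemma iint_cos (al be a b : R) : a <= b -> al != 0 ->
  iint (fun y => cos (be + y * al)) a b = (sin (be + b * al) - sin (be + a * al)) / al.
Proof.
move=> ab al0.
have c1 : continuous (fun y : R => cos (be + y * al)).
  move=> x; apply: continuous_comp; last exact: continuous_cos.
  by apply: cvgD; [exact: cvg_cst|apply: cvgM; [exact: cvg_id|exact: cvg_cst]].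
have d1 (x : R) : is_derive x 1 (fun y => al^-1 * sin (be + y * al)) (cos (be + x * al)).
  have h := is_derive1_affine (is_derive_sin (be + x * al)).
  apply: (is_derive_eq (is_derive1M (is_derive_cst al^-1 x 1) h)).
  by rewrite mul0r add0r mulrC mulfK.
by rewrite (iint_derive ab c1 d1) -mulrBr mulrC.
Qed.

End interval_integrals.

Section hat_functions.
Context {R : realType}.
Local Notation mu := (@lebesgue_measure R).

Lemma conv_hat1 (f : R -> R) (u x : R) :
  Defs.conv f (hat1 u) x = iint (fun y => f (x - y)) (- (u / 2)) (u / 2).
Proof.
rewrite /Defs.conv /iint [RHS]Rintegral_mkcond; apply: eq_Rintegral => y _.
rewrite /hat1 patchE indicE.
by case: (y \in _); rewrite ?mulr1 ?mulr0.
Qed.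

Lemma hatS (r : nat) (u x : R) :
  hat r.+2 u x = iint (fun y => hat r.+1 u (x - y)) (- (u / 2)) (u / 2).
Proof. by rewrite -conv_hat1. Qed.

Lemma hat2E (u x : R) : 0 < u -> hat 2 u x = Num.max 0 (u - `|x|).
Proof.
move=> u0; rewrite hatS /iint.
rewrite (_ : \int[mu]_(y in `[- (u / 2), u / 2[) hat 1 u (x - y) =
   \int[mu]_(y in `[- (u / 2), u / 2[ `&` `](x - u / 2), (x + u / 2)]) cst 1 y); last first.
  rewrite Rintegral_mkcond [RHS]Rintegral_mkcond; apply: eq_Rintegral => y _.
  rewrite !patchE in_setI; case: (y \in `[- (u / 2), u / 2[%classic) => //=.
  rewrite /hat /= /hat1 indicE.
  have -> : (x - y \in `[- (u / 2), u / 2[%classic) = (y \in `](x - u / 2), (x + u / 2)]%classic).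
    by apply/idP/idP; rewrite !inE /= !in_itv /=; lra.
  by case: (_ \in _).
rewrite Rintegral_cst ?mul1r; last by apply: measurableI.
have [x0|x0] := leP 0 x.
  rewrite (_ : _ `&` _ = `](x - u / 2), (u / 2)[%classic); last first.
    apply/seteqP; split => y /=; rewrite !in_itv /=; [move=> []|split]; lra.
  rewrite ger0_norm//; transitivity (fine (lebesgue_measure `]x - u / 2, u / 2[%classic)); first by [].
  rewrite lebesgue_measure_itv/= lte_fin; case: ltP => h.
    by rewrite max_r /=; lra.
  by rewrite max_l //=; lra.
rewrite (_ : _ `&` _ = `[- (u / 2), (x + u / 2)]%classic); last first.
  apply/seteqP; split => y /=; rewrite !in_itv /=; [move=> []|split]; lra.
rewrite ltr0_norm//; transitivity (fine (lebesgue_measure `[- (u / 2), x + u / 2]%classic)); first by [].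
rewrite lebesgue_measure_itv/= lte_fin; case: ltP => h.
  by rewrite max_r /=; lra.
by rewrite max_l //=; lra.
Qed.

Definition lipschitz_with (K : R) (f : R -> R) := forall x y, `|f x - f y| <= K * `|x - y|.

Lemma lipschitz_with_continuous K f : lipschitz_with K f -> continuous f.
Proof.
move=> h x; apply/cvgrPdist_le => e e0.
have K0 : 0 <= K.
  have h10 := h 1 0; rewrite subr0 normr1 mulr1 in h10.
  exact: (le_trans (normr_ge0 _) h10).
have K1 : 0 < K + 1 by rewrite ltr_wpDl.
have e1 : 0 < e / (K + 1) by rewrite divr_gt0.
near=> y.
apply: (le_trans (h x y)).
have : `|x - y| <= e / (K + 1) by near: y; apply: cvgr_dist_le => //; exact: cvg_id.
rewrite ler_pdivlMr// => hy; apply: le_trans hy.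
by rewrite mulrC ler_wpM2l// lerDl.
Unshelve. all: by end_near. Qed.

Lemma hat_lipschitz (r : nat) (u : R) : 0 < u ->
  exists K, lipschitz_with K (hat r.+2 u).
Proof.
move=> u0; elim: r => [|r [K hK]].
  exists 1 => x y; rewrite !hat2E// mul1r.
  have : `| `|x| - `|y| | <= `|x - y| by exact: ler_dist_dist.
  move: (`|x|) (`|y|) => a b; rewrite ler_norml => h; rewrite ler_norml; move: h.
  by case: (leP (u - a) 0); case: (leP (u - b) 0); lra.
have sh x : continuous (fun y => hat r.+2 u (x - y)).
  move=> y; apply: (@continuous_comp _ _ _ (fun y => x - y) (hat r.+2 u)).
    by apply: cvgB; [exact: cvg_cst|exact: cvg_id].
  exact: (lipschitz_with_continuous hK).
exists (K * u) => x y; rewrite !(hatS r.+1).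
apply: (le_trans (iint_dist_le _ (sh x) (sh y) (e := K * `|x - y|) _)).
- lra.
- by move=> z; apply: (le_trans (hK _ _)); rewrite opprB addrA subrK.
- by rewrite le_eqVlt; apply/orP; left; apply/eqP; field.
Qed.

Lemma hat_continuous r (u : R) : 0 < u -> continuous (hat r.+2 u).
Proof. by move=> u0; have [K] := hat_lipschitz r u0; exact: lipschitz_with_continuous. Qed.

Lemma hat_support r (u x : R) : 0 < u -> r.+2%:R * u / 2 <= `|x| -> hat r.+2 u x = 0.
Proof.
move=> u0; elim: r x => [|r IH] x hx.
  by rewrite hat2E// max_l//; lra.
rewrite hatS /iint (@eq_Rintegral _ _ _ _ _ (cst 0)); last first.
  move=> y; rewrite inE /= in_itv /= => /andP[y1 y2]; apply: IH.
  have yu : `|y| <= u / 2 by rewrite ler_norml y1 ltW.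
  have := ler_normD (x - y) y; rewrite subrK.
  move: hx; rewrite -[r.+3%:R]natr1 mulrDl mul1r mulrDl; lra.
by rewrite Rintegral_cst// mul0r.
Qed.

End hat_functions.


(** * Trigonometric approximation of periodized box splines *)

Section symmetric_sums.
Context {V : realType}.
Implicit Types F G : int -> V.

Definition symsum (N : nat) F : V := \sum_(j < N.*2.+1) F (j%:Z - N%:Z).

Lemma symsum_index_le N (j : 'I_N.*2.+1) : `|j%:Z - N%:Z| <= N%:Z.
Proof. by rewrite ler_norml; have := ltn_ord j; lia. Qed.

Lemma symsum0 F : symsum 0 F = F 0.
Proof. by rewrite /symsum big_ord_recl big_ord0 addr0 subr0. Qed.

Lemma symsumS N F : symsum N.+1 F = F (- N.+1%:Z) + symsum N F + F N.+1%:Z.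
Proof.
rewrite /symsum doubleS big_ord_recl big_ord_recr /= -addrA.
congr (F _ + (_ + F _)).
- by rewrite sub0r.
- by apply: eq_bigr => i _; congr F; rewrite /bump /=; lia.
- by rewrite /bump /=; lia.
Qed.

Lemma eq_symsum N F G : (forall k, `|k| <= N%:Z -> F k = G k) -> symsum N F = symsum N G.
Proof. by move=> h; apply: eq_bigr => j _; apply: h; have := ltn_ord j; lia. Qed.

Lemma symsum_shift N F : symsum N (fun n => F (n + 1)) = symsum N F + F (N%:Z + 1) - F (- N%:Z).
Proof.
elim: N => [|N IH]; first by rewrite !symsum0 oppr0 !add0r; ring.
rewrite !symsumS IH.
have -> : - N.+1%:Z + 1 = - N%:Z by lia.
have -> : N%:Z + 1 = N.+1%:Z by lia.
by ring.
Qed.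

End symmetric_sums.

Section interpolation.
Context {R : realType}.
Implicit Types (T c : int -> R).

Lemma dirichlet_kernel K (al : R) :
  symsum K (fun k => cos (k%:~R * al)) * (2 * sin (al / 2)) =
  2 * sin (K.*2.+1%:R * (al / 2)).
Proof.
elim: K => [|K IH]; first by rewrite symsum0 mul0r cos0 !mul1r.
rewrite symsumS intrN mulNr cosN mulrDl (mulrDl (cos _)) IH.
set x := cos _; have -> : K.+1.*2.+1%:R * (al / 2) = K.+1%:R * al + al / 2 :> R.
  by rewrite -[_.*2.+1%:R]natr1 -muln2 natrM; field.
have -> : K.*2.+1%:R * (al / 2) = K.+1%:R * al - al / 2 :> R.
  by rewrite -[_.*2.+1%:R]natr1 -[K.+1%:R]natr1 -muln2 natrM; field.
rewrite sinB sinD /x -[K.+1%:Z%:~R]/(K.+1%:R).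
by ring.
Qed.

Lemma dirichlet_sum K (j : int) : `|j| <= K.*2%:Z ->
  symsum K (fun k => cos (k%:~R * (2 * pi * j%:~R / K.*2.+1%:R))) =
  if j == 0 then K.*2.+1%:R else 0 :> R.
Proof.
move=> jK; set Q := K.*2.+1; have Q0 : 0 < Q%:R :> R by rewrite ltr0n.
case: eqP => [->|/eqP j0].
  rewrite /symsum (eq_bigr (fun=> 1)) => [|i _]; last first.
    by rewrite mulr0 mul0r mulr0 cos0.
  by rewrite sumr_const card_ord.
have := dirichlet_kernel K (2 * pi * j%:~R / Q%:R); rewrite -/Q.
have -> : 2 * pi * j%:~R / Q%:R / 2 = pi * (j%:~R / Q%:R) :> R by field; rewrite gt_eqF.
have -> : Q%:R * (pi * (j%:~R / Q%:R)) = j%:~R * pi :> R by field; rewrite gt_eqF.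
have -> : sin (j%:~R * pi : R) = 0.
  have := @cos_addz_pi R (- (pi / 2)) (absz j) j (esym (abszE j)).
  rewrite cosN cos_pihalf mulr0 => <-.
  by rewrite addrC cosBpihalf.
rewrite mulr0 => /eqP; rewrite mulf_eq0 mulf_eq0 pnatr_eq0 /= => /orP[/eqP//|].
have sj : 0 < `|j%:~R / Q%:R : R| < 1.
  have Qn0 : Q%:R != 0 :> R by rewrite gt_eqF.
  rewrite normr_gt0 mulf_neq0 ?intr_eq0 ?invr_eq0//=.
  rewrite normrM normfV (gtr0_norm Q0) ltr_pdivrMr// mul1r -intr_norm.
  by rewrite -[Q%:R]/(Q%:Z%:~R) ltr_int; lia.
have : `|sin (pi * (j%:~R / Q%:R : R))| != 0.
  rewrite gt_eqF//; move: sj; move: (j%:~R / Q%:R : R) => z.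
  have H (y : R) : 0 < y < 1 -> 0 < sin (pi * y).
    move=> /andP[y0 y1]; apply: sin_gt0_pi; rewrite mulr_gt0 ?pi_gt0//=.
    by rewrite -[X in _ < X]mulr1 ltr_pM2l ?pi_gt0.
  have [z0|z0] := leP 0 z.
    by rewrite ger0_norm// => /H h; rewrite gtr0_norm.
  by rewrite ltr0_norm// => /H; rewrite mulrN sinN => h; rewrite ltr0_norm -?oppr_gt0.
by rewrite normr_eq0 => /negPf ->.
Qed.

(** Coefficients of the trigonometric interpolation of an even function on the
    [2 K + 1] points of a uniform grid. *)
Definition dft K T (k : int) : R :=
  K.*2.+1%:R^-1 * symsum K (fun n => T n * cos (2 * pi * (k * n)%:~R / K.*2.+1%:R)).

Lemma dft_even K T k : dft K T (- k) = dft K T k.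
Proof.
by congr (_ * _); apply: eq_bigr => n _; rewrite mulNr intrN mulrN mulNr cosN.
Qed.

Definition tpoly K c (x : R) : R := symsum K (fun k => c k * cos (2 * pi * k%:~R * x)).

Lemma symsum_pick K T (n : int) : `|n| <= K%:Z ->
  symsum K (fun m => if m == n then T m else 0) = T n.
Proof.
move=> nK; have hn : (absz (n + K%:Z)%R < K.*2.+1)%N by lia.
rewrite /symsum (bigD1 (Ordinal hn))//= big1 => [|i].
  have e : (absz (n + K%:Z))%:Z - K%:Z = n by lia.
  by rewrite addr0 e eqxx.
rewrite -(inj_eq val_inj) /= => h; case: eqP => // e; move: h.
have e2 : absz (i%:Z - K%:Z + K%:Z)%R = i by lia.
by rewrite -e e2 eqxx.
Qed.

(** Discrete orthogonality of the cosines on the grid. *)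
Lemma tpoly_interpolates K T (n : int) : (forall m, T (- m) = T m) -> `|n| <= K%:Z ->
  tpoly K (dft K T) (n%:~R / K.*2.+1%:R) = T n.
Proof.
move=> Te nK; set Q := K.*2.+1; have Q0 : Q%:R != 0 :> R by rewrite pnatr_eq0.
have -> : tpoly K (dft K T) (n%:~R / Q%:R) = Q%:R^-1 * symsum K (fun m => T m *
    symsum K (fun k => cos (k%:~R * (2 * pi * m%:~R / Q%:R))
                     * cos (k%:~R * (2 * pi * n%:~R / Q%:R)))).
  rewrite /tpoly /dft -/Q /symsum.
  under [LHS]eq_bigr => k _ do rewrite -(mulrA Q%:R^-1) mulr_suml mulr_sumr.
  rewrite exchange_big mulr_sumr; apply: eq_bigr => m _ /=.
  rewrite mulrA mulr_sumr; apply: eq_bigr => k _.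
  rewrite intrM -!mulrA; do 2!congr (_ * _).
  by congr (cos _ * cos _); ring.
have D (m : int) : `|m| <= K%:Z ->
    symsum K (fun k => cos (k%:~R * (2 * pi * m%:~R / Q%:R))
                     * cos (k%:~R * (2 * pi * n%:~R / Q%:R))) =
    Q%:R / 2 * ((if m == n then 1 else 0) + (if m == - n then 1 else 0)) :> R.
  move=> mK; pose g j := symsum K (fun k => cos (k%:~R * (2 * pi * j%:~R / Q%:R))) : R.
  transitivity ((g (m - n) + g (m + n)) / 2).
    rewrite /g /symsum -big_split mulr_suml; apply: eq_bigr => k _ /=.
    have -> : (k%:Z - K%:Z)%:~R * (2 * pi * (m - n)%:~R / Q%:R) =
      (k%:Z - K%:Z)%:~R * (2 * pi * m%:~R / Q%:R) -
      (k%:Z - K%:Z)%:~R * (2 * pi * n%:~R / Q%:R) :> R by rewrite intrB; ring.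
    have -> : (k%:Z - K%:Z)%:~R * (2 * pi * (m + n)%:~R / Q%:R) =
      (k%:Z - K%:Z)%:~R * (2 * pi * m%:~R / Q%:R) +
      (k%:Z - K%:Z)%:~R * (2 * pi * n%:~R / Q%:R) :> R by rewrite intrD; ring.
    by rewrite cosB cosD; field.
  rewrite /g !dirichlet_sum; [|lia|lia].
  rewrite subr_eq0 addr_eq0.
  by case: (m == n); case: (m == - n); rewrite -/Q; field.
rewrite (eq_symsum (G := fun m => Q%:R / 2 * (if m == n then T m else 0) +
    Q%:R / 2 * (if m == - n then T m else 0))); last first.
  move=> m mK; rewrite (D m mK).
  by case: (m == n); case: (m == - n); field.
rewrite /symsum big_split -!mulr_sumr -/(symsum K (fun m => if m == n then T m else 0)).
rewrite -/(symsum K (fun m => if m == - n then T m else 0)) !symsum_pick ?normrN//.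
by rewrite Te /=; field.
Qed.

End interpolation.

Section periodization.
Context {R : realType}.

Definition perhat (r : nat) (u x : R) : R :=
  \sum_(m \in [set: int]) hat r u (m%:~R + x).

Lemma perhat_window r (u x : R) N : 0 < u -> `|x| + r.+2%:R * u / 2 <= N.+1%:R ->
  perhat r.+2 u x = symsum N (fun m => hat r.+2 u (m%:~R + x)).
Proof.
move=> u0 hN.
have inj : injective (fun j : 'I_N.*2.+1 => j%:Z - N%:Z).
  by move=> i j /addIr [] /val_inj.
rewrite /perhat (@fsbigE _ _ _ _ _ [seq (fun j : 'I_N.*2.+1 => j%:Z - N%:Z) j | j <- enum 'I_N.*2.+1]).
- by rewrite (eq_bigl xpredT) => [|n]; [rewrite big_map big_enum|rewrite mem_set].
- by rewrite map_inj_uniq ?enum_uniq.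
- by [].
move=> m _ hm; apply: hat_support => //.
have : N.+1%:R <= `|m%:~R : R|.
  rewrite -intr_norm -[N.+1%:R]/(N.+1%:Z%:~R) ler_int leNgt; apply: contra hm.
  move=> mN; have hn : (absz (m + N%:Z)%R < N.*2.+1)%N by lia.
  by apply/mapP; exists (Ordinal hn); rewrite ?mem_enum//=; lia.
have := lerB_normD (m%:~R : R) x.
lra.
Qed.

Lemma perhat_periodic r (u x : R) (n : int) : perhat r u (x + n%:~R) = perhat r u x.
Proof.
rewrite /perhat [RHS](reindex_fsbigT (fun m : int => m + n)); last first.
  by exists (fun m => m - n) => m; rewrite ?addrK ?subrK.
by apply: eq_fsbigr => m _; rewrite intrD -addrA (addrC x).
Qed.

Lemma cos_shift_int (a : R) (n : int) : cos (a + 2 * pi * n%:~R) = cos a.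
Proof.
have -> : 2 * pi * n%:~R = (2 * n)%:~R * pi :> R by rewrite intrM; ring.
rewrite (@cos_addz_pi _ a (absz n).*2); last by rewrite -muln2; lia.
by rewrite -signr_odd odd_double expr0 mul1r.
Qed.

Lemma tpoly_periodic K c (x : R) (n : int) : tpoly K c (x + n%:~R) = tpoly K c x.
Proof.
apply: eq_bigr => j _; congr (_ * _).
rewrite -(cos_shift_int (2 * pi * (j%:Z - K%:Z)%:~R * x) ((j%:Z - K%:Z) * n)).
by congr cos; rewrite intrM; ring.
Qed.

Lemma dist_cos_le (a b : R) : `|cos a - cos b| <= `|a - b|.
Proof.
rewrite -[leRHS]mul1r; apply: (@mean_value_le _ cos (fun x => - sin x)) => x.
by rewrite normrN sin_max.
Qed.

Definition tri (u x : R) : R := Num.max 0 (u - `|x|).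

Lemma tri_split u x : 0 <= u -> tri u x = (`|x + u| + `|x - u|) / 2 - `|x|.
Proof.
move=> u0; rewrite /tri.
case: (leP 0 x) => hx; case: (leP 0 (x + u)) => h1; case: (leP 0 (x - u)) => h2;
  case: (leP (u - `|x|) 0); rewrite ?(ger0_norm hx) ?(ltr0_norm hx) ?(ger0_norm h1)
    ?(ltr0_norm h1) ?(ger0_norm h2) ?(ltr0_norm h2) => h3; lra.
Qed.

Lemma tri_lipschitz u x y : `|tri u x - tri u y| <= `|x - y|.
Proof.
have : `| `|x| - `|y| | <= `|x - y| by exact: ler_dist_dist.
rewrite /tri; move: (`|x|) (`|y|) => a b; rewrite ler_norml => h; rewrite ler_norml; move: h.
by case: (leP (u - a) 0); case: (leP (u - b) 0); lra.
Qed.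

(** The second differences of an absolute value are nonnegative and telescope. *)
Lemma abs_second_differences (q a : R) N : 0 <= q ->
  symsum N (fun n => `| `|(n + 1)%:~R * q + a| + `|(n - 1)%:~R * q + a|
                       - 2 * `|n%:~R * q + a| |) <= 2 * q.
Proof.
move=> q0; pose A (n : int) := `|n%:~R * q + a|; pose D n := A n - A (n - 1).
have AD (m n : int) : `|A m - A n| <= `|m - n|%:~R * q.
  apply: (le_trans (ler_dist_dist _ _)).
  have -> : m%:~R * q + a - (n%:~R * q + a) = (m - n)%:~R * q by rewrite intrB; ring.
  by rewrite normrM intr_norm (ger0_norm q0).
have -> : symsum N (fun n => `| `|(n + 1)%:~R * q + a| + `|(n - 1)%:~R * q + a|
                       - 2 * `|n%:~R * q + a| |) = symsum N (fun n => D (n + 1) - D n).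
  apply: eq_bigr => j _; move: (j%:Z - N%:Z) => n; rewrite /D addrK ger0_norm.
    by rewrite /A; ring.
  have -> : `|n%:~R * q + a| = `|((n + 1)%:~R * q + a + ((n - 1)%:~R * q + a)) / 2|.
    by congr (`|_|); rewrite intrD intrB mulr1z; field.
  rewrite normrM (@ger0_norm _ 2^-1)// subr_ge0 mulrC mulfVK//.
  exact: ler_normD.
have -> : symsum N (fun n => D (n + 1) - D n) = D (N%:Z + 1) - D (- N%:Z).
  transitivity (symsum N (fun n => D (n + 1)) - symsum N D).
    by rewrite /symsum -sumrB.
  by rewrite symsum_shift; ring.
have h1 : `|D (N%:Z + 1)| <= 1 * q.
  by have := AD (N%:Z + 1) (N%:Z + 1 - 1); rewrite opprB addrCA subrr addr0 normr1.
have h2 : `|D (- N%:Z)| <= 1 * q.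
  by have := AD (- N%:Z) (- N%:Z - 1); rewrite opprB addrCA subrr addr0 normr1.
by move: h1 h2; rewrite !ler_norml; lra.
Qed.

(** A triangle is a combination of three absolute values. *)
Lemma tri_second_differences (u q : R) N : 0 <= u -> 0 <= q ->
  symsum N (fun n => `|2 * tri u (n%:~R * q) - tri u ((n + 1)%:~R * q)
                       - tri u ((n - 1)%:~R * q)|) <= 4 * q.
Proof.
move=> u0 q0.
pose E a (n : int) := `| `|(n + 1)%:~R * q + a| + `|(n - 1)%:~R * q + a|
                       - 2 * `|n%:~R * q + a| |.
apply: (@le_trans _ _ (symsum N (fun n => (E u n + E (- u) n) / 2 + E 0 n))).
  apply: ler_sum => j _; rewrite !tri_split//; move: (j%:Z - N%:Z) => n.
  rewrite /E !addr0.
  move: (`|n%:~R * q + u|) (`|n%:~R * q - u|) (`|n%:~R * q|) => x1 x2 x3.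
  move: (`|(n + 1)%:~R * q + u|) (`|(n + 1)%:~R * q - u|) (`|(n + 1)%:~R * q|) => y1 y2 y3.
  move: (`|(n - 1)%:~R * q + u|) (`|(n - 1)%:~R * q - u|) (`|(n - 1)%:~R * q|) => z1 z2 z3.
  have := ler_norm (y1 + z1 - 2 * x1); have := ler_norm (y2 + z2 - 2 * x2).
  have := ler_norm (y3 + z3 - 2 * x3); have := ler_norm (- (y1 + z1 - 2 * x1)).
  have := ler_norm (- (y2 + z2 - 2 * x2)); have := ler_norm (- (y3 + z3 - 2 * x3)).
  rewrite !normrN => *; rewrite ler_norml; lra.
have h a := abs_second_differences a N q0.
rewrite /symsum big_split /= -mulr_suml big_split /=.
have := h u; have := h (- u); have := h 0; rewrite /symsum -/(E _ _); lra.
Qed.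

End periodization.

Section trig_approximation.
Context {R : realType}.

(** This replaces the Fourier expansion: the error is as small as desired, while the
    bound on the coefficients is independent of it and of the degree. *)
Definition trig_approx (r : nat) := exists2 C : R, 0 <= C & forall u eps : R,
  0 < u <= 1 / 2 -> 0 < eps -> exists K0, forall K, (K0 <= K)%N ->
  exists c : int -> R, [/\ forall k, c (- k) = c k,
    forall k : int, `|k| <= K%:Z -> `|c k| <= C * omega u k%:~R ^+ r &
    forall x, `|perhat r u x - tpoly K c x| <= eps].

Lemma symsum_count N (z : R) : 0 < z ->
  symsum N (fun n : int => if `|n%:~R| < z then 1 else 0) <= 1 + 2 * z.
Proof.
move=> z0; pose F (n : int) : R := if `|n%:~R| < z then 1 else 0.
suff : symsum N F <= 1 + 2 * z /\ symsum N F <= 1 + 2 * N%:R by case.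
elim: N => [|N [IH1 IH2]]; first by rewrite symsum0 /F normr0 z0; lra.
rewrite !symsumS /F intrN normrN -[N.+1%:Z%:~R]/(N.+1%:R) ger0_norm// -[N.+1%:R]natr1.
case: ifP => h; split; lra.
Qed.

Lemma symsum_norm_le N (F : int -> R) : `|symsum N F| <= symsum N (fun n => `|F n|).
Proof. exact: ler_norm_sum. Qed.

(** At most [1 + 2 * u * Q] of the [Q] samples are nonzero, and they are at most [u]. *)
Lemma dft_tri_small K (u : R) k : 0 < u -> 1 <= u * K.*2.+1%:R ->
  `|dft K (fun n => tri u (n%:~R / K.*2.+1%:R)) k| <= 3 * u ^+ 2.
Proof.
move=> u0 uQ; set Q := K.*2.+1%:R in uQ *; have Q0 : 0 < Q by rewrite ltr0n.
rewrite /dft -/Q normrM gtr0_norm ?invr_gt0// ler_pdivrMl//.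
apply: (le_trans (symsum_norm_le _ _)).
apply: (@le_trans _ _ (symsum K (fun n : int => u * (if `|n%:~R| < u * Q then 1 else 0)))).
  apply: ler_sum => j _; move: (j%:Z - K%:Z) => n.
  rewrite normrM -[leRHS]mulr1 ler_pM ?cos_max//.
  rewrite ger0_norm ?le_max ?lexx// /tri normrM normfV (gtr0_norm Q0).
  case: ltP => h; rewrite ge_max ?mulr1 ?mulr0 ?lexx ?(ltW u0)/=.
    by rewrite lerBlDr lerDl divr_ge0// ltW.
  by rewrite subr_le0 ler_pdivlMr.
rewrite /symsum -mulr_sumr; have := @symsum_count K (u * Q) (mulr_gt0 u0 Q0).
rewrite /symsum => h; apply: (le_trans (ler_wpM2l (ltW u0) h)).
by rewrite expr2; nra.
Qed.

(** Summation by parts twice: taking second differences of the samples multiplies the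
    coefficient by [2 - 2 cos th], which is at least [(k / Q)^2], and the sum of the
    moduli of the second differences is at most [4 / Q]. *)
Lemma dft_tri_decay K (u : R) (k : int) : 0 < u <= 1 / 2 -> `|k| <= K%:Z -> k != 0 ->
  `|dft K (fun n => tri u (n%:~R / K.*2.+1%:R)) k| <= 4 / `|k%:~R| ^+ 2.
Proof.
move=> /andP[u0 u1] kK k0; set Q := K.*2.+1%:R; have Q0 : 0 < Q :> R by rewrite ltr0n.
pose T (n : int) := tri u (n%:~R / Q); rewrite -/T.
pose th := 2 * pi * k%:~R / Q.
have TK (n : int) : K%:Z < `|n| -> T n = 0.
  move=> Kn; apply/max_l; rewrite normrM normfV (gtr0_norm Q0) subr_le0 ler_pdivlMr//.
  have : K.+1%:R <= `|n%:~R : R|.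
    by rewrite -intr_norm -[K.+1%:R]/(K.+1%:Z%:~R) ler_int; lia.
  rewrite /Q -[K.*2.+1%:R]natr1 -muln2 natrM -[K.+1%:R]natr1.
  have : u * (K%:R * 2 + 1) <= 1 / 2 * (K%:R * 2 + 1).
    by rewrite ler_wpM2r// addr_ge0// mulr_ge0.
  lra.
pose W := symsum K.+1 (fun n => T n * cos (n%:~R * th)).
have dftE : dft K T k = Q^-1 * W.
  rewrite /dft -/Q /W symsumS !TK; [|lia|lia].
  rewrite !mul0r add0r addr0; congr (_ * _); apply: eq_bigr => j _.
  by rewrite /th intrM; congr (_ * cos _); ring.
have WE : (2 - 2 * cos th) * W =
    symsum K.+1 (fun n => (2 * T n - T (n + 1) - T (n - 1)) * cos (n%:~R * th)).
  pose G n := T n * cos ((n - 1)%:~R * th).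
  pose H n := T (n - 1) * cos (n%:~R * th).
  have hG : symsum K.+1 (fun n => G (n + 1)) = symsum K.+1 G.
    rewrite symsum_shift /G !TK; [|lia|lia].
    by rewrite !mul0r addr0 subr0.
  have hH : symsum K.+1 (fun n => H (n + 1)) = symsum K.+1 H.
    rewrite symsum_shift /H !TK; [|lia|lia].
    by rewrite !mul0r addr0 subr0.
  transitivity (2 * W - symsum K.+1 G - symsum K.+1 (fun n => H (n + 1))).
    rewrite mulrBl /W /symsum !mulr_sumr -!sumrB; apply: eq_bigr => j _.
    move: (j%:Z - K.+1%:Z) => n; rewrite /G /H addrK !intrD intrN !mulr1z.
    by rewrite !mulrDl mulN1r !mul1r cosB cosD; ring.
  rewrite hH -hG /W /symsum mulr_sumr -!sumrB; apply: eq_bigr => j _.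
  move: (j%:Z - K.+1%:Z) => n; rewrite /G /H addrK; ring.
have WB : `|(2 - 2 * cos th) * W| <= 4 / Q.
  have iQ : 0 <= Q^-1 by rewrite invr_ge0 ltW.
  rewrite WE; apply: le_trans (tri_second_differences K.+1 (ltW u0) iQ).
  apply: (le_trans (symsum_norm_le _ _)); apply: ler_sum => j _.
  by rewrite normrM -[leRHS]mulr1 ler_pM// cos_max.
have kp : 0 < `|k%:~R : R| by rewrite normr_gt0 intr_eq0.
have sB : (`|k%:~R| / Q) ^+ 2 <= 2 - 2 * cos th.
  have -> : 2 - 2 * cos th = `|2 * sin (pi * (k%:~R / Q))| ^+ 2.
    rewrite real_normK ?num_real//.
    have -> : th = (pi * (k%:~R / Q)) *+ 2 by rewrite mulr2n /th; ring.
    by rewrite cos_mulr2n exprMn sin2cos2 mulr2n; ring.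
  have -> : `|k%:~R| / Q = `|k%:~R / Q| by rewrite normrM normfV (gtr0_norm Q0).
  rewrite lerXn2r ?nnegrE// norm_sin_pi_ge// normrM normfV (gtr0_norm Q0).
  rewrite ler_pdivrMr//.
  have : `|k%:~R : R| <= K%:R by rewrite -intr_norm -[K%:R]/(K%:Z%:~R) ler_int.
  by rewrite /Q -[K.*2.+1%:R]natr1 -muln2 natrM; lra.
rewrite dftE normrM gtr0_norm ?invr_gt0// ler_pdivlMr ?exprn_gt0//.
have W0 := normr_ge0 W.
have : (`|k%:~R| / Q) ^+ 2 * `|W| <= 4 / Q.
  apply: (le_trans _ WB); rewrite normrM ler_wpM2r// (le_trans sB)//.
  exact: ler_norm.
rewrite expr_div_n mulrAC ler_pdivrMr ?exprn_gt0//.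
have -> : 4 / Q * Q ^+ 2 = 4 * Q by rewrite expr2; field; rewrite gt_eqF.
move=> h; rewrite -(ler_pM2r Q0) (le_trans _ h)// le_eqVlt; apply/orP; left; apply/eqP.
by field; rewrite gt_eqF.
Qed.

Lemma tpoly_lipschitz K (c : int -> R) :
  lipschitz_with (symsum K (fun k => `|c k| * `|2 * pi * k%:~R|)) (tpoly K c).
Proof.
move=> x y; rewrite /tpoly /symsum -sumrB mulr_suml.
apply: (le_trans (ler_norm_sum _ _ _)); apply: ler_sum => j _.
rewrite -mulrBr normrM -(mulrA `|c _|) ler_wpM2l// -normrM mulrBr.
exact: dist_cos_le.
Qed.

Lemma tpoly_continuous K (c : int -> R) : continuous (tpoly K c).
Proof. exact: lipschitz_with_continuous (tpoly_lipschitz K c). Qed.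

(** The left-hand side is a Lipschitz constant of [tpoly K c]. It grows more slowly
    than [K], so that a grid of mesh [1 / K] controls the polynomial. The square root
    comes from [1 / n <= 2 * (sqrt n - sqrt (n - 1))]. *)
Lemma symsum_decay K (c : int -> R) : (forall k : int, `|k| <= K%:Z -> k != 0 ->
    `|c k| <= 4 / `|k%:~R| ^+ 2) ->
  symsum K (fun k => `|c k| * `|2 * pi * k%:~R|) <= 32 * pi * Num.sqrt K%:R.
Proof.
move=> hc; have p0 : 0 < pi :> R := pi_gt0 R.
suff H N : (N <= K)%N -> symsum N (fun k => `|c k| * `|2 * pi * k%:~R|)
    <= 32 * pi * Num.sqrt N%:R by exact: H.
elim: N => [_|N IH NK]; first by rewrite symsum0 mulr0 normr0 mulr0 sqrtr0 mulr0.
have Np : 0 < N.+1%:R :> R by [].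
have bd (k : int) : `|k%:~R| = N.+1%:R :> R ->
    `|c k| * `|2 * pi * k%:~R| <= 8 * pi / N.+1%:R.
  move=> kN; have kN2 : `|k| = N.+1%:Z.
    by apply/eqP; rewrite -(eqr_int R) intr_norm kN.
  have := hc k; rewrite kN2 kN => h.
  have h1 : `|c k| <= 4 / N.+1%:R ^+ 2.
    by apply: h; [rewrite lez_nat|rewrite -normr_eq0 kN2].
  rewrite normrM kN (@ger0_norm _ (2 * pi)) ?mulr_ge0 ?(ltW p0)//.
  have h2 : 0 <= 2 * pi * N.+1%:R :> R by rewrite mulr_ge0// mulr_ge0// ltW.
  apply: (le_trans (ler_wpM2r h2 h1)).
  by rewrite le_eqVlt; apply/orP; left; apply/eqP; field; rewrite gt_eqF.
rewrite symsumS.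
have b1 := bd (- N.+1%:Z); have b2 := bd N.+1%:Z.
have nn : `|N.+1%:Z%:~R| = N.+1%:R :> R by rewrite -intr_norm ger0_norm.
have nn' : `|(- N.+1%:Z)%:~R| = N.+1%:R :> R by rewrite -intr_norm normrN ger0_norm.
have {}b1 := b1 nn'; have {}b2 := b2 nn; have {}IH := IH (ltnW NK).
set s := Num.sqrt N%:R in IH *; set t := Num.sqrt N.+1%:R.
have s0 : 0 <= s by exact: sqrtr_ge0.
have t1 : 1 <= t by rewrite -[leLHS]sqrtr1 ler_sqrt// ler1n.
have t2 : t ^+ 2 = N.+1%:R by rewrite sqr_sqrtr.
have s2 : s ^+ 2 = N%:R by rewrite sqr_sqrtr.
have st : s <= t by rewrite ler_sqrt// ler_nat.
have ts : N.+1%:R^-1 <= 2 * (t - s).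
  rewrite -t2 expr2; apply: (@le_trans _ _ t^-1).
    by rewrite invfM -[leRHS]mul1r ler_wpM2r ?invr_ge0 ?invf_le1//; lra.
  rewrite -[leLHS]mul1r ler_pdivrMr; last lra.
  have : t ^+ 2 - s ^+ 2 = 1 by rewrite t2 s2 -natr1; ring.
  nra.
have : 16 * pi / N.+1%:R <= 16 * pi * (2 * (t - s)) by rewrite ler_wpM2l// mulr_ge0// ltW.
have -> : 16 * pi * (2 * (t - s)) = 32 * pi * t - 32 * pi * s by ring.
have -> : 16 * pi / N.+1%:R = 8 * pi / N.+1%:R + 8 * pi / N.+1%:R :> R by field; rewrite gt_eqF.
move: (8 * pi / N.+1%:R) b1 b2 IH => w b1 b2 IH h.
have -> : 32 * pi * t = w + (32 * pi * s) + w + (32 * pi * t - 32 * pi * s - (w + w)) by ring.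
rewrite -[leLHS]addr0; apply: lerD; last by rewrite subr_ge0.
by apply: lerD; first exact: lerD.
Qed.

Lemma perhat2_tri (u x : R) : 0 < u <= 1 / 2 -> `|x| <= 1 / 2 -> perhat 2 u x = tri u x.
Proof.
move=> /andP[u0 u1] x1; rewrite (@perhat_window _ 0 u x 0)//; last lra.
by rewrite symsum0 add0r hat2E.
Qed.

Lemma tri_even (u x : R) : tri u (- x) = tri u x.
Proof. by rewrite /tri normrN. Qed.

Lemma omega_sqr_ge (u y : R) (C w : R) : 0 < u -> 0 <= C ->
  w <= C * u ^+ 2 -> (y != 0 -> w <= C / `|y| ^+ 2) -> w <= C * omega u y ^+ 2.
Proof.
move=> u0 C0 h1 h2; rewrite /omega; case: (leP 1 (u * `|y|)) => h; last first.
  by rewrite divr1.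
have y0 : y != 0 by apply: contraTneq h => ->; rewrite normr0 mulr0 ler10.
have -> : u / (u * `|y|) = `|y|^-1.
  by field; rewrite normr_eq0 y0 gt_eqF.
by rewrite exprVn h2.
Qed.

Lemma int_norm_le (K : nat) (n : int) : - K%:Z < n + 1 -> n < K%:Z + 1 -> `|n| <= K%:Z.
Proof. by lia. Qed.

(** Interpolation on a fine grid: the triangle and its interpolant agree on the grid, and
    neither moves much between its points. *)
Lemma trig_approx2 : trig_approx 2.
Proof.
exists 4 => // u eps ul eps0; have /andP[u0 u1] := ul.
pose Z : R := (1 + 32 * pi) / eps.
have Z0 : 0 < Z by rewrite divr_gt0// addr_gt0// mulr_gt0// pi_gt0.
exists (maxn (Num.truncn (Z ^+ 2)).+1 (Num.truncn u^-1).+1) => K.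
rewrite geq_max => /andP[K1 K2].
have KZ : Z ^+ 2 <= K%:R.
  by rewrite (le_trans (ltW (truncnS_gt _)))// ler_nat.
have Ku : u^-1 <= K%:R.
  by rewrite (le_trans (ltW (truncnS_gt _)))// ler_nat.
have K0 : (0 < K)%N by case: (K) K1.
pose Q : R := K.*2.+1%:R.
have QE : Q = K%:R * 2 + 1 by rewrite /Q -[K.*2.+1%:R]natr1 -muln2 natrM.
have Kr : 1 <= K%:R :> R by rewrite ler1n.
have Q0 : 0 < Q by rewrite ltr0n.
have uQ : 1 <= u * Q.
  by rewrite -ler_pdivrMl// mulr1 (le_trans Ku)// QE; lra.
pose T (n : int) := tri u (n%:~R / Q).
have Te n : T (- n) = T n by rewrite /T intrN mulNr tri_even.
have dec (k : int) : `|k| <= K%:Z -> k != 0 -> `|dft K T k| <= 4 / `|k%:~R| ^+ 2.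
  by move=> kK k0; exact: dft_tri_decay.
exists (dft K T); split; first by move=> k; exact: dft_even.
  move=> k kK; apply: omega_sqr_ge => //.
    have := @dft_tri_small K u k u0 uQ; rewrite -/T => /le_trans; apply.
    by rewrite ler_wpM2r ?sqr_ge0//; lra.
  by rewrite intr_eq0; exact: dec.
move=> x; pose m := Num.floor (x + 1 / 2); pose x' := x - m%:~R.
have /andP[m1 m2] := floor_bounds (x + 1 / 2).
have -> : x = x' + m%:~R by rewrite subrK.
rewrite perhat_periodic tpoly_periodic.
have xb : - (1 / 2) <= x' < 1 / 2 by rewrite /x' /m; lra.
have x'1 : `|x'| <= 1 / 2 by rewrite ler_norml; lra.
rewrite perhat2_tri//.
pose n := Num.floor (x' * Q + 1 / 2).
have /andP[n1 n2] := floor_bounds (x' * Q + 1 / 2).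
have xQ1 : - (1 / 2) * Q <= x' * Q by rewrite ler_pM2r//; lra.
have xQ2 : x' * Q < 1 / 2 * Q by rewrite ltr_pM2r//; lra.
have nK : `|n| <= K%:Z.
  have h1 : (- K%:Z)%:~R < n%:~R + 1 :> R.
    by rewrite intrN -[K%:Z%:~R]/(K%:R) /n; lra.
  have h2 : n%:~R < K%:Z%:~R + 1 :> R.
    by rewrite -[K%:Z%:~R]/(K%:R) /n; lra.
  have h1' : - K%:Z < n + 1 by rewrite -(ltr_int R) [X in _ < X]intrD.
  have h2' : n < K%:Z + 1 by rewrite -(ltr_int R) [X in _ < X]intrD.
  exact: int_norm_le.
have dxn : `|x' - n%:~R / Q| <= Q^-1.
  have -> : x' - n%:~R / Q = (x' * Q - n%:~R) / Q by field; rewrite gt_eqF.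
  rewrite normrM (@ger0_norm _ Q^-1) ?invr_ge0 ?(ltW Q0)//.
  rewrite -[leRHS]mul1r ler_wpM2r ?invr_ge0 ?(ltW Q0)// ler_norml /n; lra.
have e1 : `|tri u x' - T n| <= Q^-1 by apply: (le_trans (tri_lipschitz _ _ _)).
have e2 : `|T n - tpoly K (dft K T) x'| <= 32 * pi * Num.sqrt K%:R * Q^-1.
  rewrite -(tpoly_interpolates Te nK) -/Q.
  apply: (le_trans (tpoly_lipschitz _ _ _ _)); apply: ler_pM => //.
  - by apply: sumr_ge0 => j _; rewrite mulr_ge0.
  - exact: symsum_decay.
  - by rewrite distrC.
have -> : tri u x' - tpoly K (dft K T) x' = (tri u x' - T n) + (T n - tpoly K (dft K T) x').
  by rewrite addrA subrK.
apply: (le_trans (ler_normD _ _)); apply: (le_trans (lerD e1 e2)).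
have sK : 1 <= Num.sqrt K%:R :> R by rewrite -[leLHS]sqrtr1 ler_sqrt.
have sK2 : Num.sqrt K%:R ^+ 2 = K%:R :> R by rewrite sqr_sqrtr.
have sZ : Z <= Num.sqrt K%:R.
  by rewrite -(ler_pXn2r (ltn0Sn 1)) ?nnegrE ?sK2 ?(ltW Z0)//; lra.
rewrite -[X in X + _]mul1r -mulrDl ler_pdivrMr//.
move: sZ; rewrite /Z ler_pdivrMr// => sZ.
have p0 : 0 < pi :> R := pi_gt0 R.
set s := Num.sqrt K%:R in sK sK2 sZ *.
have h3 : (1 + 32 * pi) * s <= s * eps * s by rewrite ler_wpM2r//; lra.
have h4 : s * eps * s <= eps * Q.
  by rewrite mulrC mulrA -expr2 sK2 mulrC ler_wpM2l ?(ltW eps0)// QE; lra.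
apply: le_trans h4; apply: le_trans h3; nra.
Qed.

End trig_approximation.

Section trig_approximation_step.
Context {R : realType}.

Lemma perhat_continuous r (u : R) : trig_approx (R := R) r -> 0 < u <= 1 / 2 ->
  continuous (perhat r u).
Proof.
move=> [C C0 hC] u1 x; apply/cvgrPdist_le => e e0.
have e3 : 0 < e / 3 by rewrite divr_gt0.
have [K /(_ _ (leqnn K))[c [_ _ hc]]] := hC u (e / 3) u1 e3.
have ct := @tpoly_continuous R K c x.
near=> y.
have h : `|tpoly K c x - tpoly K c y| <= e / 3.
  by near: y; move/cvgrPdist_le : ct; apply.
have -> : perhat r u x - perhat r u y = (perhat r u x - tpoly K c x) +
    (tpoly K c x - tpoly K c y) - (perhat r u y - tpoly K c y) by ring.
apply: (le_trans (ler_normB _ _)).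
apply: (@le_trans _ _ (e / 3 + e / 3 + e / 3)); last lra.
apply: lerD; last exact: hc.
by apply: (le_trans (ler_normD _ _)); exact: lerD.
Unshelve. all: by end_near. Qed.

Lemma perhatS r (u x : R) : 0 < u <= 1 / 2 ->
  perhat r.+3 u x = iint (fun y => perhat r.+2 u (x - y)) (- (u / 2)) (u / 2).
Proof.
move=> /andP[u0 u1]; pose N := Num.truncn (`|x| + 1 + r.+3%:R * u).
have hN : `|x| + 1 + r.+3%:R * u <= N.+1%:R by rewrite ltW// truncnS_gt.
have ru : 0 <= r.+2%:R * u by rewrite mulr_ge0// ltW.
have rS : r.+3%:R * u = r.+2%:R * u + u by rewrite -[r.+3%:R]natr1 mulrDl mul1r.
rewrite (@perhat_window _ r.+1 u x N)//; last by rewrite rS in hN *; lra.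
have ch (m : int) : continuous (fun y => hat r.+2 u (m%:~R + (x - y))).
  move=> y; apply: (@continuous_comp _ _ _ (fun y => m%:~R + (x - y)) (hat r.+2 u)).
    by apply: cvgD; [exact: cvg_cst|apply: cvgB; [exact: cvg_cst|exact: cvg_id]].
  exact: hat_continuous.
transitivity (iint (fun y => symsum N (fun m => hat r.+2 u (m%:~R + (x - y))))
    (- (u / 2)) (u / 2)).
  rewrite /symsum iint_sum//; last lra.
  by apply: eq_bigr => j _; rewrite hatS; apply: eq_Rintegral => y _; rewrite addrA.
apply: eq_Rintegral => y; rewrite inE /= in_itv /= => /andP[y1 y2].
rewrite (@perhat_window _ r u (x - y) N)//.
have : `|y| <= u / 2 by rewrite ler_norml y1 ltW.
have := ler_normB x y; rewrite rS in hN; lra.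
Qed.

(** Convolution with the indicator of a centred interval of length [u] multiplies
    the Fourier coefficient of frequency [k] by this factor. *)
Definition box_multiplier (u : R) (k : int) : R :=
  if k == 0 then u else sin (pi * k%:~R * u) / (pi * k%:~R).

Lemma iint_cos_box (u x : R) (k : int) : 0 <= u ->
  iint (fun y => cos (2 * pi * k%:~R * (x - y))) (- (u / 2)) (u / 2) =
  box_multiplier u k * cos (2 * pi * k%:~R * x).
Proof.
move=> u0; rewrite /box_multiplier; case: eqP => [->|/eqP k0].
  have -> : (fun y => cos (2 * pi * 0%:~R * (x - y))) = (fun=> 1).
    by apply/funext => y; rewrite mulr0 mul0r cos0.
  by rewrite iint_cst ?mulr0 ?mul0r ?cos0; lra.
have kr0 : k%:~R != 0 :> R by rewrite intr_eq0.
have p0 : pi != 0 :> R by rewrite gt_eqF// pi_gt0.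
have -> : (fun y => cos (2 * pi * k%:~R * (x - y))) =
    (fun y => cos (2 * pi * k%:~R * x + y * - (2 * pi * k%:~R))).
  by apply/funext => y; congr cos; ring.
rewrite iint_cos; [|lra|by rewrite oppr_eq0 !mulf_neq0].
have -> : u / 2 * - (2 * pi * k%:~R) = - (pi * k%:~R * u) by field.
have -> : - (u / 2) * - (2 * pi * k%:~R) = pi * k%:~R * u by field.
rewrite sinB sinD; move: (pi : R) p0 => p p0.
by field; rewrite kr0 p0.
Qed.

Lemma box_multiplier_le (u : R) k : 0 < u -> `|box_multiplier u k| <= omega u k%:~R.
Proof.
move=> u0; rewrite /box_multiplier /omega; case: eqP => [->|/eqP k0].
  by rewrite normr0 mulr0 max_l// divr1 gtr0_norm.
have kr0 : 0 < `|k%:~R| :> R by rewrite normr_gt0 intr_eq0.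
have p1 : 1 <= pi :> R by have := pi_ge2 R; lra.
have p0 : 0 < pi :> R := pi_gt0 R.
rewrite normrM normfV normrM (gtr0_norm p0) ler_pdivrMr ?mulr_gt0//.
have s1 : `|sin (pi * k%:~R * u)| <= 1 by exact: sin_max.
have s2 : `|sin (pi * k%:~R * u)| <= pi * `|k%:~R| * u.
  have := @mean_value_le R sin cos 1 0 (pi * k%:~R * u) _ (@cos_max R).
  by rewrite sin0 !subr0 mul1r !normrM (gtr0_norm p0) (gtr0_norm u0); apply.
case: (leP 1 (u * `|k%:~R|)) => h; last first.
  by rewrite divr1 (mulrC u).
have -> : u / (u * `|k%:~R|) * (pi * `|k%:~R|) = pi by field; rewrite !gt_eqF.
exact: le_trans s1 p1.
Qed.

(** The multiplier [box_multiplier u k] supplies one more factor [omega u k], and averaging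
    over an interval of length at most 1 does not increase the uniform error. *)
Lemma trig_approxS r : trig_approx (R := R) r.+2 -> trig_approx (R := R) r.+3.
Proof.
move=> hr; have [C C0 hC] := hr; exists C => // u eps u1 eps0.
have [K0 hK] := hC u eps u1 eps0; exists K0 => K /hK[c [c1 c2 c3]].
have /andP[u0 u2] := u1.
exists (fun k => c k * box_multiplier u k); split.
- move=> k; rewrite c1 /box_multiplier oppr_eq0; case: eqP => // _; congr (_ * _).
  by rewrite intrN !mulrN mulNr sinN invrN mulrNN.
- move=> k kK; rewrite normrM exprSr mulrA ler_pM ?c2//.
  exact: box_multiplier_le.
- move=> x; rewrite perhatS//.
  have shc (f : R -> R) : continuous f -> continuous (fun y => f (x - y)).
    move=> cf y; apply: (@continuous_comp _ _ _ (fun y => x - y) f); last exact: cf.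
    by apply: cvgB; [exact: cvg_cst|exact: cvg_id].
  have -> : tpoly K (fun k => c k * box_multiplier u k) x =
      iint (fun y => tpoly K c (x - y)) (- (u / 2)) (u / 2).
    rewrite /tpoly /symsum iint_sum; [|lra|]; last first.
      move=> j y; apply: cvgM; first exact: cvg_cst.
      apply: (@continuous_comp _ _ _ (fun y => 2 * pi * (j%:Z - K%:Z)%:~R * (x - y)) cos).
        by apply: cvgM; [exact: cvg_cst|apply: cvgB; [exact: cvg_cst|exact: cvg_id]].
      exact: continuous_cos.
    apply: eq_bigr => j _; rewrite iintZ ?iint_cos_box ?mulrA//; first exact: ltW.
    move=> y; apply: (@continuous_comp _ _ _ (fun y => 2 * pi * (j%:Z - K%:Z)%:~R * (x - y)) cos).
      by apply: cvgM; [exact: cvg_cst|apply: cvgB; [exact: cvg_cst|exact: cvg_id]].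
    exact: continuous_cos.
  apply: (le_trans (iint_dist_le (e := eps) _ (shc _ (perhat_continuous hr u1))
    (shc _ (@tpoly_continuous R K c)) (fun y => c3 (x - y)))); first lra.
  rewrite -[leRHS]mulr1 ler_wpM2l ?(ltW eps0)//; lra.
Qed.

Lemma trig_approxP r : trig_approx (R := R) r.+2.
Proof. by elim: r => [|r IH]; [exact: trig_approx2|exact: trig_approxS]. Qed.

Lemma iint_tpoly K (c : int -> R) (z : R) : iint (fun x => tpoly K c (x - z)) 0 1 = c 0.
Proof.
have cc (k : int) : continuous (fun x => cos (2 * pi * k%:~R * (x - z))).
  move=> y; apply: (@continuous_comp _ _ _ (fun x => 2 * pi * k%:~R * (x - z)) cos).
    by apply: cvgM; [exact: cvg_cst|apply: cvgB; [exact: cvg_id|exact: cvg_cst]].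
  exact: continuous_cos.
rewrite /tpoly /symsum iint_sum//; last first.
  by move=> j y; apply: cvgM; [exact: cvg_cst|exact: cc].
rewrite -[RHS](@symsum_pick R K c 0)// /symsum; apply: eq_bigr => j _.
rewrite iintZ//; move: (j%:Z - K%:Z) => k; case: eqP => [->|/eqP k0].
  have -> : (fun x => cos (2 * pi * 0%:~R * (x - z))) = (fun=> 1).
    by apply/funext => y; rewrite mulr0 mul0r cos0.
  by rewrite iint_cst// subr0 !mulr1.
have kr0 : k%:~R != 0 :> R by rewrite intr_eq0.
have p0 : pi != 0 :> R by rewrite gt_eqF// pi_gt0.
have -> : (fun x => cos (2 * pi * k%:~R * (x - z))) =
    (fun x => cos (- (2 * pi * k%:~R * z) + x * (2 * pi * k%:~R))).
  by apply/funext => y; congr cos; ring.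
rewrite iint_cos ?mulf_neq0// mul0r addr0 mul1r.
rewrite -!cosBpihalf addrAC cos_shift_int.
by rewrite subrr mul0r mulr0.
Qed.

End trig_approximation_step.

(** * Reduction of the error to products of one-variable functions *)

Section cube_integrals.
Context {R : realType}.
Local Notation RT := (measurableTypeR R).
Local Notation mu := (@lebesgue_measure R).

Lemma measurable_tuple_prod n (h : 'I_n -> RT -> R) :
  (forall j, measurable_fun setT (h j)) ->
  measurable_fun setT (fun t : n.-tuple RT => \prod_j h j (tnth t j)).
Proof.
move=> mh; apply: (@measurable_prod _ _ _ _ _ _ (fun j t => h j (tnth t j))) => j _.
exact: (measurableT_comp (mh j) (@measurable_tnth _ RT n j)).
Qed.

(** One coordinate at a time, by Tonelli's theorem. *)
Lemma tuple_integral_prod n (h : 'I_n -> RT -> R) (v : 'I_n -> R) :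
  (forall j, measurable_fun setT (h j)) -> (forall j x, 0 <= h j x) ->
  (forall j, (\int[mu]_x (h j x)%:E = (v j)%:E)%E) ->
  (\int[lebesgue_tuple n]_t (\prod_j h j (tnth t j))%:E = (\prod_j v j)%:E)%E.
Proof.
elim: n h v => [|n IH] h v mh h0 hv.
  rewrite big_ord0 integral_dirac//.
    by rewrite diracT mul1e big_ord0.
  by apply/measurable_EFinP; exact: measurable_tuple_prod.
have mT : measurable_fun setT (fun t : n.+1.-tuple RT => (\prod_j h j (tnth t j))%:E).
  by apply/measurable_EFinP; exact: measurable_tuple_prod.
transitivity (\int[(mu \x lebesgue_tuple n)%E]_p
    (h ord0 p.1 * \prod_j h (lift ord0 j) (tnth p.2 j))%:E)%E.
  transitivity (\int[pushforward (mu \x lebesgue_tuple n)%E (@tcons R n)]_t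
    (\prod_j h j (tnth t j))%:E)%E; first by [].
  rewrite (@ge0_integral_pushforward _ _ _ _ _ _ (@measurable_tcons R n)) //; last first.
    by move=> t _; rewrite lee_fin; apply: prodr_ge0.
  rewrite preimage_setT; apply: eq_integral => p _ /=.
  rewrite big_ord_recl /tcons tnth0; congr (_ * _)%:E.
  by apply: eq_bigr => j _; rewrite tnthS.
rewrite fubini_tonelli1/=; last 2 first.
- apply/measurable_EFinP; apply: measurable_funM.
    exact: (measurableT_comp (mh ord0) measurable_fst).
  apply: (measurableT_comp (f := fun t : n.-tuple RT => \prod_j h (lift ord0 j) (tnth t j))).
    exact: (@measurable_tuple_prod n (fun j => h (lift ord0 j)) (fun j => mh _)).
  exact: measurable_snd.
- by move=> p; rewrite lee_fin; apply: mulr_ge0 => //; apply: prodr_ge0.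
have IH' := IH (fun j => h (lift ord0 j)) (fun j => v (lift ord0 j))
  (fun j => mh _) (fun j => h0 _) (fun j => hv _).
transitivity (\int[mu]_x ((\prod_j v (lift ord0 j))%:E * (h ord0 x)%:E))%E.
  apply: eq_integral => x _; rewrite /fubini_F /=.
  under eq_integral do rewrite EFinM.
  rewrite ge0_integralZl//; last 3 first.
  - apply/measurable_EFinP.
    exact: (@measurable_tuple_prod n (fun j => h (lift ord0 j)) (fun j => mh _)).
  - by move=> t _; rewrite lee_fin; apply: prodr_ge0.
  - by rewrite lee_fin.
  by rewrite IH' muleC.
have v0 j : 0 <= v j by rewrite -lee_fin -hv integral_ge0// => x _; rewrite lee_fin.
rewrite ge0_integralZl//; last 3 first.
- exact/measurable_EFinP.
- by move=> x _; rewrite lee_fin.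
- by rewrite lee_fin prodr_ge0.
by rewrite hv -EFinM mulrC big_ord_recl.
Qed.

Lemma cube_integral_prod d (g : 'I_d -> R -> R) : (forall j, continuous (g j)) ->
  (forall j x, 0 <= g j x) ->
  cube_integral (fun x : 'cV[R]_d => \prod_j g j (x j 0)) = \prod_j iint (g j) 0 1.
Proof.
move=> cg g0; rewrite /cube_integral.
pose h j : RT -> R := g j \_ `[0, 1[%classic.
rewrite Rintegral_mkcond.
have -> : (fun t : d.-tuple RT => \prod_j g j ((\col_j tnth t j) j 0))
    \_ [set t : d.-tuple RT | forall j, 0 <= tnth t j < 1] =
    (fun t => \prod_j h j (tnth t j)).
  apply/funext => t; rewrite patchE; case: ifPn.
    rewrite inE /= => ht; apply: eq_bigr => j _.
    by rewrite mxE /h patchE mem_set//= in_itv /=; exact: ht.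
  move=> /negP nt; have [j hj] : exists j, ~ (0 <= tnth t j < 1).
    by apply/existsNP => ht; apply: nt; rewrite inE.
  by rewrite (bigD1 j)//= /h patchE memNset ?mul0r//= in_itv.
rewrite /Rintegral (@tuple_integral_prod d h (fun j => iint (g j) 0 1))//.
- move=> j; apply/(measurable_restrictT _ _).1 => //.
  apply: measurable_funTS; exact: continuous_measurable_fun.
- by move=> j x; rewrite /h patchE; case: ifP.
- move=> j; rewrite /iint /Rintegral fineK.
    rewrite [RHS]integral_mkcond; apply: eq_integral => x _.
    by rewrite /h !patchE; case: ifP.
  exact: integrable_fin_num (continuous_integrable_co _ _ (cg j)).
Qed.

End cube_integrals.

Section periodized_products.
Context {R : realType}.

Lemma hat_ge0 r (u x : R) : 0 <= hat r.+1 u x.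
Proof.
elim: r x => [|r IH] x; first by rewrite /hat /= /hat1 indicE.
by rewrite hatS; apply: Rintegral_ge0 => y _; exact: IH.
Qed.

Lemma perhat_ge0 r (u x : R) : 0 <= perhat r.+1 u x.
Proof. by apply: fsumr_ge0 => m _; exact: hat_ge0. Qed.

(** Distributivity, the sums over [Z] being finite. *)
Lemma hat_per_prod d r (x z u : 'cV[R]_d) : (forall j, 0 < u j 0) ->
  hat_per r.+2 x z u = \prod_j perhat r.+2 (u j 0) (x j 0 - z j 0).
Proof.
move=> u0.
pose bd j := `|x j 0 - z j 0| + r.+2%:R * u j 0 / 2.
pose N := \max_(j < d) Num.truncn (bd j).
have hN j : bd j <= N.+1%:R.
  apply: (le_trans (ltW (truncnS_gt _))); rewrite ler_nat ltnS.
  exact: (leq_bigmax j).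
rewrite (eq_bigr _ (fun j _ => perhat_window (u0 j) (hN j))).
rewrite /symsum bigA_distr_bigA /=.
pose s := [seq window (const_mx (- N%:Z)) g | g <- enum {ffun 'I_d -> 'I_N.*2.+1}].
rewrite /hat_per (@fsbigE _ _ _ _ _ s).
- rewrite (eq_bigl xpredT) => [|n]; last by rewrite mem_set.
  rewrite big_map big_enum /=; apply: eq_bigr => g _; apply: eq_bigr => j _.
  rewrite !mxE; congr hat; rewrite addrA; congr (_ + _ - _).
  by rewrite addrC.
- by rewrite map_inj_uniq ?enum_uniq//; exact: window_inj.
- by [].
move=> n _ ns; apply/eqP; apply: contraNT ns => hn.
have nj j : `|n j 0| <= N%:Z.
  rewrite leNgt; apply: contra hn => hj; rewrite /hatd (bigD1 j)//= hat_support ?mul0r//.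
  have : N.+1%:R <= `|(n j 0)%:~R : R|.
    by rewrite -intr_norm -[N.+1%:R]/(N.+1%:Z%:~R) ler_int.
  have := hN j; rewrite /bd mxE [int_vec n j 0]mxE -addrA.
  have := lerB_normD ((n j 0)%:~R : R) (x j 0 - z j 0); lra.
apply/mapP.
have hlt j : (absz (n j 0 + N%:Z)%R < N.*2.+1)%N by have := nj j; lia.
exists [ffun j => Ordinal (hlt j)]; first by rewrite mem_enum.
apply/colP => j; rewrite !mxE ffunE /= gez0_abs; first by rewrite addrCA addNr addr0.
by have := nj j; rewrite ler_norml => /andP[h _]; rewrite -lerBlDr sub0r.
Qed.

Import complex.
Local Notation C := (complex R).

Let cis (t : R) : C := (cos t +i* sin t)%C.

Let cisD s t : cis (s + t) = cis s * cis t.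
Proof.
by rewrite /cis cosD sinD; apply/eqP; rewrite eq_complex /= eqxx/= addrC.
Qed.

Let cis0 : cis 0 = 1.
Proof. by rewrite /cis cos0 sin0. Qed.

Let ReD (I : Type) (r : seq I) (F : I -> C) :
  complex.Re (\sum_(i <- r) F i) = \sum_(i <- r) complex.Re (F i).
Proof. by elim/big_rec2 : _ => //= i y1 y2 _ <-; case: (F i) y2 => a b []. Qed.

Let ImD (I : Type) (r : seq I) (F : I -> C) :
  complex.Im (\sum_(i <- r) F i) = \sum_(i <- r) complex.Im (F i).
Proof. by elim/big_rec2 : _ => //= i y1 y2 _ <-; case: (F i) y2 => a b []. Qed.

Lemma symsum_odd N (F : int -> R) : (forall k, F (- k) = - F k) -> symsum N F = 0.
Proof.
move=> oF; elim: N => [|N IH].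
  by rewrite symsum0; have := oF 0; rewrite oppr0; lra.
by rewrite symsumS IH oF addr0 addNr.
Qed.

(** With even coefficients a cosine polynomial is also a sum of complex exponentials,
    whose products are exponentials of scalar products; then take real parts. *)
Lemma prod_tpoly d K (c : 'I_d -> int -> R) (y : 'cV[R]_d) :
  (forall j k, c j (- k) = c j k) ->
  \prod_j tpoly K (c j) (y j 0) =
  \sum_(g : {ffun 'I_d -> 'I_K.*2.+1})
    (\prod_j c j ((g j)%:Z - K%:Z)) *
      cos (2 * pi * dot (int_vec (window (const_mx (- K%:Z)) g)) y).
Proof.
move=> ce.
pose F j (i : 'I_K.*2.+1) : C :=
  (c j (i%:Z - K%:Z))%:C%C * cis (2 * pi * (i%:Z - K%:Z)%:~R * y j 0).
have sF j : \sum_i F j i = (tpoly K (c j) (y j 0))%:C%C.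
  apply/eqP; rewrite eq_complex ReD ImD /=; apply/andP; split; apply/eqP.
    by apply: eq_bigr => i _; rewrite /F /= mul0r subr0.
  rewrite -[RHS](@symsum_odd K (fun k => c j k * sin (2 * pi * k%:~R * y j 0))).
    by apply: eq_bigr => i _; rewrite /F /= mul0r addr0.
  by move=> k; rewrite ce intrN mulrN mulNr sinN mulrN.
have : \prod_j \sum_i F j i = (\prod_j tpoly K (c j) (y j 0))%:C%C.
  by rewrite rmorph_prod; apply: eq_bigr => j _.
rewrite bigA_distr_bigA => /(congr1 (@complex.Re R)); rewrite ReD /= => <-.
apply: eq_bigr => g _; rewrite big_split /= -rmorph_prod /=.
have -> : \prod_j cis (2 * pi * ((g j)%:Z - K%:Z)%:~R * y j 0) =
    cis (2 * pi * dot (int_vec (window (const_mx (- K%:Z)) g)) y).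
  rewrite -(big_morph cis cisD cis0); congr cis; rewrite /dot mulr_sumr.
  apply: eq_bigr => j _; rewrite !mxE mulrA; congr (_ * _%:~R * _).
  by rewrite addrC.
by rewrite /= mul0r subr0.
Qed.

End periodized_products.

(** * The quadrature error over all frequencies *)

Section decay_sums.
Context {R : realType}.

(** The summand is at most twice the increment of the bounded increasing function
    [t / (1 + |t|)]. *)
Lemma sum_decay2 K (y : R) :
  \sum_(j < K.*2.+1) (1 + `|(j%:Z - K%:Z)%:~R - y|) ^- 2 <= 4.
Proof.
pose H (t : R) := t / (1 + `|t|).
have p0 (t : R) : 0 < 1 + `|t| by rewrite ltr_pwDl.
have H1 t : -1 <= H t <= 1.
  rewrite /H ler_pdivrMr// ler_pdivlMr// mul1r mulN1r -ler_norml.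
  by rewrite lerDr.
have inc (t : R) : (1 + `|t|) ^- 2 <= 2 * (H (t + 1) - H t).
  rewrite /H -exprVn expr2.
  have [t0|t0] := leP 0 t.
    rewrite !ger0_norm; [|lra|lra].
    have -> : 2 * ((t + 1) / (1 + (t + 1)) - t / (1 + t)) =
        (1 + t)^-1 * (2 / (1 + (t + 1))) by field; lra.
    rewrite ler_wpM2l ?invr_ge0; [|lra|]; first by [].
    by rewrite -[leLHS]mul1r ler_pdivrMr; [rewrite mulrAC ler_pdivlMr; lra|lra].
  have [t1|t1] := leP (t + 1) 0.
    rewrite (ltr0_norm t0) (ler0_norm t1).
    have -> : 2 * ((t + 1) / (1 + - (t + 1)) - t / (1 + - t)) =
        (1 - t)^-1 * (2 / - t) by field; lra.
    rewrite ler_wpM2l ?invr_ge0; [|lra|]; first by [].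
    by rewrite -[leLHS]mul1r ler_pdivrMr; [rewrite mulrAC ler_pdivlMr; lra|lra].
  rewrite (ltr0_norm t0) (gtr0_norm t1).
  have a1 : (1 - t)^-1 * (1 - t)^-1 <= 1.
    by rewrite -[leRHS]mulr1 ler_pM ?invr_ge0 ?invf_le1; lra.
  have a2 : (t + 1) / 2 <= (t + 1) / (1 + (t + 1)).
    by rewrite ler_wpM2l ?lef_pV2 ?posrE; lra.
  have a3 : - t / 2 <= - t / (1 - t) by rewrite ler_wpM2l ?lef_pV2 ?posrE; lra.
  by apply: (le_trans a1); move: a2 a3; rewrite !mulNr; lra.
pose t0 := - K%:R - y.
apply: (@le_trans _ _ (\sum_(j < K.*2.+1) 2 * (H (t0 + j.+1%:R) - H (t0 + j%:R)))).
  apply: ler_sum => j _; rewrite -[j.+1%:R]natr1 addrA.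
  apply: le_trans (inc _); rewrite (_ : _ - y = t0 + j%:R)//.
  by rewrite /t0 intrB -[j%:Z%:~R]/(j%:R) -[K%:Z%:~R]/(K%:R); ring.
rewrite -mulr_sumr -(big_mkord xpredT (fun j => H (t0 + j.+1%:R) - H (t0 + j%:R))).
rewrite (telescope_sumr (fun j => H (t0 + j%:R)))//.
by have := H1 (t0 + K.*2.+1%:R); have := H1 (t0 + 0%:R); lra.
Qed.

Lemma omega_decay (u y : R) r : 0 <= u <= 1 ->
  omega u y ^+ r.+2 <= 4 * (1 + `|y|) ^- 2.
Proof.
move=> /andP[u0 u1]; have y0 := normr_ge0 y.
have o0 := omega_ge0 y u0.
have h1 : omega u y <= 1.
  by rewrite ler_pdivrMr ?max1_gt0// mul1r le_max u1.
have h2 : omega u y <= 2 / (1 + `|y|).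
  rewrite ler_pdivrMr ?max1_gt0// mulrAC ler_pdivlMr; last lra.
  have : 1 <= Num.max 1 (u * `|y|) by rewrite le_max lexx.
  have : u * `|y| <= Num.max 1 (u * `|y|) by rewrite le_max lexx orbT.
  by rewrite mulrDr mulr1; lra.
apply: (@le_trans _ _ (omega u y ^+ 2)).
  by rewrite -addn2 exprD -[leRHS]mul1r ler_wpM2r ?exprn_ge0// exprn_ile1.
apply: (@le_trans _ _ ((2 / (1 + `|y|)) ^+ 2)).
  by rewrite lerXn2r ?nnegrE// (le_trans o0).
by rewrite exprMn exprVn -natrX.
Qed.

End decay_sums.

Section frequency_sum.
Context {R : realType} {d : nat} (A : 'M[R]_d.+1) (r : nat).
Hypothesis frA : frolov_matrix A.
Local Notation l := (r.+2 * d.+1)%N.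
Variables (S : R -> R) (M : R).
Hypothesis S0 : forall x, x <= 0 -> S x = 0.
Hypothesis S1 : forall x, 1 <= x -> S x = 1.
Hypothesis Sh : {homo S : x y / x <= y}.
Hypothesis SM : smooth1 (l.*2).+1 M S.
Local Notation V := 'cV[R]_d.+1.
Local Notation Z := 'cV[int]_d.+1.
Implicit Types (a b : R) (u w : V) (k m : Z).

Let Au : A \in unitmx. Proof. by case: frA. Qed.

Let wsum a w b := `|latsum (dual A a) (fun x => tplateau S x * wave w b x) 0|.

(** [a *: A *m int_vec m] runs through the lattice dual to the quadrature lattice;
    this is the [m] whose dual point is nearest to [k] in lattice coordinates. *)
Let nearest a k : Z :=
  map_mx Num.floor (a^-1 *: (invmx A *m int_vec k) + const_mx (1 / 2)).

Let residue a k : V := int_vec k - a *: (A *m int_vec (nearest a k)).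

Lemma residue_small a k : 1 <= a -> forall i, `|(invmx A *m residue a k) i 0| <= a / 2.
Proof.
move=> a1 i; have a0 : 0 < a := lt_le_trans ltr01 a1.
rewrite mulmxBr -scalemxAr mulKmx//.
pose y := (invmx A *m int_vec k) i 0.
have -> : (invmx A *m int_vec k - a *: int_vec (nearest a k)) i 0 =
    y - a * (Num.floor (a^-1 * y + 1 / 2))%:~R.
  by rewrite /y /nearest; move: (invmx A *m _) => q; rewrite !mxE.
have /andP[] := floor_bounds (a^-1 * y + 1 / 2).
set f := (Num.floor _)%:~R => f1 f2.
have -> : y - a * f = a * (a^-1 * y - f) by rewrite mulrBr mulVKf ?gt_eqF.
by rewrite normrM gtr0_norm// ler_pM2l// ler_norml; lra.
Qed.

(** Waves whose frequencies differ by a point of the dual lattice agree on the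
    quadrature lattice. *)
Lemma wsum_residue a k b : 1 <= a -> wsum a (int_vec k) b = wsum a (residue a k) b.
Proof.
move=> a1; have a0 : 0 < a := lt_le_trans ltr01 a1.
congr `|_|; apply: eq_fsbigr => n _; congr (_ * _); rewrite addr0 /wave.
set m := nearest a k; set x := lat _ _.
have -> : int_vec k = residue a k + a *: (A *m int_vec m) :> V by rewrite subrK.
rewrite dotDl.
have -> : dot (a *: (A *m int_vec m)) x = (\sum_j m j 0 * n j 0)%:~R.
  transitivity (((int_vec m : V)^T *m (int_vec n : V)) 0 0).
    transitivity (((a *: (A *m int_vec m))^T *m x) 0 0).
      by rewrite mxE; apply: eq_bigr => j _; rewrite [_^T _ _]mxE.
    rewrite /x /lat /dual linearZ /= -!scalemxAl -scalemxAr scalerA divff ?gt_eqF// scale1r.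
    by rewrite trmx_mul -mulmxA trmx_inv mulKVmx ?unitmx_tr.
  rewrite mxE rmorph_sum; apply: eq_bigr => j _.
  by rewrite !mxE rmorphM.
by rewrite -[RHS](cos_shift_int _ (\sum_j m j 0 * n j 0)); congr cos; ring.
Qed.

(** Every factor is at most the one of the largest coordinate of the residue, for which
    [wave_sum_decay] is used. Bounding the product over all coordinates in this way is
    what takes so many derivatives of the plateau. *)
Lemma wsum_prod_decay : exists2 C, 0 <= C & forall a k b, 1 <= a ->
  (\prod_j (1 + `|residue a k j 0|) ^+ r.+2) ^+ 2 * wsum a (int_vec k) b <= C * a ^+ d.+1.
Proof.
have [C1 C10 h1] := wave_sum_trivial Au l S0 S1 Sh.
have [C2 C20 h2] := wave_sum_decay (ltn0Sn d) Au S0 S1 SM.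
exists (2 ^+ l.*2 * (C1 + C2)); first by rewrite mulr_ge0 ?exprn_ge0 ?addr_ge0.
move=> a k b a1; rewrite wsum_residue//; set w := residue a k.
have hw := residue_small k a1; rewrite -/w in hw.
have [J hJ] : exists J, forall i, `|w i 0| <= `|w J 0|.
  have [J _ h] := @Order.TotalTheory.arg_maxP _ _ _ (ord0 : 'I_d.+1) xpredT (fun i => `|w i 0|) isT.
  by exists J => i; exact: h.
move: (h1 a w b a1) (h2 a w b a1 hw J); rewrite -/(wsum a w b).
have W0 : 0 <= wsum a w b by exact: normr_ge0.
move: (wsum a w b) W0 => W W0 e1 e2; set x := `|w J 0| in hJ e2.
have x0 : 0 <= x by exact: normr_ge0.
have hp : (\prod_j (1 + `|w j 0|) ^+ r.+2) ^+ 2 <= (1 + x) ^+ l.*2.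
  rewrite -muln2 exprM lerXn2r ?nnegrE ?exprn_ge0 ?addr_ge0//.
    by apply: prodr_ge0 => j _; rewrite exprn_ge0// addr_ge0.
  rewrite exprM -[X in _ <= _ ^+ X]card_ord -prodr_const; apply: ler_prod => j _.
  by rewrite exprn_ge0 ?addr_ge0//= lerXn2r ?nnegrE ?addr_ge0// lerD2l.
have hx : (1 + x) ^+ l.*2 <= 2 ^+ l.*2 * (1 + x ^+ l.*2).
  have [x1|x1] := leP x 1.
    apply: (@le_trans _ _ (2 ^+ l.*2)).
      by rewrite lerXn2r ?nnegrE ?addr_ge0//; lra.
    by rewrite ler_peMr ?exprn_ge0// lerDl exprn_ge0.
  apply: (@le_trans _ _ (2 ^+ l.*2 * x ^+ l.*2)).
    by rewrite -exprMn lerXn2r ?nnegrE ?addr_ge0 ?mulr_ge0//; lra.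
  by rewrite ler_wpM2l ?exprn_ge0// lerDr.
apply: (le_trans (ler_wpM2r W0 (le_trans hp hx))).
have p0 : 0 <= 2 ^+ l.*2 :> R by exact: exprn_ge0.
move: (2 ^+ l.*2) p0 (x ^+ l.*2) e2 => p p0 xl e2.
rewrite -mulrA -[leRHS]mulrA; apply: ler_wpM2l => //.
by rewrite !mulrDl mul1r; apply: lerD.
Qed.

Let freq K (g : {ffun 'I_d.+1 -> 'I_K.*2.+1}) : Z := window (const_mx (- K%:Z)) g.

Let sum_prod_freq K (F : 'I_d.+1 -> int -> R) :
  \sum_(g : {ffun 'I_d.+1 -> 'I_K.*2.+1}) \prod_j F j (freq g j 0) =
  \prod_j symsum K (F j).
Proof.
rewrite /symsum bigA_distr_bigA; apply: eq_bigr => g _; apply: eq_bigr => j _.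
by rewrite !mxE addrC.
Qed.

Let prod_decay_le K (y : V) :
  \sum_(g : {ffun 'I_d.+1 -> 'I_K.*2.+1})
    \prod_j (1 + `|(freq g j 0)%:~R - y j 0|) ^- 2 <= 4 ^+ d.+1.
Proof.
rewrite (sum_prod_freq K (fun j n => (1 + `|n%:~R - y j 0|) ^- 2)).
rewrite -[X in _ <= _ ^+ X]card_ord -prodr_const; apply: ler_prod => j _.
rewrite sum_decay2 andbT; apply: sumr_ge0 => i _.
by rewrite invr_ge0 exprn_ge0// addr_ge0.
Qed.

(** The frequencies are grouped by [nearest a k]. The group of zero is handled by
    [wave_sum_small], the coefficients being summable. In the group of [m != 0], half of
    the decay of [wsum] pays for moving the frequency inside [omega] from [k] to
    [a A m], the other half makes the sum over [k] bounded; [frolov_sum] sums over [m]. *)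
Lemma frequency_sum : exists2 C, 0 <= C & forall a u n0 K (b : Z -> R), 1 <= a ->
  (forall j, 0 < u j 0 <= 1 / 2) ->
  a ^+ d.+1 * pr u <= 2 ^+ (n0 + d.+1) ->
  (forall n, a ^+ d.+1 * pr u <= 2 ^+ (n + d.+1) -> (n0 <= n)%N) ->
  \sum_(g : {ffun 'I_d.+1 -> 'I_K.*2.+1} | freq g != 0)
    (\prod_j omega (u j 0) (freq g j 0)%:~R ^+ r.+2) * wsum a (int_vec (freq g)) (b (freq g))
  <= C * a ^+ d.+1 * n0.+1%:R ^+ d / a ^+ l.
Proof.
have [C3 C30 h3] := wsum_prod_decay.
have [C4 C40 h4] := wave_sum_small (ltn0Sn d) Au S0 S1 Sh SM.
have [C5 C50 h5] := frolov_sum frA (ltn0Sn r).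
exists (C4 * 16 ^+ d.+1 + C3 * 4 ^+ d.+1 * C5).
  by rewrite addr_ge0 ?mulr_ge0 ?exprn_ge0.
move=> a u n0 K b a1 u01 hn0 hmin; have a0 : 0 < a := lt_le_trans ltr01 a1.
have u0 j : 0 < u j 0 by have := u01 j; lra.
have ui j : 0 <= u j 0 <= 1 by have := u01 j; lra.
pose Q k := \prod_j omega (u j 0) (k j 0)%:~R ^+ r.+2.
have Q0 k : 0 <= Q k.
  by apply: prodr_ge0 => j _; rewrite exprn_ge0// omega_ge0 ?ltW.
have ad0 : 0 <= a ^+ d.+1 by rewrite exprn_ge0 ?ltW.
have al0 : 0 < a ^+ l by rewrite exprn_gt0.
have n1 : 1 <= n0.+1%:R ^+ d :> R by rewrite exprn_ege1// ler1n.
rewrite (bigID (fun g => nearest a (freq g) == 0)) /=.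
have -> : (C4 * 16 ^+ d.+1 + C3 * 4 ^+ d.+1 * C5) * a ^+ d.+1 * n0.+1%:R ^+ d / a ^+ l =
  16 ^+ d.+1 * (C4 * a ^+ d.+1 / a ^+ l) * n0.+1%:R ^+ d +
  C3 * a ^+ d.+1 * 4 ^+ d.+1 * (C5 * n0.+1%:R ^+ d / a ^+ l) by ring.
apply: lerD.
  have E0 : 0 <= C4 * a ^+ d.+1 / a ^+ l by rewrite divr_ge0 ?mulr_ge0// ltW.
  apply: (@le_trans _ _ (16 ^+ d.+1 * (C4 * a ^+ d.+1 / a ^+ l))); last first.
    by rewrite ler_peMr// mulr_ge0// exprn_ge0.
  apply: (@le_trans _ _ (\sum_(g | (freq g != 0) && (nearest a (freq g) == 0))
      Q (@freq K g) * (C4 * a ^+ d.+1 / a ^+ l))).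
    apply: ler_sum => g /andP[g0 /eqP gm]; apply: ler_wpM2l; first exact: Q0.
    apply: h4 => // i; have := residue_small (freq g) a1 i.
    rewrite /residue gm (_ : int_vec 0 = 0) ?mulmx0 ?scaler0 ?subr0//.
    by apply/colP => j; rewrite !mxE.
  rewrite -mulr_suml ler_wpM2r//.
  apply: (@le_trans _ _ (\sum_(g : {ffun 'I_d.+1 -> 'I_K.*2.+1}) Q (freq g))).
    rewrite [leRHS](bigID (fun g => (freq g != 0) && (nearest a (freq g) == 0))) /=.
    by rewrite lerDl sumr_ge0.
  rewrite /Q (sum_prod_freq K (fun j n => omega (u j 0) n%:~R ^+ r.+2)).
  rewrite -[X in _ <= _ ^+ X]card_ord -prodr_const; apply: ler_prod => j _.
  apply/andP; split.
    by apply: sumr_ge0 => i _; rewrite exprn_ge0// omega_ge0 ?ltW.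
  apply: (@le_trans _ _ (4 * symsum K (fun n => (1 + `|n%:~R - 0|) ^- 2))).
    by rewrite /symsum mulr_sumr; apply: ler_sum => i _; rewrite subr0 omega_decay.
  by have := sum_decay2 K (0 : R); rewrite /symsum; lra.
pose y m : V := a *: (A *m int_vec m).
pose T m := \prod_j omega (u j 0) (y m j 0) ^+ r.+2.
have T0 m : 0 <= T m.
  by apply: prodr_ge0 => j _; rewrite exprn_ge0// omega_ge0 ?ltW.
have term k : Q k * wsum a (int_vec k) (b k) <= C3 * a ^+ d.+1 *
    ((\prod_j (1 + `|(k j 0)%:~R - y (nearest a k) j 0|) ^- 2) * T (nearest a k)).
  pose P := \prod_j (1 + `|residue a k j 0|) ^+ r.+2.
  have P1 j : 1 <= 1 + `|residue a k j 0| by rewrite lerDl.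
  have P0 : 0 < P by apply: prodr_gt0 => j _; rewrite exprn_gt0// (lt_le_trans ltr01).
  have resE j : residue a k j 0 = (k j 0)%:~R - y (nearest a k) j 0.
    by rewrite /residue /y; move: (a *: _) => q; rewrite !mxE.
  have W0 : 0 <= wsum a (int_vec k) (b k) by exact: normr_ge0.
  have QT : Q k <= P * T (nearest a k).
    rewrite /Q /P /T -big_split /=; apply: ler_prod => j _.
    rewrite exprn_ge0 ?omega_ge0 ?(ltW (u0 j))//= -exprMn.
    have o1 := omega_ge0 (k j 0)%:~R (ltW (u0 j)).
    have := omega_transfer (k j 0)%:~R (y (nearest a k) j 0) (ui j); rewrite -resE => h.
    by rewrite lerXn2r ?nnegrE// (le_trans o1).
  have PV : P^-1 <= \prod_j (1 + `|(k j 0)%:~R - y (nearest a k) j 0|) ^- 2.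
    rewrite /P -prodfV; apply: ler_prod => j _.
    have e1 : 0 < 1 + `|residue a k j 0| by rewrite (lt_le_trans ltr01).
    rewrite invr_ge0 exprn_ge0 ?(ltW e1)//= -resE lef_pV2 ?posrE ?exprn_gt0//.
    by rewrite ler_weXn2l.
  have := h3 a k (b k) a1; rewrite -/P => h.
  have W1 : wsum a (int_vec k) (b k) <= C3 * a ^+ d.+1 / P ^+ 2.
    by rewrite ler_pdivlMr ?exprn_gt0// mulrC.
  apply: (@le_trans _ _ (P * T (nearest a k) * (C3 * a ^+ d.+1 / P ^+ 2))).
    by apply: ler_pM.
  have -> : P * T (nearest a k) * (C3 * a ^+ d.+1 / P ^+ 2) =
      C3 * a ^+ d.+1 * (P^-1 * T (nearest a k)) * (P / P).
    by rewrite expr2 invfM; ring.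
  by rewrite divff ?gt_eqF// mulr1 ler_wpM2l ?mulr_ge0// ler_wpM2r.
apply: (@le_trans _ _ (C3 * a ^+ d.+1 * \sum_(g | (freq g != 0) && (nearest a (freq g) != 0))
    ((\prod_j (1 + `|(@freq K g j 0)%:~R - y (nearest a (freq g)) j 0|) ^- 2) *
      T (nearest a (freq g))))).
  by rewrite mulr_sumr; apply: ler_sum => g _; exact: term.
rewrite -[leRHS]mulrA ler_wpM2l ?mulr_ge0//.
pose s := undup [seq nearest a (@freq K g) | g <- enum {ffun 'I_d.+1 -> 'I_K.*2.+1} &
  nearest a (freq g) != 0].
have h5s : \sum_(m <- s) T m <= C5 * n0.+1%:R ^+ d / a ^+ l.
  apply: le_trans (h5 a u n0 s a1 u0 hn0 hmin (undup_uniq _) _).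
    by apply: ler_sum => m _; apply: ler_prod => j _; rewrite mxE lexx andbT
      exprn_ge0// omega_ge0 ?ltW.
  by rewrite mem_undup; apply/mapP => -[g]; rewrite mem_filter => /andP[/eqP h _] /esym /h.
apply: le_trans (ler_wpM2l (exprn_ge0 _ (ler0n R 4)) h5s).
rewrite mulr_sumr.
apply: (@le_trans _ _ (\sum_(m <- s) \sum_(g : {ffun 'I_d.+1 -> 'I_K.*2.+1})
    (\prod_j (1 + `|(freq g j 0)%:~R - y m j 0|) ^- 2) * T m)); last first.
  apply: ler_sum => m _; rewrite -mulr_suml ler_wpM2r//; exact: prod_decay_le.
rewrite exchange_big /= [leRHS](bigID (fun g => (freq g != 0) && (nearest a (freq g) != 0))) /=.
have G0 g m : 0 <= (\prod_j (1 + `|(@freq K g j 0)%:~R - y m j 0|) ^- 2) * T m.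
  rewrite mulr_ge0//; apply: prodr_ge0 => j _.
  by rewrite invr_ge0 exprn_ge0// addr_ge0.
apply: ler_wpDr; first by apply: sumr_ge0 => g _; apply: sumr_ge0.
apply: ler_sum => g /andP[_ gm].
have gs : nearest a (freq g) \in s.
  by rewrite mem_undup; apply/mapP; exists g => //; rewrite mem_filter gm mem_enum.
by rewrite (big_rem _ gs) /= lerDl sumr_ge0.
Qed.

End frequency_sum.

(** * The cubature formula *)

Lemma prod_dist_le (R : realType) n (x y : 'I_n -> R) (b e : R) : 1 <= b -> 0 <= e ->
  (forall j, `|x j| <= b) -> (forall j, `|y j| <= b) -> (forall j, `|x j - y j| <= e) ->
  `|\prod_j x j - \prod_j y j| <= n%:R * b ^+ n * e.
Proof.
move=> b1 e0 xb yb xy; have b0 : 0 <= b by exact: le_trans b1.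
have pb (z : 'I_n -> R) : (forall j, `|z j| <= b) -> forall s : seq 'I_n,
    `|\prod_(j <- s) z j| <= b ^+ size s.
  move=> zb; elim=> [|j s IH]; first by rewrite big_nil normr1.
  by rewrite big_cons normrM exprS ler_pM.
suff H (s : seq 'I_n) : `|\prod_(j <- s) x j - \prod_(j <- s) y j| <=
    (size s)%:R * b ^+ size s * e.
  by have := H (index_enum 'I_n); rewrite /index_enum -enumT size_enum_ord.
elim: s => [|j s IH]; first by rewrite !big_nil subrr normr0 !mul0r.
rewrite !big_cons /=; set X := \prod_(j <- s) x j in IH *; set Y := \prod_(j <- s) y j in IH *.
have -> : x j * X - y j * Y = x j * (X - Y) + (x j - y j) * Y by ring.
apply: (le_trans (ler_normD _ _)); rewrite !normrM.
have h1 : `|x j| * `|X - Y| <= b * ((size s)%:R * b ^+ size s * e) by rewrite ler_pM.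
have h2 : `|x j - y j| * `|Y| <= e * b ^+ (size s).+1.
  apply: ler_pM => //; apply: (le_trans (pb y yb s)).
  by rewrite exprS ler_peMl// exprn_ge0.
apply: (le_trans (lerD h1 h2)); rewrite -[(size s).+1%:R]natr1 exprS.
by rewrite le_eqVlt; apply/orP; left; apply/eqP; ring.
Qed.

Section weighted_sums.
Context {R : realType} {d : nat} (A : 'M[R]_d) (a : R) (S : R -> R).
Hypothesis Au : A \in unitmx.
Hypothesis a1 : 1 <= a.
Hypothesis S0 : forall x, x <= 0 -> S x = 0.
Hypothesis S1 : forall x, 1 <= x -> S x = 1.
Local Notation V := 'cV[R]_d.
Local Notation pts := (fset_set (frolov_set a A)).

Let a0 : 0 < a. Proof. exact: lt_le_trans a1. Qed.

(** The lattice points outside the box have weight zero. *)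
Lemma frolov_sum_latsum (F : V -> R) :
  \sum_(x <- pts) tplateau S x * F x = latsum (dual A a) (fun x => tplateau S x * F x) 0.
Proof.
pose G x := tplateau S x * F x; rewrite -/G.
have latE n : lat (dual A a) n = a^-1 *: ((invmx A)^T *m int_vec n).
  by rewrite /lat /dual -scalemxAl.
transitivity (\sum_(x \in range (lat (dual A a))) G x).
  rewrite -(fsbig_finite _ G (finite_frolov_set Au a0)).
  apply: fsbig_widen => x.
    by move=> [[n _ <-] _]; exists n => //; rewrite latE.
  move=> [[n _ <-] hx] /=; apply: contrapT => Gn; apply: hx; split.
    by exists n => //; rewrite latE.
  move=> j /=; apply: contrapT => /negP h; apply: Gn.
  by rewrite /G (tplateau0 S0 S1 h) ?mul0r.
rewrite fsbig_image; first by apply: eq_fsbigr => n _; rewrite addr0.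
move=> n p _ _ /(congr1 (mulmx (invmx (dual A a)))).
rewrite /lat !mulKmx ?dual_unit// => /colP e; apply/colP => j.
by have := e j; rewrite !mxE => /intr_inj.
Qed.

End weighted_sums.

Section cubature_error.
Context {R : realType} {d : nat} (A : 'M[R]_d.+1) (r : nat).
Hypothesis frA : frolov_matrix A.
Local Notation l := (r.+2 * d.+1)%N.
Variables (S : R -> R) (M : R).
Hypothesis S0 : forall x, x <= 0 -> S x = 0.
Hypothesis S1 : forall x, 1 <= x -> S x = 1.
Hypothesis Sh : {homo S : x y / x <= y}.
Hypothesis SM : smooth1 (l.*2).+1 M S.
Local Notation V := 'cV[R]_d.+1.
Local Notation Z := 'cV[int]_d.+1.
Implicit Types (a : R) (u w z : V).

Let Au : A \in unitmx. Proof. by case: frA. Qed.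

Definition total_weight a := latsum (dual A a) (tplateau S) 0.

Definition cubature a (F : V -> R) :=
  \sum_(x <- fset_set (frolov_set a A)) tplateau S x / total_weight a * F x.

Lemma cubature_latsum a (F : V -> R) : 1 <= a ->
  cubature a F = latsum (dual A a) (fun x => tplateau S x * F x) 0 / total_weight a.
Proof.
move=> a1; rewrite -(frolov_sum_latsum Au a1 S0 S1) mulr_suml.
by apply: eq_bigr => x _; ring.
Qed.

Lemma cubature1 a : 1 <= a -> 0 < total_weight a -> cubature a (fun=> 1) = 1.
Proof.
move=> a1 w0; rewrite cubature_latsum//.
rewrite (_ : latsum _ _ _ = total_weight a) ?divff ?gt_eqF//.
by apply: eq_fsbigr => n _; rewrite mulr1.
Qed.

(** The weights are nonnegative and sum to one. *)
Lemma cubature_dist_le a (F G : V -> R) e : 1 <= a -> 0 < total_weight a ->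
  (forall x, `|F x - G x| <= e) -> `|cubature a F - cubature a G| <= e.
Proof.
move=> a1 w0 FG; rewrite -[e in leRHS]mulr1 -(cubature1 a1 w0) /cubature mulr_sumr -sumrB.
apply: (le_trans (ler_norm_sum _ _ _)); apply: ler_sum => x _.
rewrite -mulrBr normrM mulr1 [leRHS]mulrC ger0_norm; last first.
  by rewrite divr_ge0 ?tplateau_ge0// ltW.
by rewrite ler_wpM2l// divr_ge0 ?tplateau_ge0// ltW.
Qed.

(** The bound is uniform in [K], so approximants of products stay close to products. *)
Lemma tpoly_norm_le K (c : int -> R) C (u : R) : 0 <= C -> 0 < u <= 1 / 2 ->
  (forall k : int, `|k| <= K%:Z -> `|c k| <= C * omega u k%:~R ^+ r.+2) ->
  forall x : R, `|tpoly K c x| <= 16 * C.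
Proof.
move=> C0 u01 hc x; have ui : 0 <= u <= 1 by lra.
apply: (le_trans (ler_norm_sum _ _ _)).
apply: (@le_trans _ _ (\sum_(j < K.*2.+1) C * (4 * (1 + `|(j%:Z - K%:Z)%:~R - 0|) ^- 2))).
  apply: ler_sum => j _.
  rewrite normrM -[leRHS]mulr1 ler_pM ?cos_max// subr0.
  apply: le_trans (hc _ _) _; first exact: symsum_index_le.
  by rewrite ler_wpM2l// omega_decay.
have := sum_decay2 K (0 : R); rewrite -!mulr_sumr; set W := \sum_j _ => W4.
have -> : 16 * C = C * (4 * 4) by ring.
by rewrite ler_wpM2l// ler_wpM2l.
Qed.

(** The zero frequency is integrated exactly, so only the nonzero ones contribute. *)
Lemma cubature_tpoly_error (c0 : R) : 0 < c0 -> exists2 C, 0 <= C &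
  forall a u n0 z K (c : 'I_d.+1 -> int -> R) Ct, 1 <= a ->
  c0 * a ^+ d.+1 <= total_weight a -> 0 <= Ct ->
  (forall j, 0 < u j 0 <= 1 / 2) ->
  a ^+ d.+1 * pr u <= 2 ^+ (n0 + d.+1) ->
  (forall n, a ^+ d.+1 * pr u <= 2 ^+ (n + d.+1) -> (n0 <= n)%N) ->
  (forall j k, c j (- k) = c j k) ->
  (forall j (k : int), `|k| <= K%:Z -> `|c j k| <= Ct * omega (u j 0) k%:~R ^+ r.+2) ->
  `|cubature a (fun x => \prod_j tpoly K (c j) (x j 0 - z j 0)) - \prod_j c j 0|
    <= Ct ^+ d.+1 * C * n0.+1%:R ^+ d / a ^+ l.
Proof.
move=> c00; have [C C0 hC] := frequency_sum frA S0 S1 Sh SM.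
exists (C / c0); first by rewrite divr_ge0// ltW.
move=> a u n0 z K c Ct a1 hw Ct0 u01 hn0 hmin ce hc.
have a0 : 0 < a := lt_le_trans ltr01 a1.
have ad0 : 0 < a ^+ d.+1 by rewrite exprn_gt0.
have w0 : 0 < total_weight a by apply: lt_le_trans hw; rewrite mulr_gt0.
pose freq (g : {ffun 'I_d.+1 -> 'I_K.*2.+1}) : Z := window (const_mx (- K%:Z)) g.
pose cp (g : {ffun 'I_d.+1 -> 'I_K.*2.+1}) := \prod_j c j ((g j)%:Z - K%:Z).
pose b (k : Z) := - (2 * pi * dot (int_vec k) z).
pose Q g := cubature a (wave (int_vec (freq g)) (b (freq g))).
have freqE (g : {ffun 'I_d.+1 -> 'I_K.*2.+1}) j : (g j)%:Z - K%:Z = freq g j 0 by rewrite !mxE addrC.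
have sumE : cubature a (fun x => \prod_j tpoly K (c j) (x j 0 - z j 0)) =
    \sum_g cp g * Q g.
  rewrite /Q /cubature.
  under [RHS]eq_bigr => g _ do rewrite mulr_sumr.
  rewrite exchange_big /=; apply: eq_bigr => x _.
  have -> : \prod_j tpoly K (c j) (x j 0 - z j 0) = \prod_j tpoly K (c j) ((x - z) j 0).
    by apply: eq_bigr => j _; rewrite !mxE.
  rewrite prod_tpoly// mulr_sumr; apply: eq_bigr => g _; rewrite mulrCA; congr (_ * (_ * _)).
  have dotN w y y' : dot w (y - y') = dot w y - dot w y' :> R.
    by rewrite dotDr -scaleN1r dotZr mulN1r.
  by rewrite /wave /b dotN mulrBr.
pose g0 : {ffun 'I_d.+1 -> 'I_K.*2.+1} := [ffun => inord K].
have g0E g : (freq g == 0) = (g == g0).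
  apply/eqP/eqP => [/colP e|->].
    apply/ffunP => j; apply/val_inj; have := e j; rewrite -freqE mxE ffunE /=.
    rewrite inordK; last by rewrite -addnn ltnS leq_addr.
    by move=> /eqP; rewrite subr_eq0 => /eqP [].
  apply/colP => j; rewrite -freqE mxE ffunE /= inordK ?subrr//.
  by rewrite -addnn ltnS leq_addr.
have Q1 : Q g0 = 1.
  rewrite -(cubature1 a1 w0) /Q; congr cubature; apply/funext => x.
  have /eqP -> : freq g0 == 0 by rewrite g0E.
  have d0 y : dot (int_vec 0) y = 0 :> R by rewrite /dot big1// => j _; rewrite !mxE mul0r.
  by rewrite /wave /b !d0 mulr0 oppr0 addr0 cos0.
have cp0 : cp g0 = \prod_j c j 0.
  apply: eq_bigr => j _; rewrite freqE.
  by have /eqP -> : freq g0 == 0 by [rewrite g0E]; rewrite mxE.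
rewrite sumE (bigD1 g0)//= Q1 mulr1 cp0 addrAC subrr add0r.
apply: (le_trans (ler_norm_sum _ _ _)).
under eq_bigl => g do rewrite -g0E.
apply: (@le_trans _ _ (Ct ^+ d.+1 / total_weight a * \sum_(g | freq g != 0)
   (\prod_j omega (u j 0) (freq g j 0)%:~R ^+ r.+2) *
    `|latsum (dual A a) (fun x => tplateau S x * wave (int_vec (freq g)) (b (freq g)) x) 0|)).
  rewrite mulr_sumr; apply: ler_sum => g _.
  rewrite /Q cubature_latsum// normrM normf_div (gtr0_norm w0).
  set L := `|latsum _ _ _|; set P := \prod_j _.
  have cpP : `|cp g| <= Ct ^+ d.+1 * P.
    rewrite /cp normr_prod -[X in _ ^+ X]card_ord -prodr_const -big_split /=.
    apply: ler_prod => j _; rewrite normr_ge0 freqE /=; apply: hc.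
    by rewrite -freqE; exact: symsum_index_le.
  have -> : Ct ^+ d.+1 / total_weight a * (P * L) = Ct ^+ d.+1 * P * (L / total_weight a).
    by ring.
  by rewrite ler_wpM2r// divr_ge0 ?normr_ge0// ltW.
have := hC a u n0 K b a1 u01 hn0 hmin; rewrite -/freq; set W := \sum_(g | _) _ => hW.
have p0 : 0 <= Ct ^+ d.+1 by exact: exprn_ge0.
have E0 : 0 <= C * n0.+1%:R ^+ d / a ^+ l.
  by rewrite divr_ge0 ?mulr_ge0 ?exprn_ge0// ltW.
have -> : Ct ^+ d.+1 * (C / c0) * n0.+1%:R ^+ d / a ^+ l =
    Ct ^+ d.+1 * (C * n0.+1%:R ^+ d / a ^+ l / c0) by ring.
rewrite -mulrA; apply: ler_wpM2l => //; rewrite mulrC ler_pdivrMr//.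
apply: (le_trans hW).
have -> : C * a ^+ d.+1 * n0.+1%:R ^+ d / a ^+ l =
    C * n0.+1%:R ^+ d / a ^+ l / c0 * (c0 * a ^+ d.+1).
  by field; rewrite !gt_eqF// exprn_gt0.
by apply: ler_wpM2l => //; rewrite divr_ge0// ltW.
Qed.

(** The bound of [cubature_tpoly_error] does not depend on the quality of the
    approximation, which can then be made arbitrarily good. *)
Lemma cubature_hat_error (c0 : R) : 0 < c0 -> exists2 C, 0 <= C &
  forall a u n0 z, 1 <= a ->
  c0 * a ^+ d.+1 <= total_weight a -> (forall j, 0 < u j 0 <= 1 / 2) ->
  a ^+ d.+1 * pr u <= 2 ^+ (n0 + d.+1) ->
  (forall n, a ^+ d.+1 * pr u <= 2 ^+ (n + d.+1) -> (n0 <= n)%N) ->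
  `|cube_integral (fun x => hat_per r.+2 x z u) - cubature a (fun x => hat_per r.+2 x z u)|
    <= C * n0.+1%:R ^+ d / a ^+ l.
Proof.
move=> c00; have [C C0 hC] := cubature_tpoly_error c00.
have [Ct Ct0 hCt] := trig_approxP (R := R) r.
exists (Ct ^+ d.+1 * C); first by rewrite mulr_ge0 ?exprn_ge0.
move=> a u n0 z a1 hw u01 hn0 hmin.
have u0 j : 0 < u j 0 by have := u01 j; lra.
have a0 : 0 < a := lt_le_trans ltr01 a1.
have w0 : 0 < total_weight a by apply: lt_le_trans hw; rewrite mulr_gt0// exprn_gt0.
pose h j t := perhat r.+2 (u j 0) (t - z j 0).
have hE : (fun x : V => hat_per r.+2 x z u) = fun x => \prod_j h j (x j 0).
  by apply/funext => x; rewrite hat_per_prod.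
have shift_cont (f : R -> R) y : continuous f -> continuous (fun t => f (t - y)).
  move=> cf t; apply: (@continuous_comp _ _ _ (fun t => t - y) f); last exact: cf.
  by apply: cvgB; [exact: cvg_id|exact: cvg_cst].
have ch j : continuous (h j).
  by apply: (shift_cont (perhat r.+2 (u j 0))); exact: perhat_continuous (trig_approxP r) (u01 j).
rewrite hE cube_integral_prod//; last by move=> j x; exact: perhat_ge0.
pose B := 16 * Ct + 1; have B1 : 1 <= B by rewrite lerDr mulr_ge0.
pose D := d.+1%:R * B ^+ d.+1; have D0 : 0 < D.
  by rewrite mulr_gt0 ?ltr0n// exprn_gt0// (lt_le_trans ltr01).
apply/ler_addgt0Pr => e e0; pose e' := Num.min 1 (e / (2 * D)).
have e'0 : 0 < e' by rewrite lt_min ltr01 divr_gt0// mulr_gt0.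
have e'1 : e' <= 1 by rewrite ge_min lexx.
have e'e : D * e' <= e / 2.
  apply: (@le_trans _ _ (D * (e / (2 * D)))).
    by rewrite ler_pM2l// ge_min lexx orbT.
  by rewrite le_eqVlt; apply/orP; left; apply/eqP; field; rewrite gt_eqF.
have /choice[K0 hK0] j := hCt (u j 0) e' (u01 j) e'0.
pose K := (\max_j K0 j)%N.
have /choice[c hc] j := hK0 j K (leq_bigmax j).
have ce j k : c j (- k) = c j k by have [h1 _ _] := hc j.
have cb j (k : int) : `|k| <= K%:Z -> `|c j k| <= Ct * omega (u j 0) k%:~R ^+ r.+2.
  by have [_ h2 _] := hc j; exact: h2.
have ca j x : `|perhat r.+2 (u j 0) x - tpoly K (c j) x| <= e' by have [_ _ h3] := hc j.
have pB j x : `|tpoly K (c j) x| <= B.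
  by apply: le_trans (tpoly_norm_le Ct0 (u01 j) (cb j) x) _; rewrite lerDl.
have hB j x : `|perhat r.+2 (u j 0) x| <= B.
  have := tpoly_norm_le Ct0 (u01 j) (cb j) x; have := ca j x.
  have := ler_normD (perhat r.+2 (u j 0) x - tpoly K (c j) x) (tpoly K (c j) x).
  by rewrite subrK /B; lra.
have err1 : `|cubature a (fun x => \prod_j h j (x j 0)) -
    cubature a (fun x => \prod_j tpoly K (c j) (x j 0 - z j 0))| <= D * e'.
  apply: cubature_dist_le => // x.
  apply: (prod_dist_le B1 (ltW e'0)) => j; [exact: hB|exact: pB|exact: ca].
have ci j : `|iint (h j) 0 1 - c j 0| <= e'.
  rewrite -(iint_tpoly K (c j) (z j 0)) -[leRHS]mulr1 -[X in _ * X]subr0.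
  apply: iint_dist_le => //; last by move=> y; exact: ca.
  by apply: (shift_cont (tpoly K (c j))); exact: tpoly_continuous.
have c0B j : `|c j 0| <= 16 * Ct.
  have ui : 0 <= u j 0 <= 1 by have := u01 j; lra.
  have := cb j 0; rewrite normr0 => /(_ isT) /le_trans; apply.
  have o1 : omega (u j 0) 0%:~R <= 1.
    by rewrite ler_pdivrMr ?max1_gt0// mul1r le_max; have := u01 j; lra.
  apply: (@le_trans _ _ (Ct * 1)); last lra.
  by rewrite ler_wpM2l// exprn_ile1// omega_ge0// ltW.
have err2 : `|\prod_j iint (h j) 0 1 - \prod_j c j 0| <= D * e'.
  apply: (prod_dist_le B1 (ltW e'0) _ _ ci) => j.
    have := ci j; have := c0B j.
    have := ler_normD (iint (h j) 0 1 - c j 0) (c j 0).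
    by rewrite subrK /B; lra.
  by apply: (le_trans (c0B j)); rewrite lerDl.
have err3 := hC a u n0 z K c Ct a1 hw Ct0 u01 hn0 hmin ce cb.
move: err1 err2 err3.
set I := \prod_j iint _ _ _; set P0 := \prod_j c j 0; set G := cubature a (fun x => \prod_j h _ _).
set T := cubature a _ => err1 err2 err3.
have -> : I - G = (I - P0) + - (T - P0) + - (G - T) by ring.
apply: (le_trans (ler_normD _ _)); rewrite normrN.
apply: (@le_trans _ _ (`|I - P0| + `|T - P0| + `|G - T|)).
  by rewrite lerD2r; apply: (le_trans (ler_normD _ _)); rewrite normrN.
by move: err1 err2 err3; set X := _ / a ^+ l; lra.
Qed.

End cubature_error.

(** * From dyadic levels to the logarithm *)

Lemma dyadic_exponent (R : realType) (x : R) D :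
  exists n, x <= 2 ^+ (n + D) /\ forall m, x <= 2 ^+ (m + D) -> (n <= m)%N.
Proof.
have ex : exists n, x <= 2 ^+ (n + D).
  exists (Num.truncn x).+1; apply: (le_trans (ltW (truncnS_gt x))).
  rewrite -natrX ler_nat (leq_trans (ltnW (ltn_expl _ (ltnSn 1))))//.
  by rewrite leq_exp2l// leq_addr.
by exists (ex_minn ex); case: ex_minnP.
Qed.

(** The exponent is at most [log2 (c * t / 2) + 1], and for [t >= 2] the constants and
    [ln c] are absorbed by multiples of [ln t]. *)
Lemma dyadic_exponent_le (R : realType) (c t : R) n D : 1 <= c -> 2 <= t ->
  (forall m, c * t / 2 <= 2 ^+ (m + D) -> (n <= m)%N) ->
  n.+1%:R <= (3 + ln c / ln 2) / ln 2 * ln t.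
Proof.
move=> c1 t2 hn; have l2 : 0 < ln 2 :> R by rewrite ln_gt0// ltr1n.
have lc : 0 <= ln c by rewrite ln_ge0.
have lt2 : ln 2 <= ln t by rewrite ler_ln ?posrE//; lra.
have lct : ln c <= ln c / ln 2 * ln t.
  by rewrite mulrAC -mulrA ler_peMr// ler_pdivlMr// mul1r.
rewrite mulrAC ler_pdivlMr// mulrDl.
case: n hn => [|n] hn; first by rewrite mul1r; lra.
have : n%:R * ln 2 <= ln (c * t / 2).
  have nX : 2 ^+ (n + D) <= c * t / 2.
    by rewrite leNgt; apply/negP => /ltW /hn; rewrite ltnn.
  rewrite mulr_natl -lnXn// ler_ln ?posrE ?exprn_gt0//.
    apply: le_trans nX; by rewrite ler_weXn2l ?ler1n// leq_addr.
  by apply: lt_le_trans nX; rewrite exprn_gt0.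
have -> : ln (c * t / 2) = ln c + ln t - ln 2.
  by rewrite ln_div ?posrE ?mulr_gt0// ?lnM ?posrE//; lra.
by rewrite -[n.+2%:R]natr1 -[n.+1%:R]natr1 !mulrDl !mul1r; lra.
Qed.

Theorem corollary1p2 (R : realType) (d r : nat) (A : 'M[R]_d) :
  (2 <= d)%N -> (2 <= r)%N -> frolov_matrix A ->
  exists c C : R, 0 < c /\
    forall a v : R, 1 < a ->
      let v0 := c * a ^- d in
      v0 <= v ->
      (per_disc r (frolov_points a A) v
        <= (C * a ^- (r * d) * ln (2 * v / v0) ^+ d.-1)%:E)%E.
Proof.
case: d A => [|d] A //; case: r => [|[|r]] // _ _ frA.
have [S [M [SM S0 S1 Sh]]] := smooth_step (R := R) (r.+2 * d.+1).*2.
have Au : A \in unitmx by case: frA.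
have [c0 [a0 [c00 a01 hw]]] := tplateau_sum_ge Au S0 S1 Sh SM.
have [C C0 herr] := cubature_hat_error frA S0 S1 Sh SM c00.
(* An admissible [u] has [pr u <= 1], so [c * a ^- d.+1 <= v] forces [a0 <= a] for this
   [c]; without admissible [u] the supremum is 0. *)
pose c := a0 ^+ d.+1; have c1 : 1 <= c by exact: exprn_ege1.
have cp : 0 < c by exact: lt_le_trans c1.
pose B := (3 + ln c / ln 2) / ln 2.
exists c, (C * B ^+ d); split=> // a v a1 v0 hv.
have a1' := ltW a1; have ap : 0 < a := lt_trans ltr01 a1.
have aD : 0 < a ^+ d.+1 by exact: exprn_gt0.
have v00 : 0 < v0 by rewrite mulr_gt0// invr_gt0.
pose t := 2 * v / v0; rewrite -/t.
have t2 : 2 <= t by rewrite /t ler_pdivlMr// ler_wpM2l.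
have tE : c * t / 2 = a ^+ d.+1 * v by rewrite /t /v0; field; rewrite !gt_eqF.
have lt0 : 0 <= ln t by rewrite ln_ge0//; lra.
have B0 : 0 <= B.
  have l2 : 0 < ln 2 :> R by rewrite ln_gt0// ltr1n.
  apply: divr_ge0; last exact: ltW.
  by apply: addr_ge0 => //; apply: divr_ge0; [exact: ln_ge0|exact: ltW].
pose E := C * B ^+ d * a ^- (r.+2 * d.+1) * ln t ^+ d.
have E0 : 0 <= E.
  apply: mulr_ge0; last exact: exprn_ge0.
  apply: mulr_ge0; first by apply: mulr_ge0 => //; exact: exprn_ge0.
  by rewrite invr_ge0 exprn_ge0// ltW.
rewrite -/E; set xi := frolov_points a A.
(* Distinct lattice points with the same fractional parts keep separate weights, indexed
   by their common position in the two lists. *)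
pose lam (mu : 'I_(size xi)) :=
  let x := nth 0 (fset_set (frolov_set a A)) mu in
  tplateau S x / total_weight A S a.
apply: le_trans (ereal_inf_lbound _) _; first by exists lam.
apply: ge_ereal_sup => _ [->|[[z u] /= [z01 u01 uv] <-]]; rewrite lee_fin//.
have u0 j : 0 < u j 0 by have := u01 j; lra.
have a0a : a0 <= a.
  have v1 : v <= 1.
    rewrite -uv /pr; apply: prodr_ile1 => j _; have := u01 j; lra.
  have : a0 ^+ d.+1 <= a ^+ d.+1.
    rewrite -/c; apply: (@le_trans _ _ (a ^+ d.+1 * v)).
      by rewrite -tE -mulrA ler_peMr ?(ltW cp)//; lra.
    by rewrite ler_piMr// ltW.
  by rewrite ler_pXn2r // nnegrE (le_trans ler01).
have -> : per_error r.+2 lam z u = cube_integral (fun x => hat_per r.+2 x z u) -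
    cubature A S a (fun x => hat_per r.+2 x z u).
  congr (_ - _); rewrite /cubature (big_nth 0) big_mkord.
  have sz : size xi = size (fset_set (frolov_set a A)) by rewrite size_map.
  rewrite -sz; apply: eq_bigr => mu _; congr (_ * _).
  rewrite (tnth_nth 0) /= (nth_map 0) -?sz// !hat_per_prod//; apply: eq_bigr => j _.
  set x := nth _ _ _; rewrite /frac_vec mxE.
  by rewrite -[RHS](perhat_periodic _ _ _ (- Num.floor (x j 0))) intrN addrAC.
have [n0 [hn0 hmin]] := dyadic_exponent (a ^+ d.+1 * v) d.+1.
rewrite -uv in hn0 hmin.
apply: le_trans (herr a u n0 z a1' (hw a a0a) u01 hn0 hmin) _.
have hB : n0.+1%:R <= B * ln t.
  by apply: (dyadic_exponent_le (D := d.+1)) => // m; rewrite tE -uv; exact: hmin.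
rewrite /E [leRHS]mulrAC ler_wpM2r ?invr_ge0 ?exprn_ge0 ?(ltW ap)//.
rewrite -mulrA; apply: ler_wpM2l => //; rewrite -exprMn.
by rewrite lerXn2r ?nnegrE // ?(le_trans _ hB)//.
Qed.
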